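(* Let $\tau\in\mathbf{C}$ satisfy $-\frac12<\Re(\tau)\le\frac12$, $\Im(\tau)>0$, $|\tau|\ge 1$, and $\Re(\tau)\ge 0$ if $|\tau|=1$. Then for every $s\in\mathbf{C}$ with $\Re(s)>2$, $$\widetilde{E}_s(\tau)=2\cos\left(\frac{\pi}{2}s\right)\frac{\Gamma(1-s)\,e^{-is\pi}}{i\pi}\int_C z^{s-1}F(s,z)\,dz,$$ where $$F(s,z)=e^{-is\pi/2}\,e^{-z}\frac{\cosh^2(\tau z/2)}{1-2e^{-z}\cosh(\tau z)+e^{-2z}}+e^{i\tau z}\frac{\cos^2(z/2)}{1-2e^{i\tau z}\cos(z)+e^{2i\tau z}}$$ and $C$ is the contour described in the context. At integers $s\ge3$, where $\Gamma(1-s)$ has a pole, the right-hand side is understood as its limit (removable singularity).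
   Context: Definition of $\widetilde E_s$: $$\widetilde{E}_s(\tau)=\lim_{K\to\infty}\sum_{|m|,|n|\le K}\frac{1}{(m+n\tau)^s},$$ over integers $m,n$, omitting $m=n=0$. For non-integer $s$ the lattice power is $\omega^s=|\omega|^s e^{is\arg\omega}$ with $\theta\le\arg(\omega)\le\theta+2\pi$, $\theta=\mathrm{Arg}(-1-\tau)\in(-\pi,-\pi/2)$ (cut along $\{-t(1+\tau):t>0\}$), and for lattice points on the cut ($\omega=-m-m\tau$, $m\ge 1$) the two boundary values are averaged: $\frac{1}{(-m-m\tau)^s}:=\frac{1}{2(m|1+\tau|)^s}\left(e^{-i\theta s}+e^{-i(\theta+2\pi)s}\right)$. Contour and branch in the integral: apart from $z=0$, the singularities of $F(s,\cdot)$ lie in $P=\{\pm\frac{2\pi i}{1\pm\tau}m,\ \pm\frac{2\pi}{1\pm\tau}n : m,n\in\mathbf{N}, m,n\ge1\}$ (all sign choices). Let $\rho=\min_{z\in P}|z|$. The contour $C$ begins at $\infty+iy$ with $y>0$, runs parallel to the real axis until it meets the circle of radius $r$ centered at the origin, where $y<r<\rho$, follows this circle counterclockwise around the origin, and runs back out to $\infty-iy$ parallel to the real axis; $y>0$ is small enough that $C$ encloses only the singularity at $z=0$. The factor $z^{s-1}$ has its branch cut along the positive real axis, with $0<\arg z<2\pi$, so that for $\lambda>0$, $\lim_{y\to0^+}(\lambda+iy)^{s-1}=\lambda^{s-1}$ and $\lim_{y\to0^+}(\lambda-iy)^{s-1}=e^{2\pi i(s-1)}\lambda^{s-1}$. 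*)

(* Defs.v *)
From Stdlib Require Import Reals ZArith.
From Coquelicot Require Import Coquelicot.
Open Scope C_scope.

Definition Cexp (z : C) : C :=
  RtoC (exp (Re z)) * (cos (Im z), sin (Im z)).

Definition Ccos (z : C) : C := (Cexp (Ci * z) + Cexp (- (Ci * z))) / 2.

Definition Ccosh (z : C) : C := (Cexp z + Cexp (- z)) / 2.

(* Principal argument, in (-PI, PI]; the value at 0 is irrelevant. *)
Definition Carg (z : C) : R :=
  if Rle_dec 0 (Im z) then acos (Re z / Cmod z)
  else (- acos (Re z / Cmod z))%R.

(* For -PI < theta <= PI: the argument of z lying in [theta, theta + 2 PI). *)
Definition Carg_from (theta : R) (z : C) : R :=
  if Rle_dec theta (Carg z) then Carg z else (Carg z + 2 * PI)%R.

(* x ^ s for a real base x > 0 *)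
Definition Rcpow (x : R) (s : C) : C := Cexp (s * RtoC (ln x)).

(* z ^ s with the branch cut along the ray of argument theta *)
Definition Cpow_cut (theta : R) (z s : C) : C :=
  Rcpow (Cmod z) s * Cexp (Ci * s * RtoC (Carg_from theta z)).

Fixpoint rising (z : C) (n : nat) : C :=
  match n with
  | O => z
  | S k => rising z k * (z + RtoC (INR (S k)))
  end.

Definition CLim_seq (u : nat -> C) : C :=
  (real (Lim_seq (fun n => Re (u n))), real (Lim_seq (fun n => Im (u n)))).

(* Euler-Gauss limit  n! n^z / (z (z+1) ... (z+n)),  which gives Gamma on the
   whole plane except at its poles 0, -1, -2, ... *)
Definition CGamma (z : C) : C :=
  CLim_seq (fun n => RtoC (INR (fact n)) * Rcpow (INR n) z / rising z n).

Definition theta_cut (tau : C) : R := Carg (- 1 - tau).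

(* The summand 1 / (m + n tau)^s.  Since tau is not real, m + n tau lies on the
   cut exactly when m = n < 0; there |m + n tau| = (-m) |1 + tau| and the two
   boundary values are averaged. *)
Definition lattice_term (tau s : C) (m n : Z) : C :=
  if (Z.eqb m 0 && Z.eqb n 0)%bool then 0
  else if (Z.eqb m n && Z.ltb m 0)%bool then
    1 / (2 * Rcpow (IZR (- m) * Cmod (1 + tau)) s)
    * (Cexp (- (Ci * RtoC (theta_cut tau) * s))
       + Cexp (- (Ci * RtoC (theta_cut tau + 2 * PI) * s)))
  else
    1 / Cpow_cut (theta_cut tau) (RtoC (IZR m) + RtoC (IZR n) * tau) s.

(* sum over |m|, |n| <= K *)
Definition Etilde_partial (tau s : C) (K : nat) : C :=
  sum_n (fun i => sum_n (fun j =>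
    lattice_term tau s (Z.of_nat i - Z.of_nat K)%Z (Z.of_nat j - Z.of_nat K)%Z)
    (2 * K)%nat) (2 * K)%nat.

Definition is_Etilde (tau s E : C) : Prop :=
  filterlim (Etilde_partial tau s) eventually (locally E).

Definition F (tau s z : C) : C :=
  Cexp (- (Ci * s * RtoC PI / 2)) *
    (Cexp (- z) *
      ((Ccosh (tau * z / 2) * Ccosh (tau * z / 2))
       / (1 - 2 * Cexp (- z) * Ccosh (tau * z) + Cexp (- (2 * z)))))
  + Cexp (Ci * tau * z) *
      ((Ccos (z / 2) * Ccos (z / 2))
       / (1 - 2 * Cexp (Ci * tau * z) * Ccos z + Cexp (2 * Ci * tau * z))).

(* The set P of nonzero candidate singularities of F tau s. *)
Definition sing (tau z : C) : Prop :=
  exists (m : nat) (e e' : R),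
    (1 <= m)%nat /\ (e = 1 \/ e = -1)%R /\ (e' = 1 \/ e' = -1)%R /\
    (z = RtoC e * (2 * RtoC PI * Ci / (1 + RtoC e' * tau)) * RtoC (INR m) \/
     z = RtoC e * (2 * RtoC PI / (1 + RtoC e' * tau)) * RtoC (INR m)).

Definition is_min_modulus (P : C -> Prop) (rho : R) : Prop :=
  (exists z, P z /\ Cmod z = rho) /\ (forall z, P z -> (rho <= Cmod z)%R).

(* The region bounded by the contour, contour included. *)
Definition enclosed (r y : R) (z : C) : Prop :=
  (Cmod z <= r)%R \/ (0 <= Re z /\ Rabs (Im z) <= y)%R.

(* The contour is the incoming ray oo + i y -> x0 + i y with
   x0 = sqrt (r^2 - y^2), the arc r e^(i phi) with phi from asin (y/r) to
   2 PI - asin (y/r), and the outgoing ray x0 - i y -> oo - i y. *)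
Definition on_upper_ray (f : C -> C) (y t : R) : C := f (t, y).
Definition on_lower_ray (f : C -> C) (y t : R) : C := f (t, (- y)%R).
Definition on_arc (f : C -> C) (r phi : R) : C :=
  f (RtoC r * Cexp (Ci * RtoC phi)) * (Ci * RtoC r * Cexp (Ci * RtoC phi)).

Definition ray_start (r y : R) : R := sqrt (r ^ 2 - y ^ 2).
Definition arc_start (r y : R) : R := asin (y / r).
Definition arc_end (r y : R) : R := (2 * PI - asin (y / r))%R.

Definition ex_contour_integral (f : C -> C) (r y : R) : Prop :=
  ex_RInt_gen (V := C_R_NormedModule) (on_upper_ray f y)
    (Rbar_locally p_infty) (at_point (ray_start r y)) /\
  ex_RInt (V := C_R_NormedModule) (on_arc f r) (arc_start r y) (arc_end r y) /\
  ex_RInt_gen (V := C_R_NormedModule) (on_lower_ray f y)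
    (at_point (ray_start r y)) (Rbar_locally p_infty).

Definition contour_integral (f : C -> C) (r y : R) : C :=
  RInt_gen (V := C_R_CompleteNormedModule) (on_upper_ray f y)
    (Rbar_locally p_infty) (at_point (ray_start r y))
  + RInt (V := C_R_CompleteNormedModule) (on_arc f r)
      (arc_start r y) (arc_end r y)
  + RInt_gen (V := C_R_CompleteNormedModule) (on_lower_ray f y)
      (at_point (ray_start r y)) (Rbar_locally p_infty).

(* z^(s-1) F(s,z) with 0 < arg z < 2 PI *)
Definition integrand (tau s z : C) : C := Cpow_cut 0 z (s - 1) * F tau s z.

Definition contour_side (tau : C) (r y : R) (s : C) : C :=
  2 * Ccos (RtoC PI / 2 * s)
  * (CGamma (1 - s) * Cexp (- (Ci * s * RtoC PI)) / (Ci * RtoC PI))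
  * contour_integral (integrand tau s) r y.

(* Main.v *)
(** Put [z = e^w].  The function [e^(s w) F(s, e^w)] has an explicit primitive on the region
    enclosed by the contour, namely its integral along the horizontal half line ending at [w]:
    the region is star-shaped about [0] in the variable [z], and the double pole of [F] at [0] is
    beaten by [Re s > 2].  The contour integral is therefore [(e^(2 pi i s) - 1) X], where [X] is
    the Mellin integral of [F] on the positive axis.

    Each of the two summands of [F] has the form
    [(a + b + 2 sqrt (a b)) / (4 (1 - a) (1 - b))] with [a = e^(- (al - be) z)] and
    [b = e^(- (al + be) z)], which is half of the sum of [e^(- (m al + n be) z)] over the cone
    [|n| <= m], [m >= 1], with half weights on the two boundary rays.  Integrating term by term,
    [X] becomes [Gamma(s) / 2] times a combination of two cone sums of [(m al + n be)^(- s)].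
    Up to sign and rotation by [i], four such cones tile the lattice, the averaged values on the
    cut being exactly the two half-weighted boundary values, so that the truncation of the lattice
    sum to a square is a combination of truncated cone sums.  What remains is the reflection
    formula for [Gamma], obtained from the Gauss limit and Euler's sine product.  At integers [s]
    the identity passes to the limit because the cone sums are continuous in [s]. *)

Require Import Defs.
From Stdlib Require Import Reals ZArith.
From Coquelicot Require Import Coquelicot.
From Stdlib Require Import Lra Lia ClassicalEpsilon FunctionalExtensionality.
Open Scope C_scope.

(** * Complex-valued functions of a real variable *)

Local Notation is_CInt := (@is_RInt C_R_NormedModule) (only parsing).
Local Notation CInt := (@RInt C_R_CompleteNormedModule) (only parsing).
Local Notation is_Cderive := (@is_derive R_AbsRing C_R_NormedModule) (only parsing).
Local Notation Ccontinuous f x := (@continuous _ C_UniformSpace f x) (only parsing).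

(** Cauchy's theorem enters only through the truncated primitive [leftprim]: differentiating the
    integral over a horizontal segment of length N gives h(w) - h(w - N) exactly, and the term at w
    - N dies by the decay at the left end. The same device turns the ray of the Gamma integral and
    compares the two rays of the contour with the positive axis. In the variable w the branch of the
    power is no longer a cut but the translation by 2 pi i, which multiplies the integrand by e^(2
    pi i s). All integrals over the line are controlled by one majorant e^(q u - eta e^u), whose
    integral is at most a constant times eta^(-q). With eta proportional to the number K of shells
    this is an explicit rate for the exchange of sum and integral; with eta = N it is the rate in
    the Gauss limit. Hence no dominated convergence is invoked. Write S1, S2 for the two cone sums
    and u = e^(i pi s / 2): the lattice sum is (u + 1/u)(S1/u + S2), and u + 1/u is the factor 2
    cos(pi s / 2) of the statement. *)

Lemma C_eq (z w : C) : Re z = Re w -> Im z = Im w -> z = w.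
Proof. destruct z, w; simpl; intros; subst; reflexivity. Qed.

Lemma Cmod_le_abs (z : C) : (Cmod z <= Rabs (Re z) + Rabs (Im z))%R.
Proof.
  replace z with (RtoC (Re z) + Ci * RtoC (Im z)) at 1 by (apply C_eq; simpl; ring).
  eapply Rle_trans; [apply Cmod_triangle|]. rewrite Cmod_mult, Cmod_Ci, !Cmod_R. lra.
Qed.

Lemma im_le_Cmod (z : C) : (Rabs (Im z) <= Cmod z)%R.
Proof. eapply Rle_trans; [|apply Rmax_Cmod]. apply Rmax_r. Qed.

Lemma Cmod_minus_sym (x y : C) : Cmod (x - y) = Cmod (y - x).
Proof. rewrite <- Cmod_opp. f_equal. ring. Qed.

Lemma Cmod_triangle_minus (x y : C) : (Cmod x - Cmod y <= Cmod (x - y))%R.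
Proof.
  assert (H := Cmod_triangle (x - y) y). replace (x - y + y) with x in H by ring. lra.
Qed.

Section Continuity.
Context {T : UniformSpace}.

Lemma continuous_C_pair (f : T -> C) (x : T) :
  continuous (fun t => Re (f t)) x -> continuous (fun t => Im (f t)) x -> Ccontinuous f x.
Proof.
  intros H1 H2.
  apply (filterlim_ext (fun t => (Re (f t), Im (f t)))).
  { intros t. destruct (f t); reflexivity. }
  apply filterlim_locally. intros eps.
  assert (A := proj1 (filterlim_locally _ _) H1 eps).
  assert (B := proj1 (filterlim_locally _ _) H2 eps).
  generalize (filter_and _ _ A B). apply filter_imp. intros t [A' B']. split; assumption.
Qed.

Lemma continuous_Re (f : T -> C) (x : T) : Ccontinuous f x -> continuous (fun t => Re (f t)) x.
Proof.
  intros H. apply (continuous_comp f (fun z : C => Re z)); [exact H|].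
  destruct (f x). apply continuous_fst.
Qed.

Lemma continuous_Im (f : T -> C) (x : T) : Ccontinuous f x -> continuous (fun t => Im (f t)) x.
Proof.
  intros H. apply (continuous_comp f (fun z : C => Im z)); [exact H|].
  destruct (f x). apply continuous_snd.
Qed.

Lemma continuous_RtoC (f : T -> R) (x : T) : continuous f x -> Ccontinuous (fun t => RtoC (f t)) x.
Proof.
  intros H. apply continuous_C_pair; simpl; [exact H|apply continuous_const].
Qed.

Lemma continuous_Cplus (f g : T -> C) (x : T) :
  Ccontinuous f x -> Ccontinuous g x -> Ccontinuous (fun t => f t + g t) x.
Proof.
  intros Hf Hg. apply continuous_C_pair; simpl.
  - apply (continuous_plus (fun t => Re (f t)) (fun t => Re (g t))); apply continuous_Re; assumption.
  - apply (continuous_plus (fun t => Im (f t)) (fun t => Im (g t))); apply continuous_Im; assumption.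
Qed.

Lemma continuous_Copp (f : T -> C) (x : T) :
  Ccontinuous f x -> Ccontinuous (fun t => - f t) x.
Proof.
  intros Hf. apply continuous_C_pair; simpl.
  - apply (continuous_opp (fun t => Re (f t))); apply continuous_Re; assumption.
  - apply (continuous_opp (fun t => Im (f t))); apply continuous_Im; assumption.
Qed.

Lemma continuous_Cminus (f g : T -> C) (x : T) :
  Ccontinuous f x -> Ccontinuous g x -> Ccontinuous (fun t => f t - g t) x.
Proof. intros. apply continuous_Cplus; [|apply continuous_Copp]; assumption. Qed.

Lemma continuous_Cmult (f g : T -> C) (x : T) :
  Ccontinuous f x -> Ccontinuous g x -> Ccontinuous (fun t => f t * g t) x.
Proof.
  intros Hf Hg.
  assert (A := continuous_Re _ _ Hf). assert (B := continuous_Im _ _ Hf).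
  assert (A' := continuous_Re _ _ Hg). assert (B' := continuous_Im _ _ Hg).
  apply continuous_C_pair; simpl.
  - apply (continuous_minus (fun t => Re (f t) * Re (g t))%R (fun t => Im (f t) * Im (g t))%R);
    apply (continuous_mult (K := R_AbsRing)); assumption.
  - apply (continuous_plus (fun t => Re (f t) * Im (g t))%R (fun t => Im (f t) * Re (g t))%R);
    apply (continuous_mult (K := R_AbsRing)); assumption.
Qed.

Lemma continuous_comp_R (f : T -> R) (g : R -> R) (x : T) :
  continuous f x -> continuous g (f x) -> continuous (fun t => g (f t)) x.
Proof. intros. apply continuous_comp; assumption. Qed.

Lemma continuous_Cmod (f : T -> C) (x : T) :
  Ccontinuous f x -> continuous (fun t => Cmod (f t)) x.
Proof.
  intros Hf. unfold Cmod.
  assert (A := continuous_Re _ _ Hf). assert (B := continuous_Im _ _ Hf).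
  apply (continuous_comp_R (fun t => (fst (f t)) ^ 2 + (snd (f t)) ^ 2)%R sqrt).
  - apply (continuous_plus (fun t => (fst (f t))^2)%R (fun t => (snd (f t))^2)%R).
    + apply (continuous_comp_R (fun t => fst (f t)) (fun x => x^2)%R); [exact A|].
      apply (@ex_derive_continuous R_AbsRing R_NormedModule). auto_derive; trivial.
    + apply (continuous_comp_R (fun t => snd (f t)) (fun x => x^2)%R); [exact B|].
      apply (@ex_derive_continuous R_AbsRing R_NormedModule). auto_derive; trivial.
  - apply continuous_sqrt.
Qed.

Lemma continuous_Cinv (f : T -> C) (x : T) :
  f x <> 0 -> Ccontinuous f x -> Ccontinuous (fun t => / f t) x.
Proof.
  intros H0 Hf.
  assert (A := continuous_Re _ _ Hf). assert (B := continuous_Im _ _ Hf).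
  assert (D : continuous (fun t => / (Re (f t) ^ 2 + Im (f t) ^ 2))%R x).
  { apply (continuous_comp_R (fun t => Re (f t) ^ 2 + Im (f t) ^ 2)%R Rinv).
    - apply (continuous_plus (fun t => (Re (f t))^2)%R (fun t => (Im (f t))^2)%R).
      + apply (continuous_comp_R (fun t => Re (f t)) (fun x => x^2)%R); [exact A|].
        apply (@ex_derive_continuous R_AbsRing R_NormedModule). auto_derive; trivial.
      + apply (continuous_comp_R (fun t => Im (f t)) (fun x => x^2)%R); [exact B|].
        apply (@ex_derive_continuous R_AbsRing R_NormedModule). auto_derive; trivial.
    - apply continuous_Rinv. intros E. apply H0. apply C_eq; simpl; nra. }
  apply continuous_C_pair; unfold Cinv; simpl.
  - apply (continuous_mult (K := R_AbsRing)); assumption.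
  - apply (continuous_mult (K := R_AbsRing)); [|assumption].
    apply (continuous_opp (fun t => Im (f t))). exact B.
Qed.

Lemma continuous_Cdiv (f g : T -> C) (x : T) :
  g x <> 0 -> Ccontinuous f x -> Ccontinuous g x -> Ccontinuous (fun t => f t / g t) x.
Proof. intros. apply continuous_Cmult; [|apply continuous_Cinv]; assumption. Qed.

Lemma continuous_Cexp (f : T -> C) (x : T) :
  Ccontinuous f x -> Ccontinuous (fun t => Cexp (f t)) x.
Proof.
  intros Hf. unfold Cexp.
  assert (A := continuous_Re _ _ Hf). assert (B := continuous_Im _ _ Hf).
  apply continuous_Cmult.
  - apply continuous_RtoC. apply (continuous_comp_R _ exp); [exact A|].
    apply continuous_exp.
  - apply continuous_C_pair; simpl.
    + apply (continuous_comp_R _ cos); [exact B|apply continuous_cos].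
    + apply (continuous_comp_R _ sin); [exact B|apply continuous_sin].
Qed.

End Continuity.

(** * The complex exponential *)

Lemma Cexp_add (z w : C) : Cexp (z + w) = Cexp z * Cexp w.
Proof.
  destruct z as [a b], w as [c d]. apply C_eq; simpl; rewrite exp_plus, ?cos_plus, ?sin_plus; ring.
Qed.

Lemma Cexp_0 : Cexp 0 = 1.
Proof. apply C_eq; simpl; rewrite exp_0, ?cos_0, ?sin_0; ring. Qed.

Lemma Cmod_Cexp (z : C) : Cmod (Cexp z) = exp (Re z).
Proof.
  unfold Cexp. rewrite Cmod_mult, Cmod_R, Rabs_pos_eq by (left; apply exp_pos).
  unfold Cmod; simpl. replace (_ + _)%R with 1%R; [rewrite sqrt_1; ring|].
  assert (H := sin2_cos2 (Im z)). unfold Rsqr in H. lra.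
Qed.

Lemma Cexp_nz (z : C) : Cexp z <> 0.
Proof. apply Cmod_gt_0. rewrite Cmod_Cexp. apply exp_pos. Qed.

Lemma Cexp_opp (z : C) : Cexp (- z) = / Cexp z.
Proof.
  assert (H : Cexp z * Cexp (- z) = 1) by (rewrite <- Cexp_add, <- Cexp_0; f_equal; ring).
  replace (Cexp (- z)) with (/ Cexp z * (Cexp z * Cexp (- z))); [rewrite H; ring|].
  field. apply Cexp_nz.
Qed.

Lemma Cexp_opp_l (z : C) : Cexp (- z) * Cexp z = 1.
Proof. rewrite <- Cexp_add, <- Cexp_0. f_equal. ring. Qed.

Lemma Cexp_RtoC (x : R) : Cexp (RtoC x) = RtoC (exp x).
Proof. apply C_eq; simpl; rewrite ?cos_0, ?sin_0; ring. Qed.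

Lemma Cexp_INR_mult (n : nat) (z : C) : Cexp (RtoC (INR n) * z) = Cexp z ^ n.
Proof.
  induction n as [|n IH].
  - simpl. rewrite Cmult_0_l. apply Cexp_0.
  - rewrite S_INR, RtoC_plus, Cmult_plus_distr_r, Cexp_add, IH, Cmult_1_l. simpl. ring.
Qed.

Lemma cos_sin_2PI (k : Z) : (cos (2 * IZR k * PI) = 1 /\ sin (2 * IZR k * PI) = 0)%R.
Proof.
  assert (H : forall n : nat, (cos (2 * INR n * PI) = 1 /\ sin (2 * INR n * PI) = 0)%R).
  { intros n. rewrite <- (Rplus_0_l (2 * INR n * PI)), cos_period, sin_period, cos_0, sin_0. auto. }
  destruct (Z_le_dec 0 k).
  - rewrite <- (Z2Nat.id k), <- INR_IZR_INZ by lia. apply H.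
  - assert (E : (2 * IZR k * PI)%R = (- (2 * INR (Z.to_nat (- k)) * PI))%R).
    { rewrite INR_IZR_INZ, Z2Nat.id, opp_IZR by lia. ring. }
    rewrite E, cos_neg, sin_neg. destruct (H (Z.to_nat (- k))) as [-> ->]. split; ring.
Qed.

Lemma Cexp_2PI (k : Z) : Cexp (Ci * RtoC (2 * IZR k * PI)) = 1.
Proof.
  destruct (cos_sin_2PI k) as [Hc Hs].
  apply C_eq; simpl; replace (0 * (2 * IZR k * PI) - 1 * 0)%R with 0%R by ring;
  replace (0 * 0 + 1 * (2 * IZR k * PI))%R with (2 * IZR k * PI)%R by ring;
  rewrite exp_0, ?Hc, ?Hs; ring.
Qed.

Lemma Cexp_PI : Cexp (Ci * RtoC PI) = - (1).
Proof.
  apply C_eq; simpl; replace (0 * PI - 1 * 0)%R with 0%R by ring;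
  replace (0 * 0 + 1 * PI)%R with PI by ring; rewrite exp_0, cos_PI, sin_PI; ring.
Qed.

(** The modulus forces the real part to vanish; then cos (Im z) = 1 is rewritten as sin (Im z / 2) =
    0, whose zeros are the integral multiples of pi. *)
Lemma Cexp_eq_1 (z : C) : Cexp z = 1 -> exists k : Z, z = RtoC (2 * IZR k * PI) * Ci.
Proof.
  intros H. assert (Hr : Re z = 0%R).
  { apply exp_inv. rewrite exp_0, <- Cmod_Cexp, H. apply Cmod_1. }
  assert (Hc : cos (Im z) = 1%R).
  { apply (f_equal Re) in H. unfold Cexp in H. simpl in H. rewrite Hr, exp_0 in H. lra. }
  assert (Hs : sin (Im z / 2) = 0%R).
  { replace (Im z) with (2 * (Im z / 2))%R in Hc by field. rewrite cos_2a_sin in Hc. nra. }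
  apply sin_eq_0_0 in Hs. destruct Hs as [k Hk]. exists k.
  apply C_eq; simpl; [rewrite Hr; ring|]. replace (Im z) with (2 * (Im z / 2))%R by field.
  rewrite Hk. ring.
Qed.

(** * Derivatives along a real variable *)

Lemma is_Cderive_pair (f : R -> C) (x : R) (l : C) :
  is_derive (fun t => Re (f t)) x (Re l) -> is_derive (fun t => Im (f t)) x (Im l) ->
  is_Cderive f x l.
Proof.
  intros H1 H2.
  assert (K1 := @is_derive_scal_l R_AbsRing C_R_NormedModule _ _ _ ((1%R, 0%R) : C) H1).
  assert (K2 := @is_derive_scal_l R_AbsRing C_R_NormedModule _ _ _ ((0%R, 1%R) : C) H2).
  assert (K := is_derive_plus _ _ _ _ _ K1 K2).
  refine (is_derive_ext _ _ _ _ _ (eq_ind _ (fun l => is_derive _ x l) K _ _)).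
  - intros t. apply C_eq; simpl; unfold plus, scal, mult; simpl; unfold mult; simpl; ring.
  - apply C_eq; simpl; unfold plus, scal, mult; simpl; unfold mult; simpl; ring.
Qed.

Lemma is_Cderive_Re (f : R -> C) (x : R) (l : C) :
  is_Cderive f x l -> is_derive (fun t => Re (f t)) x (Re l).
Proof.
  intros H. unfold is_derive in *.
  apply (filterdiff_comp' f (fun z : C => fst z) x (fun y => scal y l) (fun z : C => fst z) H).
  apply filterdiff_linear, is_linear_fst.
Qed.

Lemma is_Cderive_Im (f : R -> C) (x : R) (l : C) :
  is_Cderive f x l -> is_derive (fun t => Im (f t)) x (Im l).
Proof.
  intros H. unfold is_derive in *.
  apply (filterdiff_comp' f (fun z : C => snd z) x (fun y => scal y l) (fun z : C => snd z) H).
  apply filterdiff_linear, is_linear_snd.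
Qed.

Lemma is_Cderive_eq (f : R -> C) (x : R) (l l' : C) : is_Cderive f x l -> l = l' -> is_Cderive f x l'.
Proof. intros H <-. exact H. Qed.

Lemma is_Cderive_continuous (f : R -> C) (x : R) (l : C) : is_Cderive f x l -> Ccontinuous f x.
Proof. intros H. apply (@ex_derive_continuous R_AbsRing C_R_NormedModule). exists l. exact H. Qed.

Lemma is_derive_eq (f : R -> R) (x : R) (l l' : R) : is_derive f x l -> l = l' -> is_derive f x l'.
Proof. intros H <-. exact H. Qed.

Lemma is_Cderive_const (c : C) (x : R) : is_Cderive (fun _ => c) x (RtoC 0).
Proof. apply (@is_derive_const R_AbsRing C_R_NormedModule). Qed.

Lemma is_Cderive_plus (f g : R -> C) (x : R) (f' g' : C) :
  is_Cderive f x f' -> is_Cderive g x g' -> is_Cderive (fun t => f t + g t) x (f' + g').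
Proof. intros. apply (@is_derive_plus R_AbsRing C_R_NormedModule); assumption. Qed.

Lemma is_derive_Rmult (f g : R -> R) (x f' g' : R) :
  is_derive f x f' -> is_derive g x g' ->
  is_derive (fun t => f t * g t)%R x (f' * g x + f x * g')%R.
Proof. intros. apply (is_derive_mult (K := R_AbsRing)); auto. intros; apply Rmult_comm. Qed.

Lemma is_derive_Rplus (f g : R -> R) (x f' g' : R) :
  is_derive f x f' -> is_derive g x g' -> is_derive (fun t => f t + g t)%R x (f' + g')%R.
Proof. intros. apply (is_derive_plus f g); assumption. Qed.

Lemma is_derive_Rminus (f g : R -> R) (x f' g' : R) :
  is_derive f x f' -> is_derive g x g' -> is_derive (fun t => f t - g t)%R x (f' - g')%R.
Proof. intros. apply (is_derive_minus f g); assumption. Qed.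

Lemma is_Cderive_mult (f g : R -> C) (x : R) (f' g' : C) :
  is_Cderive f x f' -> is_Cderive g x g' ->
  is_Cderive (fun t => f t * g t) x (f' * g x + f x * g').
Proof.
  intros Hf Hg.
  assert (A := is_Cderive_Re _ _ _ Hf). assert (B := is_Cderive_Im _ _ _ Hf).
  assert (A' := is_Cderive_Re _ _ _ Hg). assert (B' := is_Cderive_Im _ _ _ Hg).
  apply is_Cderive_pair; simpl.
  - eapply is_derive_eq.
    + apply is_derive_Rminus; apply is_derive_Rmult; eassumption.
    + unfold Re, Im; simpl; ring.
  - eapply is_derive_eq.
    + apply is_derive_Rplus; apply is_derive_Rmult; eassumption.
    + unfold Re, Im; simpl; ring.
Qed.

Lemma is_derive_comp_R (f g : R -> R) (x f' g' : R) :
  is_derive f (g x) f' -> is_derive g x g' -> is_derive (fun t => f (g t)) x (f' * g')%R.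
Proof.
  intros. eapply is_derive_eq; [apply (is_derive_comp f g); eassumption|].
  unfold scal; simpl; unfold mult; simpl; ring.
Qed.

Lemma is_Cderive_exp (f : R -> C) (x : R) (f' : C) :
  is_Cderive f x f' -> is_Cderive (fun t => Cexp (f t)) x (Cexp (f x) * f').
Proof.
  intros Hf.
  assert (A := is_Cderive_Re _ _ _ Hf). assert (B := is_Cderive_Im _ _ _ Hf).
  unfold Cexp.
  eapply is_Cderive_eq.
  - apply is_Cderive_mult.
    + apply (is_Cderive_pair _ _ (RtoC (exp (Re (f x)) * Re f'))); simpl.
      * apply (is_derive_comp_R exp _ _ (exp (Re (f x)))); [apply is_derive_exp|exact A].
      * apply (@is_derive_const R_AbsRing R_NormedModule).
    + apply (is_Cderive_pair _ _ ((- sin (Im (f x)) * Im f')%R, (cos (Im (f x)) * Im f')%R)); simpl.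
      * apply (is_derive_comp_R cos); [apply is_derive_cos|exact B].
      * apply (is_derive_comp_R sin); [apply is_derive_sin|exact B].
  - apply C_eq; unfold Re, Im; simpl; ring.
Qed.

Lemma is_Cderive_RtoC (f : R -> R) (x f' : R) :
  is_derive f x f' -> is_Cderive (fun t => RtoC (f t)) x (RtoC f').
Proof.
  intros H. apply is_Cderive_pair; simpl; [exact H|].
  apply (@is_derive_const R_AbsRing R_NormedModule).
Qed.

Lemma is_Cderive_inv (f : R -> C) (x : R) (f' : C) :
  f x <> 0 -> is_Cderive f x f' -> is_Cderive (fun t => / f t) x (- f' / (f x * f x)).
Proof.
  intros H0 Hf.
  assert (A := is_Cderive_Re _ _ _ Hf). assert (B := is_Cderive_Im _ _ _ Hf).
  assert (D0 : (Re (f x) * Re (f x) + Im (f x) * Im (f x))%R <> 0%R).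
  { intros E. apply H0. apply C_eq; simpl; nra. }
  assert (D : is_derive (fun t => / (Re (f t) * Re (f t) + Im (f t) * Im (f t)))%R x
     (- (2 * (Re (f x) * Re f' + Im (f x) * Im f'))
      / (Re (f x) * Re (f x) + Im (f x) * Im (f x)) ^ 2)%R).
  { apply (is_derive_inv (fun t => Re (f t) * Re (f t) + Im (f t) * Im (f t))%R); [|exact D0].
    eapply is_derive_eq.
    - apply is_derive_Rplus; apply is_derive_Rmult; eassumption.
    - unfold Re, Im; simpl; ring. }
  apply (@is_derive_ext R_AbsRing C_R_NormedModule
    (fun t => (Re (f t), (- Im (f t))%R) * RtoC (/ (Re (f t) * Re (f t) + Im (f t) * Im (f t))))).
  { intros t. apply C_eq; unfold Re, Im, Rdiv; simpl; rewrite ?Rmult_1_r; unfold Rdiv; ring. }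
  eapply is_Cderive_eq.
  - apply is_Cderive_mult; [|apply is_Cderive_RtoC; exact D].
    apply (is_Cderive_pair _ _ (Re f', (- Im f')%R)); simpl; [exact A|].
    apply (is_derive_opp (fun t => Im (f t))). exact B.
  - destruct (f x) as [a b] eqn:E, f' as [a' b']; unfold Re, Im in *; simpl in *.
    assert (D1 : ((a * a - b * b) * (a * a - b * b) + (a * b + b * a) * (a * b + b * a))%R <> 0%R).
    { replace (_ + _)%R with ((a * a + b * b) * (a * a + b * b))%R by ring.
      apply Rmult_integral_contrapositive_currified; exact D0. }
    apply C_eq; unfold Re, Im; simpl; rewrite E; simpl; field; split; assumption.
Qed.

(* Complex differentiability is only ever used along real curves, which makes the chain rule
   part of the definition. *)
Definition Hol (Om : C -> Prop) (f f' : C -> C) : Prop :=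
  (forall z, Om z -> Ccontinuous f z) /\ (forall z, Om z -> Ccontinuous f' z) /\
  (forall (g : R -> C) (t : R) (g' : C), Om (g t) -> is_Cderive g t g' ->
     is_Cderive (fun u => f (g u)) t (f' (g t) * g')).

Definition hol (Om : C -> Prop) (f : C -> C) : Prop := exists f', Hol Om f f'.

Section Holomorphic.
Variable Om : C -> Prop.

Lemma hol_ext (f g : C -> C) : (forall z, f z = g z) -> hol Om f -> hol Om g.
Proof.
  intros E H. assert (f = g) by (apply functional_extensionality; exact E). subst. exact H.
Qed.

Lemma hol_const (c : C) : hol Om (fun _ => c).
Proof.
  exists (fun _ => 0). split; [|split]; intros; try apply continuous_const.
  eapply is_Cderive_eq; [apply is_Cderive_const|cbv beta; ring].
Qed.

Lemma hol_id : hol Om (fun z => z).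
Proof.
  exists (fun _ => 1). split; [|split]; intros; try apply continuous_const; try apply continuous_id.
  eapply is_Cderive_eq; [eassumption|cbv beta; ring].
Qed.

Lemma hol_plus (f g : C -> C) : hol Om f -> hol Om g -> hol Om (fun z => f z + g z).
Proof.
  intros [f' [F1 [F2 F3]]] [g' [G1 [G2 G3]]].
  exists (fun z => f' z + g' z). split; [|split]; intros.
  - apply continuous_Cplus; auto.
  - apply continuous_Cplus; auto.
  - eapply is_Cderive_eq; [apply is_Cderive_plus; eauto|cbv beta; ring].
Qed.

Lemma hol_mult (f g : C -> C) : hol Om f -> hol Om g -> hol Om (fun z => f z * g z).
Proof.
  intros [f' [F1 [F2 F3]]] [g' [G1 [G2 G3]]].
  exists (fun z => f' z * g z + f z * g' z). split; [|split]; intros.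
  - apply continuous_Cmult; auto.
  - apply continuous_Cplus; apply continuous_Cmult; auto.
  - eapply is_Cderive_eq; [apply is_Cderive_mult; eauto|cbv beta; ring].
Qed.

Lemma hol_opp (f : C -> C) : hol Om f -> hol Om (fun z => - f z).
Proof.
  intros H. apply (hol_ext (fun z => - (1) * f z)); [intros; ring|].
  apply hol_mult; [apply hol_const|exact H].
Qed.

Lemma hol_minus (f g : C -> C) : hol Om f -> hol Om g -> hol Om (fun z => f z - g z).
Proof. intros. apply hol_plus; [|apply hol_opp]; assumption. Qed.

Lemma hol_inv (f : C -> C) : (forall z, Om z -> f z <> 0) -> hol Om f -> hol Om (fun z => / f z).
Proof.
  intros H0 [f' [F1 [F2 F3]]].
  exists (fun z => - f' z / (f z * f z)). split; [|split]; intros.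
  - apply continuous_Cinv; auto.
  - apply continuous_Cdiv.
    + apply Cmult_neq_0; auto.
    + apply continuous_Copp; auto.
    + apply continuous_Cmult; auto.
  - eapply is_Cderive_eq; [apply is_Cderive_inv; eauto|]. cbv beta; field. auto.
Qed.

Lemma hol_div (f g : C -> C) :
  (forall z, Om z -> g z <> 0) -> hol Om f -> hol Om g -> hol Om (fun z => f z / g z).
Proof. intros. apply hol_mult; [|apply hol_inv]; assumption. Qed.

Lemma hol_exp (f : C -> C) : hol Om f -> hol Om (fun z => Cexp (f z)).
Proof.
  intros [f' [F1 [F2 F3]]].
  exists (fun z => Cexp (f z) * f' z). split; [|split]; intros.
  - apply continuous_Cexp; auto.
  - apply continuous_Cmult; [apply continuous_Cexp|]; auto.
  - eapply is_Cderive_eq; [apply is_Cderive_exp; eauto|cbv beta; ring].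
Qed.

End Holomorphic.

(** * Integrals over compact intervals *)

Lemma is_CInt_mult (f : R -> C) (a b : R) (c l : C) :
  is_CInt f a b l -> is_CInt (fun t => c * f t) a b (c * l).
Proof.
  intros H.
  assert (A := is_RInt_fct_extend_fst (U := R_NormedModule) (V := R_NormedModule) _ _ _ _ H).
  assert (B := is_RInt_fct_extend_snd (U := R_NormedModule) (V := R_NormedModule) _ _ _ _ H).
  apply (is_RInt_fct_extend_pair (U := R_NormedModule) (V := R_NormedModule)); simpl.
  - exact (is_RInt_minus _ _ _ _ _ _ (is_RInt_scal _ _ _ (fst c) _ A)
             (is_RInt_scal _ _ _ (snd c) _ B)).
  - exact (is_RInt_plus _ _ _ _ _ _ (is_RInt_scal _ _ _ (fst c) _ B)
             (is_RInt_scal _ _ _ (snd c) _ A)).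
Qed.

Lemma is_CInt_plus (f g : R -> C) (a b : R) (lf lg : C) :
  is_CInt f a b lf -> is_CInt g a b lg -> is_CInt (fun t => f t + g t) a b (lf + lg).
Proof. apply (@is_RInt_plus C_R_NormedModule). Qed.

Lemma is_CInt_minus (f g : R -> C) (a b : R) (lf lg : C) :
  is_CInt f a b lf -> is_CInt g a b lg -> is_CInt (fun t => f t - g t) a b (lf - lg).
Proof. apply (@is_RInt_minus C_R_NormedModule). Qed.

Lemma is_CInt_eq (f : R -> C) (a b : R) (l l' : C) : is_CInt f a b l -> l = l' -> is_CInt f a b l'.
Proof. intros H <-. exact H. Qed.

Lemma CInt_correct (f : R -> C) (a b : R) :
  (forall t, (Rmin a b <= t <= Rmax a b)%R -> Ccontinuous f t) -> is_CInt f a b (CInt f a b).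
Proof.
  intros H. apply (@RInt_correct C_R_CompleteNormedModule).
  apply (@ex_RInt_continuous C_R_CompleteNormedModule). exact H.
Qed.

Lemma CInt_unique (f : R -> C) (a b : R) (l : C) : is_CInt f a b l -> CInt f a b = l.
Proof. apply (@is_RInt_unique C_R_CompleteNormedModule). Qed.

Lemma is_CInt_derive (f f' : R -> C) (a b : R) :
  (forall t, (Rmin a b <= t <= Rmax a b)%R -> is_Cderive f t (f' t)) ->
  (forall t, (Rmin a b <= t <= Rmax a b)%R -> Ccontinuous f' t) ->
  is_CInt f' a b (f b - f a).
Proof. apply (@is_RInt_derive C_R_CompleteNormedModule). Qed.

Lemma is_CInt_bound (f : R -> C) (g : R -> R) (a b : R) (lf : C) (lg : R) :
  (a <= b)%R -> (forall t, (a <= t <= b)%R -> (Cmod (f t) <= g t)%R) ->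
  is_CInt f a b lf -> is_RInt g a b lg -> (Cmod lf <= lg)%R.
Proof.
  intros Hab H Hf Hg. rewrite Cmod_norm.
  apply (norm_RInt_le (V := C_R_NormedModule) f g a b); try assumption.
  intros t Ht. generalize (H t Ht). rewrite Cmod_norm. exact (fun x => x).
Qed.

Lemma is_CInt_bound_const (f : R -> C) (a b : R) (l : C) (M : R) :
  (a <= b)%R -> (forall t, (a <= t <= b)%R -> (Cmod (f t) <= M)%R) ->
  is_CInt f a b l -> (Cmod l <= (b - a) * M)%R.
Proof.
  intros Hab H Hf. apply (is_CInt_bound f (fun _ => M) a b); try assumption.
  apply (is_RInt_const a b M).
Qed.

Lemma is_CInt_Chasles (f : R -> C) (a b c : R) (l1 l2 : C) :
  is_CInt f a b l1 -> is_CInt f b c l2 -> is_CInt f a c (l1 + l2).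
Proof. apply (@is_RInt_Chasles C_R_NormedModule). Qed.

Lemma is_CInt_ext (f g : R -> C) (a b : R) (l : C) :
  (forall t, (Rmin a b < t < Rmax a b)%R -> f t = g t) -> is_CInt f a b l -> is_CInt g a b l.
Proof. apply (@is_RInt_ext C_R_NormedModule). Qed.

Lemma is_CInt_unique2 (f : R -> C) (a b : R) (l l' : C) :
  is_CInt f a b l -> is_CInt f a b l' -> l = l'.
Proof. intros H H'. rewrite <- (CInt_unique _ _ _ _ H). apply CInt_unique, H'. Qed.

Lemma is_CInt_shift (f : R -> C) (a b c : R) (l : C) :
  is_CInt f (a + c) (b + c) l -> is_CInt (fun t => f (t + c)%R) a b l.
Proof.
  intros H. assert (K := @is_RInt_comp_lin C_R_NormedModule f 1 c a b l).
  rewrite !Rmult_1_l in K. specialize (K H).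
  apply (is_CInt_ext (fun y => @scal R_AbsRing C_R_NormedModule 1%R (f (1 * y + c)%R))); [|exact K].
  intros t _. rewrite Rmult_1_l. exact (@scal_one R_AbsRing C_R_NormedModule (f (t + c)%R)).
Qed.

(** * Limits of complex sequences *)

Definition Clim (u : nat -> C) (l : C) : Prop :=
  forall eps : R, (0 < eps)%R -> exists N, forall n, (N <= n)%nat -> (Cmod (u n - l) < eps)%R.

Lemma Clim_unique (u : nat -> C) (l l' : C) : Clim u l -> Clim u l' -> l = l'.
Proof.
  intros H H'. destruct (Req_dec (Cmod (l - l')) 0) as [E|E].
  - apply Cmod_eq_0 in E. replace l with (l - l' + l') by ring. rewrite E. ring.
  - assert (P : (0 < Cmod (l - l') / 2)%R) by (generalize (Cmod_ge_0 (l - l')); lra).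
    destruct (H _ P) as [N HN], (H' _ P) as [N' HN'].
    specialize (HN (N + N')%nat ltac:(lia)). specialize (HN' (N + N')%nat ltac:(lia)).
    assert (T := Cmod_triangle (l - u (N + N')%nat) (u (N + N')%nat - l')).
    rewrite (Cmod_minus_sym l) in T.
    replace (l - u (N + N')%nat + (u (N + N')%nat - l')) with (l - l') in T by ring. lra.
Qed.

Lemma Clim_ext_loc (u v : nat -> C) (l : C) (N0 : nat) :
  (forall n, (N0 <= n)%nat -> u n = v n) -> Clim u l -> Clim v l.
Proof.
  intros E H eps He. destruct (H eps He) as [N HN]. exists (N + N0)%nat. intros n Hn.
  rewrite <- E by lia. apply HN. lia.
Qed.

Lemma Clim_ext (u v : nat -> C) (l : C) : (forall n, u n = v n) -> Clim u l -> Clim v l.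
Proof. intros E. apply (Clim_ext_loc _ _ _ 0). auto. Qed.

Lemma Clim_const (c : C) : Clim (fun _ => c) c.
Proof. intros eps He. exists O. intros. replace (c - c) with (RtoC 0) by ring. rewrite Cmod_0. exact He. Qed.

Lemma Clim_eq (u : nat -> C) (l l' : C) : Clim u l -> l = l' -> Clim u l'.
Proof. intros H <-. exact H. Qed.

Lemma Clim_plus (u v : nat -> C) (l m : C) : Clim u l -> Clim v m -> Clim (fun n => u n + v n) (l + m).
Proof.
  intros H H' eps He. destruct (H (eps / 2)%R) as [N HN]; [lra|].
  destruct (H' (eps / 2)%R) as [N' HN']; [lra|]. exists (N + N')%nat. intros n Hn.
  replace (u n + v n - (l + m)) with ((u n - l) + (v n - m)) by ring.
  eapply Rle_lt_trans; [apply Cmod_triangle|].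
  specialize (HN n ltac:(lia)). specialize (HN' n ltac:(lia)). lra.
Qed.

Lemma Clim_mult_const (c : C) (u : nat -> C) (l : C) : Clim u l -> Clim (fun n => c * u n) (c * l).
Proof.
  intros H eps He. assert (P : (0 < Cmod c + 1)%R) by (generalize (Cmod_ge_0 c); lra).
  destruct (H (eps / (Cmod c + 1))%R) as [N HN]; [apply Rdiv_lt_0_compat; lra|].
  exists N. intros n Hn. replace (c * u n - c * l) with (c * (u n - l)) by ring.
  rewrite Cmod_mult. specialize (HN n Hn).
  apply (Rmult_lt_compat_r (Cmod c + 1)) in HN; [|exact P].
  replace (eps / (Cmod c + 1) * (Cmod c + 1))%R with eps in HN by (field; lra).
  generalize (Cmod_ge_0 (u n - l)). nra.
Qed.

Lemma Clim_minus (u v : nat -> C) (l m : C) : Clim u l -> Clim v m -> Clim (fun n => u n - v n) (l - m).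
Proof.
  intros H H'. apply (Clim_ext (fun n => u n + - (1) * v n)); [intros; ring|].
  replace (l - m) with (l + - (1) * m) by ring. apply Clim_plus; [exact H|].
  apply Clim_mult_const, H'.
Qed.

Lemma Clim_mult (u v : nat -> C) (l m : C) : Clim u l -> Clim v m -> Clim (fun n => u n * v n) (l * m).
Proof.
  intros H H'.
  apply (Clim_ext (fun n => ((u n - l) * (v n - m)) + (m * u n + l * v n - l * m))); [intros; ring|].
  apply (Clim_eq _ (0 + (m * l + l * m - l * m))); [|ring]. apply Clim_plus.
  - intros eps He. destruct (H eps He) as [N HN]. destruct (H' 1%R) as [N' HN']; [lra|].
    exists (N + N')%nat. intros n Hn. specialize (HN n ltac:(lia)). specialize (HN' n ltac:(lia)).
    replace ((u n - l) * (v n - m) - 0) with ((u n - l) * (v n - m)) by ring. rewrite Cmod_mult.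
    generalize (Cmod_ge_0 (u n - l)), (Cmod_ge_0 (v n - m)). nra.
  - apply Clim_minus; [|apply Clim_const].
    apply Clim_plus; apply Clim_mult_const; assumption.
Qed.

Lemma Clim_squeeze (u : nat -> C) (l : C) (b : nat -> R) :
  (forall n, (1 <= n)%nat -> (Cmod (u n - l) <= b n)%R) -> is_lim_seq b 0 -> Clim u l.
Proof.
  intros H Hb eps He. apply is_lim_seq_spec in Hb. destruct (Hb (mkposreal eps He)) as [N HN].
  exists (N + 1)%nat. intros n Hn. specialize (HN n ltac:(lia)). simpl in HN.
  eapply Rle_lt_trans; [apply H; lia|]. rewrite Rminus_0_r in HN.
  eapply Rle_lt_trans; [apply Rle_abs|exact HN].
Qed.

Lemma Clim_filterlim (u : nat -> C) (l : C) : Clim u l -> filterlim u eventually (@locally C_UniformSpace l).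
Proof.
  intros H. apply filterlim_locally. intros eps. destruct (H eps (cond_pos eps)) as [N HN].
  exists N. intros n Hn. specialize (HN n Hn). split.
  - apply (Rle_lt_trans _ (Cmod (u n - l))); [apply (re_le_Cmod (u n - l))|exact HN].
  - apply (Rle_lt_trans _ (Cmod (u n - l))); [apply (im_le_Cmod (u n - l))|exact HN].
Qed.

(** The bridge to [CGamma], whose coordinates are real parts of possibly infinite limits; a limit in
    modulus makes both of them finite. *)
Lemma Clim_CLim_seq (u : nat -> C) (l : C) : Clim u l -> CLim_seq u = l.
Proof.
  intros H. unfold CLim_seq. destruct l as [a b]. f_equal.
  - rewrite (is_lim_seq_unique _ (Finite a)); [reflexivity|]. apply is_lim_seq_spec.
    intros eps. destruct (H eps (cond_pos eps)) as [N HN]. exists N. intros n Hn.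
    eapply Rle_lt_trans; [|apply (HN n Hn)]. apply (re_le_Cmod (u n - (a, b))).
  - rewrite (is_lim_seq_unique _ (Finite b)); [reflexivity|]. apply is_lim_seq_spec.
    intros eps. destruct (H eps (cond_pos eps)) as [N HN]. exists N. intros n Hn.
    eapply Rle_lt_trans; [|apply (HN n Hn)]. apply (im_le_Cmod (u n - (a, b))).
Qed.

(** The error bound [b] is carried over to the limit: when [b] does not depend on a parameter, the
    convergence is uniform in it. This is how the cone sums become continuous in s. *)
Lemma Clim_cauchy (u : nat -> C) (b : nat -> R) (N0 : nat) :
  is_lim_seq b 0 -> (forall n m, (N0 <= n)%nat -> (n <= m)%nat -> (Cmod (u m - u n) <= b n)%R) ->
  exists l, Clim u l /\ forall n, (N0 <= n)%nat -> (Cmod (l - u n) <= b n)%R.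
Proof.
  intros Hb H. apply is_lim_seq_spec in Hb.
  assert (Cau : forall g : C -> R, (forall x y, (Rabs (g x - g y) <= Cmod (x - y))%R) ->
     exists l : R, is_lim_seq (fun n => g (u n)) l).
  { intros g Hg. assert (E : ex_finite_lim_seq (fun n => g (u n))).
    { apply ex_lim_seq_cauchy_corr. intros eps.
      destruct (Hb (mkposreal (eps / 2) ltac:(destruct eps; simpl; lra))) as [N HN].
      exists (N + N0)%nat. intros n m Hn Hm.
      assert (Q := HN (N + N0)%nat ltac:(lia)). simpl in Q. rewrite Rminus_0_r in Q.
      assert (B := Rle_abs (b (N + N0)%nat)).
      assert (A1 := H (N + N0)%nat n ltac:(lia) Hn). assert (A2 := H (N + N0)%nat m ltac:(lia) Hm).
      replace (g (u n) - g (u m))%R with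
        ((g (u n) - g (u (N + N0)%nat)) + - (g (u m) - g (u (N + N0)%nat)))%R by ring.
      eapply Rle_lt_trans; [apply Rabs_triang|]. rewrite Rabs_Ropp.
      assert (C1 := Hg (u n) (u (N + N0)%nat)). assert (C2 := Hg (u m) (u (N + N0)%nat)). lra. }
    destruct E as [l Hl]. exists l. exact Hl. }
  destruct (Cau Re) as [a Ha]. { intros x y. apply (re_le_Cmod (x - y)). }
  destruct (Cau Im) as [c Hc]. { intros x y. apply (im_le_Cmod (x - y)). }
  assert (L : Clim u (a, c)).
  { intros eps He. apply is_lim_seq_spec in Ha. apply is_lim_seq_spec in Hc.
    destruct (Ha (mkposreal (eps / 2) ltac:(lra))) as [N1 H1].
    destruct (Hc (mkposreal (eps / 2) ltac:(lra))) as [N2 H2].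
    exists (N1 + N2)%nat. intros n Hn. specialize (H1 n ltac:(lia)). specialize (H2 n ltac:(lia)).
    simpl in H1, H2. eapply Rle_lt_trans; [apply Cmod_le_abs|]. 
    change (Rabs (Re (u n) - a) + Rabs (Im (u n) - c) < eps)%R. lra. }
  exists (a, c). split; [exact L|]. intros n Hn.
  apply Rnot_lt_le. intros Hlt.
  destruct (L (Cmod ((a, c) - u n) - b n)%R ltac:(lra)) as [N HN].
  specialize (HN (N + n)%nat ltac:(lia)). assert (Q := H n (N + n)%nat Hn ltac:(lia)).
  assert (T := Cmod_triangle ((a, c) - u (N + n)%nat) (u (N + n)%nat - u n)).
  rewrite (Cmod_minus_sym (a, c)) in T.
  replace ((a, c) - u (N + n)%nat + (u (N + n)%nat - u n)) with ((a, c) - u n) in T by ring.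
  lra.
Qed.

Lemma exp_le (x y : R) : (x <= y)%R -> (exp x <= exp y)%R.
Proof. intros [H| ->]; [left; apply exp_increasing, H|right; reflexivity]. Qed.

(** Splits e^z - 1 as (e^x - 1) + e^x (e^(iy) - 1), where |e^(iy) - 1| = 2 |sin (y/2)| is at most
    |y|. *)
Lemma Cmod_exp_minus_1 (z : C) : (Cmod (Cexp z - 1) <= 2 * Cmod z * exp (Cmod z))%R.
Proof.
  assert (Hx := re_le_Cmod z). assert (Hy := im_le_Cmod z).
  set (x := Re z) in *. set (y := Im z) in *. set (m := Cmod z) in *.
  assert (Hm : (0 <= m)%R) by apply Cmod_ge_0.
  assert (Ex : (Rabs (exp x - 1) <= m * exp m)%R).
  { assert (1 <= exp m)%R by (rewrite <- exp_0; apply exp_le; exact Hm).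
    unfold Rabs in *. destruct (Rcase_abs x); destruct (Rcase_abs (exp x - 1)).
    - assert (1 + x <= exp x)%R by apply exp_ineq1_le. nra.
    - assert (exp x < exp 0)%R by (apply exp_increasing; lra). rewrite exp_0 in *. nra.
    - assert (exp 0 <= exp x)%R by (apply exp_le; lra). rewrite exp_0 in *. nra.
    - assert (1 + - x <= exp (- x))%R by apply exp_ineq1_le.
      assert (exp x * exp (- x) = 1)%R by (rewrite <- exp_plus, Rplus_opp_r; apply exp_0).
      assert (exp x <= exp m)%R by (apply exp_le; lra).
      assert (exp x - 1 <= x * exp x)%R by nra. nra. }
  assert (Ey : (Cmod (Cexp (Ci * RtoC y) - 1) <= m)%R).
  { apply Rsqr_incr_0_var; [|exact Hm]. unfold Rsqr.
    replace (Cmod (Cexp (Ci * y) - 1) * Cmod (Cexp (Ci * y) - 1))%R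
      with (Cmod (Cexp (Ci * y) - 1) ^ 2)%R by ring.
    rewrite Cmod2_alt. simpl.
    replace (0 * y - 1 * 0)%R with 0%R by ring. replace (0 * 0 + 1 * y)%R with y by ring.
    rewrite exp_0. replace y with (2 * (y / 2))%R by field.
    rewrite cos_2a_sin, sin_2a.
    assert (S : (Rabs (sin (y / 2)) <= Rabs (y / 2))%R).
    { assert (Aux : forall t, (0 <= t)%R -> (Rabs (sin t) <= t)%R).
      { intros t Ht. destruct (Rle_lt_dec t 1) as [H1|H1].
        - rewrite Rabs_pos_eq; [destruct Ht as [Ht|<-]; [left; apply sin_lt_x; lra|rewrite sin_0; lra]|].
          apply sin_ge_0; [lra|]. generalize PI2_1. lra.
        - generalize (SIN_bound t); intros. apply Rabs_le; lra. }
      destruct (Rle_lt_dec 0 (y / 2)).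
      - rewrite (Rabs_pos_eq (y / 2)) by lra. auto.
      - rewrite (Rabs_left (y / 2)) by lra. rewrite <- Rabs_Ropp, <- sin_neg. apply Aux. lra. }
    assert (Q := sin2_cos2 (y / 2)). unfold Rsqr in Q.
    assert (S2 : (sin (y / 2) * sin (y / 2) <= (y / 2) * (y / 2))%R).
    { apply Rsqr_le_abs_1 in S. exact S. }
    assert (Y2 : (y * y <= m * m)%R).
    { apply Rsqr_le_abs_1. rewrite (Rabs_pos_eq m) by exact Hm. exact Hy. }
    set (sn := sin (y / 2)) in *. set (cs := cos (y / 2)) in *.
    replace (_ + _)%R with (4 * (sn * sn) * (sn * sn + cs * cs))%R by ring.
    rewrite Q. lra. }
  replace (Cexp z - 1) with (RtoC (exp x - 1) + RtoC (exp x) * (Cexp (Ci * RtoC y) - 1)).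
  - eapply Rle_trans; [apply Cmod_triangle|]. rewrite Cmod_mult, !Cmod_R.
    rewrite (Rabs_pos_eq (exp x)) by (left; apply exp_pos).
    assert (exp x <= exp m)%R by (apply exp_le; unfold Rabs in Hx; destruct (Rcase_abs x); lra).
    assert (P := exp_pos x). generalize (Cmod_ge_0 (Cexp (Ci * y) - 1)). nra.
  - replace z with (RtoC x + Ci * RtoC y) at 1 by (apply C_eq; simpl; unfold x, y; ring).
    rewrite Cexp_add, Cexp_RtoC, RtoC_minus. ring.
Qed.

(** * Primitives by integration from the left end of horizontal lines *)

(** Compactness of [a, b] makes the neighbourhoods uniform (the tube lemma); differentiation under
    the integral sign asks for conditions on whole segments. *)
Lemma tube (P : R -> R -> Prop) (x a b : R) :
  (forall t, (a <= t <= b)%R -> locally_2d P x t) ->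
  locally x (fun u => forall t, (a <= t <= b)%R -> P u t).
Proof.
  intros H.
  assert (D : forall t, exists d : posreal, (a <= t <= b)%R -> forall u v,
     (Rabs (u - x) < d)%R -> (Rabs (v - t) < d)%R -> P u v).
  { intros t. destruct (Rle_dec a t) as [A|A]; [destruct (Rle_dec t b) as [B|B]|].
    - destruct (H t (conj A B)) as [d Hd]. exists d. auto.
    - exists (mkposreal 1 Rlt_0_1). intros; lra.
    - exists (mkposreal 1 Rlt_0_1). intros; lra. }
  set (delta t := proj1_sig (constructive_indefinite_description _ (D t))).
  assert (Hdelta : forall t, (a <= t <= b)%R -> forall u v,
     (Rabs (u - x) < delta t)%R -> (Rabs (v - t) < delta t)%R -> P u v).
  { intros t. unfold delta. exact (proj2_sig (constructive_indefinite_description _ (D t))). }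
  (* Compactness gives one radius [d] for all t, but only under a double negation, hence the
     excluded middle on [P u t]. *)
  destruct (compactness_value_1d a b delta) as [d Hd].
  exists d. intros u Hu t Ht. destruct (classic (P u t)) as [|N]; [assumption|exfalso].
  apply (Hd t Ht). intros [t0 [Ht0 [H1 H2]]]. apply N. apply (Hdelta t0 Ht0); [|exact H1].
  eapply Rlt_le_trans; [exact Hu|exact H2].
Qed.

Lemma is_derive_param_R (f f' : R -> R -> R) (a b x : R) :
  (a <= b)%R ->
  (forall t, (a <= t <= b)%R -> locally_2d (fun u v =>
     is_derive (fun u => f u v) u (f' u v) /\ continuous (f u) v) x t) ->
  (forall t, (a <= t <= b)%R -> continuity_2d_pt f' x t) ->
  is_derive (fun u => RInt (f u) a b) x (RInt (f' x) a b).
Proof.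
  intros Hab H Hc.
  assert (T := tube _ _ _ _ H).
  assert (Tx := locally_singleton _ _ T).
  rewrite <- (RInt_ext (fun t => Derive (fun u => f u t) x) (f' x)).
  2:{ rewrite Rmin_left, Rmax_right by exact Hab. intros t Ht. apply is_derive_unique, Tx. lra. }
  apply is_derive_RInt_param.
  - revert T. apply filter_imp. intros u Hu t. rewrite Rmin_left, Rmax_right by exact Hab.
    intros Ht. exists (f' u t). apply Hu, Ht.
  - intros t. rewrite Rmin_left, Rmax_right by exact Hab. intros Ht.
    apply (continuity_2d_pt_ext_loc f'); [|apply Hc, Ht].
    destruct (H t Ht) as [d Hd]. exists d. intros u v Hu Hv. symmetry. apply is_derive_unique.
    apply Hd; assumption.
  - revert T. apply filter_imp. intros u Hu.
    apply (ex_RInt_continuous (V := R_CompleteNormedModule)).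
    rewrite Rmin_left, Rmax_right by exact Hab. intros t Ht. apply Hu, Ht.
Qed.

Lemma CInt_Re (f : R -> C) (a b : R) (l : C) :
  is_CInt f a b l -> is_RInt (fun t => Re (f t)) a b (Re l).
Proof. apply (is_RInt_fct_extend_fst (U := R_NormedModule) (V := R_NormedModule)). Qed.

Lemma CInt_Im (f : R -> C) (a b : R) (l : C) :
  is_CInt f a b l -> is_RInt (fun t => Im (f t)) a b (Im l).
Proof. apply (is_RInt_fct_extend_snd (U := R_NormedModule) (V := R_NormedModule)). Qed.

Lemma is_Cderive_param (f f' : R -> R -> C) (a b x : R) :
  (a <= b)%R ->
  (forall t, (a <= t <= b)%R -> locally_2d (fun u v =>
     is_Cderive (fun u => f u v) u (f' u v) /\ Ccontinuous (f u) v) x t) ->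
  (forall t, (a <= t <= b)%R -> Ccontinuous (fun p : R * R => f' (fst p) (snd p)) (x, t)) ->
  is_Cderive (fun u => CInt (f u) a b) x (CInt (f' x) a b).
Proof.
  intros Hab H Hc.
  assert (T := tube _ _ _ _ H).
  assert (T1 : locally x (fun u => is_CInt (f u) a b (CInt (f u) a b))).
  { revert T. apply filter_imp. intros u Hu. apply CInt_correct.
    rewrite Rmin_left, Rmax_right by exact Hab. intros t Ht. apply Hu, Ht. }
  assert (T2 : is_CInt (f' x) a b (CInt (f' x) a b)).
  { apply CInt_correct. rewrite Rmin_left, Rmax_right by exact Hab. intros t Ht.
    apply (@continuous_comp_2 R_UniformSpace R_UniformSpace R_UniformSpace C_UniformSpace
       (fun _ => x) (fun t => t) f'); [apply continuous_const|apply continuous_id|exact (Hc t Ht)]. }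
  apply is_Cderive_pair.
  - apply (is_derive_ext_loc (fun u => RInt (fun v => Re (f u v)) a b)).
    { revert T1. apply filter_imp. intros u Hu. apply is_RInt_unique, CInt_Re, Hu. }
    rewrite <- (is_RInt_unique _ _ _ _ (CInt_Re _ _ _ _ T2)).
    apply (is_derive_param_R (fun u v => Re (f u v)) (fun u v => Re (f' u v))); [exact Hab| |].
    + intros t Ht. destruct (H t Ht) as [d Hd]. exists d. intros u v Hu Hv.
      destruct (Hd u v Hu Hv) as [A B]. split; [apply is_Cderive_Re in A; exact A|].
      apply continuous_Re, B.
    + intros t Ht. apply continuity_2d_pt_filterlim.
      apply (continuous_Re (fun p : R * R => f' (fst p) (snd p)) (x, t)). apply Hc, Ht.
  - apply (is_derive_ext_loc (fun u => RInt (fun v => Im (f u v)) a b)).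
    { revert T1. apply filter_imp. intros u Hu. apply is_RInt_unique, CInt_Im, Hu. }
    rewrite <- (is_RInt_unique _ _ _ _ (CInt_Im _ _ _ _ T2)).
    apply (is_derive_param_R (fun u v => Im (f u v)) (fun u v => Im (f' u v))); [exact Hab| |].
    + intros t Ht. destruct (H t Ht) as [d Hd]. exists d. intros u v Hu Hv.
      destruct (Hd u v Hu Hv) as [A B]. split; [apply is_Cderive_Im in A; exact A|].
      apply continuous_Im, B.
    + intros t Ht. apply continuity_2d_pt_filterlim.
      apply (continuous_Im (fun p : R * R => f' (fst p) (snd p)) (x, t)). apply Hc, Ht.
Qed.

Lemma continuous_C_comp {T : UniformSpace} (f : C -> C) (g : T -> C) (x : T) :
  Ccontinuous g x -> Ccontinuous f (g x) -> Ccontinuous (fun t => f (g t)) x.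
Proof. apply (@continuous_comp T C_UniformSpace C_UniformSpace g f). Qed.

Lemma Cplus_minus_cancel (a b : C) : a + b - b = a.
Proof. ring. Qed.

Lemma Cminus_zero (a : C) : a - 0 = a.
Proof. ring. Qed.

Section Primitive.
Variables (Om : C -> Prop) (h : C -> C).
Hypothesis Om_open : forall z, Om z -> @locally C_UniformSpace z Om.
Hypothesis h_hol : hol Om h.

(** Truncated to length N so that the derivative along a path is an exact boundary difference; the
    limit in N is taken once, after integrating along the path. *)
Definition leftprim (N : R) (z : C) : C := CInt (fun v => h (z + RtoC v)) (- N) 0.

Lemma hol_continuous (z : C) : Om z -> Ccontinuous h z.
Proof. destruct h_hol as [h' [H _]]. apply H. Qed.

Lemma continuous_add_R (z : C) (v : R) : Ccontinuous (fun v => z + RtoC v) v.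
Proof.
  apply continuous_Cplus; [apply continuous_const|apply continuous_RtoC, continuous_id].
Qed.

Lemma h_line_continuous (z : C) (v : R) : Om (z + RtoC v) -> Ccontinuous (fun v => h (z + RtoC v)) v.
Proof.
  intros H. apply continuous_C_comp; [apply continuous_add_R|]. apply hol_continuous, H.
Qed.

(** The derivative of h (w + v) along the path is h' (w + v) w', and its derivative in v is h' (w +
    v): after differentiation under the integral, the integrand is an exact v-derivative times the
    constant w' t. *)
Lemma leftprim_derive (w w' : R -> C) (t N : R) :
  (0 <= N)%R ->
  locally t (fun u => is_Cderive w u (w' u)) -> Ccontinuous w' t ->
  (forall v, (- N <= v <= 0)%R -> Om (w t + RtoC v)) ->
  is_Cderive (fun u => leftprim N (w u)) t ((h (w t) - h (w t - RtoC N)) * w' t).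
Proof.
  intros HN Hw Hw' HO. destruct h_hol as [h' [H1 [H2 H3]]].
  assert (Hwt := locally_singleton _ _ Hw).
  assert (Cw : Ccontinuous w t) by (eapply is_Cderive_continuous; exact Hwt).
  assert (Cp : forall v, Ccontinuous (fun p : R * R => w (fst p) + RtoC (snd p)) (t, v)).
  { intros v. apply continuous_Cplus.
    - apply (@continuous_comp _ R_UniformSpace C_UniformSpace fst w); [apply continuous_fst|exact Cw].
    - apply continuous_RtoC, continuous_snd. }
  eapply is_Cderive_eq.
  - apply (is_Cderive_param (fun u v => h (w u + RtoC v)) (fun u v => h' (w u + RtoC v) * w' u)).
    + lra.
    + intros v Hv. apply locally_2d_locally.
      assert (A : locally (t, v) (fun p : R * R => Om (w (fst p) + RtoC (snd p)))).
      { apply (Cp v). apply Om_open. apply HO, Hv. }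
      assert (B : locally (t, v) (fun p : R * R => is_Cderive w (fst p) (w' (fst p)))).
      { exact (@continuous_fst R_UniformSpace R_UniformSpace t v (fun u => is_Cderive w u (w' u)) Hw). }
      generalize (filter_and _ _ A B). apply filter_imp. intros [u v'] [A' B']. simpl in *. split.
      * apply (H3 (fun u => w u + RtoC v')); [exact A'|].
        eapply is_Cderive_eq; [apply is_Cderive_plus; [exact B'|apply is_Cderive_const]|ring].
      * apply h_line_continuous, A'.
    + intros v Hv. apply continuous_Cmult.
      * apply (continuous_C_comp h' (fun p : R * R => w (fst p) + RtoC (snd p))); [apply Cp|].
        apply H2, HO, Hv.
      * apply (@continuous_comp _ R_UniformSpace C_UniformSpace fst w'); [apply continuous_fst|exact Hw'].
  - apply CInt_unique.
    replace ((h (w t) - h (w t - RtoC N)) * w' t)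
      with (w' t * (h (w t + RtoC 0) - h (w t + RtoC (- N)))).
    2:{ rewrite RtoC_opp. replace (w t + 0) with (w t) by ring. unfold Cminus. ring. }
    apply (is_CInt_ext (fun v => w' t * h' (w t + RtoC v))); [intros; ring|].
    apply is_CInt_mult. apply (is_CInt_derive (fun v => h (w t + RtoC v))).
    + rewrite Rmin_left, Rmax_right by lra. intros v Hv.
      eapply is_Cderive_eq.
      * apply (H3 (fun v => w t + RtoC v) v 1); [apply HO, Hv|].
        eapply is_Cderive_eq; [apply is_Cderive_plus; [apply is_Cderive_const|]|].
        -- apply is_Cderive_RtoC. apply (is_derive_id (K := R_AbsRing)).
        -- unfold one; simpl. ring.
      * ring.
    + rewrite Rmin_left, Rmax_right by lra. intros v Hv.
      apply continuous_C_comp; [apply continuous_add_R|apply H2, HO, Hv].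
Qed.

(** Cauchy's theorem for the region swept out when the path is moved left by N: the path integral is
    the difference of the two horizontal sides plus the integral [l] over the moved path. *)
Lemma path_trunc (w w' : R -> C) (a b N : R) (l : C) :
  (0 <= N)%R -> (a <= b)%R ->
  (forall t, (a <= t <= b)%R -> locally t (fun u => is_Cderive w u (w' u))) ->
  (forall t, (a <= t <= b)%R -> Ccontinuous w' t) ->
  (forall t, (a <= t <= b)%R -> forall v, (v <= 0)%R -> Om (w t + RtoC v)) ->
  is_CInt (fun t => h (w t - RtoC N) * w' t) a b l ->
  is_CInt (fun t => h (w t) * w' t) a b (leftprim N (w b) - leftprim N (w a) + l).
Proof.
  intros HN Hab Hw Hw' HO Hl.
  apply (is_CInt_ext (fun t => (h (w t) - h (w t - RtoC N)) * w' t + h (w t - RtoC N) * w' t)).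
  { intros; ring. }
  apply is_CInt_plus; [|exact Hl].
  apply (is_CInt_derive (fun t => leftprim N (w t))).
  - rewrite Rmin_left, Rmax_right by exact Hab. intros t Ht.
    apply leftprim_derive; auto. intros v Hv. apply HO; [exact Ht|lra].
  - rewrite Rmin_left, Rmax_right by exact Hab. intros t Ht.
    assert (Cw : Ccontinuous w t).
    { eapply is_Cderive_continuous. exact (locally_singleton _ _ (Hw t Ht)). }
    apply continuous_Cmult; [apply continuous_Cminus|auto].
    + apply continuous_C_comp; [exact Cw|]. apply hol_continuous.
      replace (w t) with (w t + RtoC 0) by ring. apply HO; [exact Ht|lra].
    + apply (continuous_C_comp h (fun t => w t - RtoC N)).
      * apply continuous_Cminus; [exact Cw|apply continuous_const].
      * apply hol_continuous. unfold Cminus. rewrite <- RtoC_opp. apply HO; [exact Ht|lra].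
Qed.

Hypothesis h_decay : forall B : R, exists U K q : R, (0 < q)%R /\ forall z : C,
  (Re z <= U)%R -> (Rabs (Im z) <= B)%R -> (Cmod (h z) <= K * exp (q * Re z))%R.

(** The value at z of the primitive that vanishes at the left end, as a relation; this normalisation
    leaves no additive constant. *)
Definition is_prim (z l : C) : Prop := Clim (fun N => leftprim (INR N) z) l.

Lemma is_lim_exp_decay (K q c : R) : (0 < q)%R -> is_lim_seq (fun n => K * exp (q * (c - INR n)))%R 0.
Proof.
  intros Hq. replace (Finite 0) with (Rbar_mult K 0) by (simpl; f_equal; ring).
  apply is_lim_seq_scal_l.
  apply (is_lim_comp_seq exp (fun n => q * (c - INR n))%R m_infty 0).
  - apply is_lim_exp_m.
  - exists O. intros. discriminate.
  - apply (is_lim_seq_ext (fun n => q * c + - (q * INR n))%R); [intros; ring|].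
    apply (is_lim_seq_plus _ _ (q * c)%R m_infty); [apply is_lim_seq_const| |reflexivity].
    replace m_infty with (Rbar_opp p_infty) by reflexivity.
    apply -> is_lim_seq_opp.
    assert (X := is_lim_seq_scal_l INR q _ is_lim_seq_INR).
    replace (Rbar_mult q p_infty) with p_infty in X; [exact X|].
    simpl. destruct (Rle_dec 0 q); [|exfalso; lra]. destruct (Rle_lt_or_eq_dec 0 q r); [reflexivity|exfalso; lra].
Qed.

Lemma is_prim_exists (z : C) : (forall v, (v <= 0)%R -> Om (z + RtoC v)) -> exists l, is_prim z l.
Proof.
  intros HO. destruct (h_decay (Rabs (Im z))) as [U [K [q [Hq HK]]]].
  (* For n > N0 the segment from z - m to z - n lies in the half plane Re <= U, where the decay
     bound applies. *)
  destruct (nfloor_ex (Rabs (Re z - U)) (Rabs_pos _)) as [N0 HN0].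
  destruct (Clim_cauchy (fun N => leftprim (INR N) z) (fun n => K / q * exp (q * (Re z - INR n)))%R (S N0))
    as [l [Hl _]]; [apply is_lim_exp_decay, Hq| |exists l; exact Hl].
  intros n m Hn Hm.
  assert (Hnm : (INR n <= INR m)%R) by (apply le_INR; lia).
  assert (Hn0 : (Rabs (Re z - U) <= INR n)%R).
  { apply le_INR in Hn. rewrite S_INR in Hn. lra. }
  assert (Pn := pos_INR n).
  assert (Cn : forall a b, (b <= 0)%R -> (a <= b)%R ->
     is_CInt (fun v => h (z + RtoC v)) a b (CInt (fun v => h (z + RtoC v)) a b)).
  { intros a b Hb Hab. apply CInt_correct. rewrite Rmin_left, Rmax_right by exact Hab.
    intros t Ht. apply h_line_continuous, HO. lra. }
  assert (I1 := Cn (- INR m)%R (- INR n)%R ltac:(lra) ltac:(lra)).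
  assert (I2 := Cn (- INR n)%R 0%R ltac:(lra) ltac:(lra)).
  assert (I3 := CInt_unique _ _ _ _ (is_CInt_Chasles _ _ _ _ _ _ I1 I2)).
  unfold leftprim. rewrite I3.
  match goal with |- (Cmod (?a + ?b - _) <= _)%R =>
    replace (a + b - b) with a by exact (eq_sym (Cplus_minus_cancel a b)) end.
  assert (G : is_RInt (fun v => K * exp (q * (Re z + v)))%R (- INR m) (- INR n)
     (K / q * exp (q * (Re z - INR n)) - K / q * exp (q * (Re z - INR m)))%R).
  { apply (is_RInt_derive (V := R_CompleteNormedModule) (fun v => K / q * exp (q * (Re z + v)))%R).
    - intros v _. auto_derive; [trivial|]. field. lra.
    - intros v _. apply (@ex_derive_continuous R_AbsRing R_NormedModule). auto_derive. trivial. }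
  eapply Rle_trans; [eapply (is_CInt_bound _ _ _ _ _ _ _ _ I1 G)|].
  - destruct (Req_dec K 0) as [->|]; [right; unfold Rdiv; ring|].
    assert (0 <= K)%R.
    { specialize (HK (RtoC U) ltac:(simpl; lra) ltac:(simpl; rewrite Rabs_R0; apply Rabs_pos)).
      generalize (Cmod_ge_0 (h U)) (exp_pos (q * Re U)). nra. }
    assert (0 < K / q)%R by (apply Rdiv_lt_0_compat; lra).
    generalize (exp_pos (q * (Re z - INR m))). nra.
  Unshelve.
  + lra.
  + intros v Hv. replace (Re z + v)%R with (Re (z + RtoC v)) by (unfold Re; simpl; ring).
    apply HK; simpl.
    * unfold Rabs in Hn0. destruct (Rcase_abs (Re z - U)); unfold Re in *; lra.
    * right. f_equal. unfold Im, Re; ring.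
Qed.

(** On a compact path Re w, |Im w| and |w'| are bounded, so the integral over the path moved left by
    n tends to 0 exponentially. The integral evaluated by [path_trunc] does not depend on n, and its
    value is read off in the limit. *)
Lemma path_integral (w w' : R -> C) (a b : R) (la lb : C) :
  (a <= b)%R ->
  (forall t, (a <= t <= b)%R -> locally t (fun u => is_Cderive w u (w' u))) ->
  (forall t, (a <= t <= b)%R -> Ccontinuous w' t) ->
  (forall t, (a <= t <= b)%R -> forall v, (v <= 0)%R -> Om (w t + RtoC v)) ->
  is_prim (w a) la -> is_prim (w b) lb ->
  is_CInt (fun t => h (w t) * w' t) a b (lb - la).
Proof.
  intros Hab Hw Hw' HO Ha Hb.
  assert (Cw : forall t, (a <= t <= b)%R -> Ccontinuous w t).
  { intros t Ht. eapply is_Cderive_continuous. exact (locally_singleton _ _ (Hw t Ht)). }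
  assert (Bd : forall g : R -> R, (forall t, (a <= t <= b)%R -> continuous g t) ->
     exists M, forall t, (a <= t <= b)%R -> (g t <= M)%R).
  { intros g Hg. destruct (continuity_ab_maj g a b Hab) as [x [Hx _]].
    - intros t Ht. apply continuity_pt_filterlim, Hg, Ht.
    - exists (g x). exact Hx. }
  destruct (Bd (fun t => Rabs (Im (w t)))) as [B HB].
  { intros t Ht. apply (continuous_comp_R (fun t => Im (w t)) Rabs); [apply continuous_Im; auto|].
    apply continuous_Rabs. }
  destruct (Bd (fun t => Re (w t))) as [M1 HM1].
  { intros t Ht. apply continuous_Re; auto. }
  destruct (Bd (fun t => Cmod (w' t))) as [M2 HM2].
  { intros t Ht. apply continuous_Cmod; auto. }
  destruct (h_decay B) as [U [K [q [Hq HK]]]].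
  assert (Ic : forall N, (0 <= N)%R -> is_CInt (fun t => h (w t - RtoC N) * w' t) a b
     (CInt (fun t => h (w t - RtoC N) * w' t) a b)).
  { intros N HN. apply CInt_correct. rewrite Rmin_left, Rmax_right by exact Hab. intros t Ht.
    apply continuous_Cmult; [|auto]. apply (continuous_C_comp h (fun t => w t - RtoC N)).
    - apply continuous_Cminus; [auto|apply continuous_const].
    - apply hol_continuous. unfold Cminus. rewrite <- RtoC_opp. apply HO; [exact Ht|lra]. }
  set (I N := CInt (fun t => h (w t - RtoC (INR N)) * w' t) a b).
  assert (HI : Clim I 0).
  { assert (K0 : (0 <= K)%R).
    { specialize (HK (RtoC U) ltac:(simpl; lra)).
      assert (HB0 : (0 <= B)%R) by (eapply Rle_trans; [apply Rabs_pos|apply (HB a); lra]).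
      specialize (HK ltac:(simpl; rewrite Rabs_R0; exact HB0)).
      generalize (Cmod_ge_0 (h U)) (exp_pos (q * Re U)). nra. }
    destruct (nfloor_ex (Rabs (M1 - U)) (Rabs_pos _)) as [N0 HN0].
    intros eps He.
    assert (L := is_lim_exp_decay ((b - a) * (K * M2)) q M1 Hq). apply is_lim_seq_spec in L.
    destruct (L (mkposreal eps He)) as [N1 HN1]. exists (S N0 + N1)%nat. intros n Hn.
    specialize (HN1 n ltac:(lia)). simpl in HN1. rewrite Rminus_0_r in HN1.
    assert (Hn0 : (Rabs (M1 - U) <= INR n)%R).
    { assert (A : (S N0 <= n)%nat) by lia. apply le_INR in A. rewrite S_INR in A. lra. }
    eapply Rle_lt_trans; [|eapply Rle_lt_trans; [apply Rle_abs|exact HN1]].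
    replace (I n - 0) with (I n) by exact (eq_sym (Cminus_zero (I n))). rewrite Rmult_assoc.
    apply (is_CInt_bound_const _ _ _ _ _ Hab) with (2 := Ic (INR n) (pos_INR n)).
    intros t Ht. rewrite Cmod_mult.
    assert (A : (Cmod (h (w t - INR n)) <= K * exp (q * (M1 - INR n)))%R).
    { eapply Rle_trans; [apply HK|].
      - simpl. specialize (HM1 t Ht). unfold Re in HM1. unfold Rabs in Hn0.
        destruct (Rcase_abs (M1 - U)); lra.
      - simpl. specialize (HB t Ht). unfold Im in HB. rewrite Ropp_0, Rplus_0_r. exact HB.
      - apply Rmult_le_compat_l; [exact K0|]. apply exp_le. apply Rmult_le_compat_l; [lra|].
        simpl. specialize (HM1 t Ht). unfold Re in HM1. lra. }
    specialize (HM2 t Ht).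
    replace (K * M2 * exp (q * (M1 - INR n)))%R with (K * exp (q * (M1 - INR n)) * M2)%R by ring.
    apply Rmult_le_compat; auto using Cmod_ge_0. }
  (* [Jv] is the formula of [path_trunc] at N = 0; by uniqueness of the integral every other N gives
     the same value. *)
  set (Jv := leftprim (INR 0) (w b) - leftprim (INR 0) (w a) + I O).
  assert (HJ : is_CInt (fun t => h (w t) * w' t) a b Jv).
  { apply path_trunc; auto. - apply pos_INR. - apply Ic, pos_INR. }
  apply (is_CInt_eq _ _ _ Jv); [exact HJ|].
  apply (Clim_unique (fun n => leftprim (INR n) (w b) - leftprim (INR n) (w a) + I n)).
  - apply (Clim_ext (fun _ => Jv)); [|apply Clim_const]. intros n.
    apply (is_CInt_unique2 _ _ _ _ _ HJ). apply path_trunc; auto.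
    + apply pos_INR.
    + apply Ic, pos_INR.
  - apply (Clim_eq _ (lb - la + 0)); [|ring]. apply Clim_plus; [|exact HI].
    apply Clim_minus; assumption.
Qed.

End Primitive.

(** * Absolutely convergent integrals over the real line *)

(** For q > 0 a bounded increasing function whose derivative decays like e^(-q |u|): as a primitive
    of a majorant it makes the tails of integrals over the line explicit. *)
Definition logistic (q u : R) : R := (/ (1 + exp (- (q * u))))%R.

Definition dlogistic (q u : R) : R := (q * exp (- (q * u)) / (1 + exp (- (q * u))) ^ 2)%R.

Lemma logistic_bounds (q u : R) : (0 < logistic q u < 1)%R.
Proof.
  unfold logistic. assert (P := exp_pos (- (q * u))). split.
  - apply Rinv_0_lt_compat. lra.
  - rewrite <- Rinv_1. apply Rinv_lt_contravar; lra.
Qed.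

Lemma logistic_derive (q u : R) : is_derive (logistic q) u (dlogistic q u).
Proof.
  unfold logistic, dlogistic. assert (P := exp_pos (- (q * u))).
  auto_derive; [lra|]. field. lra.
Qed.

Lemma dlogistic_continuous (q u : R) : continuous (dlogistic q) u.
Proof.
  assert (P := exp_pos (- (q * u))).
  apply (@ex_derive_continuous R_AbsRing R_NormedModule). unfold dlogistic. auto_derive.
  assert (0 < 1 + exp (- (q * u)))%R by lra.
  apply Rgt_not_eq. rewrite Rmult_1_r. apply Rmult_gt_0_compat; assumption.
Qed.

Lemma logistic_p (q eps : R) : (0 < q)%R -> (0 < eps)%R ->
  exists A, forall a b, (a <= - A)%R -> (A <= b)%R ->
    (logistic q a < eps /\ 1 - logistic q b < eps)%R.
Proof.
  intros Hq He. exists (/ (q * eps))%R. intros a b Ha Hb.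
  assert (Key : forall x, (/ (q * eps) <= x -> / (1 + exp (q * x)) < eps)%R).
  { intros x Hx. assert (1 + q * x <= exp (q * x))%R by apply exp_ineq1_le.
    assert (q * / (q * eps) <= q * x)%R by (apply Rmult_le_compat_l; lra).
    replace (q * / (q * eps))%R with (/ eps)%R in H0 by (field; lra).
    assert (0 < / eps)%R by (apply Rinv_0_lt_compat; lra).
    rewrite <- (Rinv_inv eps). apply Rinv_lt_contravar; [|lra].
    apply Rmult_lt_0_compat; lra. }
  split.
  - unfold logistic. replace (- (q * a))%R with (q * - a)%R by ring. apply Key. lra.
  - unfold logistic. replace (1 - / (1 + exp (- (q * b))))%R with (/ (1 + exp (q * b)))%R.
    + apply Key, Hb.
    + rewrite exp_Ropp. assert (P := exp_pos (q * b)). field. split; lra.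
Qed.

(** p u - e^u is largest at u = ln p; the bound is 1 + x <= e^x at x = u - ln p. *)
Lemma exp_pow_bound (p u : R) : (0 < p)%R -> (exp (p * u - exp u) <= exp (p * ln p - p))%R.
Proof.
  intros Hp. apply exp_le.
  assert (H : (1 + (u - ln p) <= exp (u - ln p))%R) by apply exp_ineq1_le.
  assert (E : exp u = (p * exp (u - ln p))%R).
  { rewrite <- (exp_ln p) at 1 by exact Hp. rewrite <- exp_plus. f_equal. ring. }
  rewrite E. nra.
Qed.

(** With x = e^(q u), the inequality of [gam_dom] reduces to (1 + x)^2 e^(-e^u) <= 2 (1 + x^2)
    e^(-e^u) <= 2 (1 + C), where C bounds e^(2 q u - e^u); the division by q compensates the factor
    q in [dlogistic]. *)
Definition gam_const (q : R) : R := (2 * (1 + exp (2 * q * ln (2 * q) - 2 * q)) / q)%R.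

Lemma gam_const_pos (q : R) : (0 < q)%R -> (0 < gam_const q)%R.
Proof.
  intros Hq. unfold gam_const. apply Rdiv_lt_0_compat; [|exact Hq].
  generalize (exp_pos (2 * q * ln (2 * q) - 2 * q)). lra.
Qed.

Lemma gam_dom (q u : R) : (0 < q)%R -> (exp (q * u - exp u) <= gam_const q * dlogistic q u)%R.
Proof.
  intros Hq. unfold gam_const, dlogistic.
  assert (B := exp_pow_bound (2 * q) u ltac:(lra)).
  set (C := exp (2 * q * ln (2 * q) - 2 * q)) in *.
  assert (P := exp_pos (- (q * u))). assert (P1 := exp_pos u).
  assert (Pe := exp_pos (- exp u)).
  assert (L1 : (exp (- exp u) <= 1)%R) by (rewrite <- exp_0; apply exp_le; lra).
  assert (E1 : (exp (q * u) * exp (- (q * u)) = 1)%R) by (rewrite <- exp_plus, Rplus_opp_r; apply exp_0).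
  replace (2 * q * u - exp u)%R with (q * u + q * u + - exp u)%R in B by ring.
  replace (q * u - exp u)%R with (q * u + - exp u)%R by ring.
  rewrite !exp_plus in *.
  set (x := exp (q * u)) in *. set (y := exp (- (q * u))) in *. set (e := exp (- exp u)) in *.
  assert (D : (0 < (1 + y) ^ 2)%R) by (apply pow_lt; lra).
  replace (2 * (1 + C) / q * (q * y / (1 + y) ^ 2))%R with (2 * (1 + C) * y / (1 + y) ^ 2)%R by (field; lra).
  apply Rmult_le_reg_r with ((1 + y) ^ 2)%R; [exact D|].
  unfold Rdiv. rewrite (Rmult_assoc (2 * (1 + C) * y)), Rinv_l, Rmult_1_r by lra.
  assert (Q : ((1 + x) ^ 2 * e <= 2 * (1 + C))%R).
  { assert (Hx := pow2_ge_0 (1 - x)). assert (Hx2 : ((1 + x) ^ 2 * e <= 2 * (1 + x * x) * e)%R).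
    { apply Rmult_le_compat_r; [lra|]. simpl in *. lra. }
    lra. }
  replace (x * e * (1 + y) ^ 2)%R with ((1 + x) ^ 2 * e * y)%R.
  - apply Rmult_le_compat_r; lra.
  - replace ((1 + x) ^ 2 * e * y)%R with (e * (y + 2 * (x * y) + x * (x * y)))%R by ring.
    replace (x * e * (1 + y) ^ 2)%R with (e * (x + 2 * (x * y) + y * (x * y)))%R by ring.
    rewrite E1. ring.
Qed.

(** Translation of [gam_dom] by ln eta. The factor eta^(-q) that it produces is the source of the
    rates of convergence of the Gauss product and of the cone series. *)
Lemma gam_dom_scale (q eta u : R) : (0 < q)%R -> (0 < eta)%R ->
  (exp (q * u - eta * exp u) <= gam_const q * exp (- (q * ln eta)) * dlogistic q (u + ln eta))%R.
Proof.
  intros Hq He. assert (B := gam_dom q (u + ln eta) Hq).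
  rewrite exp_plus, exp_ln in B by exact He.
  replace (exp (q * u - eta * exp u))%R
    with (exp (- (q * ln eta)) * exp (q * (u + ln eta) - exp u * eta))%R.
  - assert (P := exp_pos (- (q * ln eta))). nra.
  - rewrite <- exp_plus. f_equal. ring.
Qed.

Lemma is_lim_seq_exp_ln (q : R) : (0 < q)%R -> is_lim_seq (fun n => exp (- (q * ln (INR n))))%R 0.
Proof.
  intros Hq. apply (is_lim_comp_seq exp (fun n => - (q * ln (INR n)))%R m_infty 0).
  - apply is_lim_exp_m.
  - exists O. intros. discriminate.
  - replace m_infty with (Rbar_opp p_infty) by reflexivity. apply -> is_lim_seq_opp.
    assert (L : is_lim_seq (fun n => ln (INR n)) p_infty).
    { apply (is_lim_comp_seq ln INR p_infty p_infty).
      - apply is_lim_ln_p.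
      - exists O. intros. discriminate.
      - apply is_lim_seq_INR. }
    assert (Q := is_lim_seq_scal_l _ q _ L).
    replace (Rbar_mult q p_infty) with p_infty in Q; [exact Q|].
    simpl. destruct (Rle_dec 0 q); [|exfalso; lra].
    destruct (Rle_lt_or_eq_dec 0 q r); [reflexivity|exfalso; lra].
Qed.

(** Under lam = e^u the majorant is the Gamma integrand lam^(q-1) e^(-eta lam) d lam. *)
Definition dominated (q eta K : R) (f : R -> C) : Prop :=
  forall u, (Cmod (f u) <= K * exp (q * u - eta * exp u))%R.

Definition Ccont (f : R -> C) : Prop := forall u : R, Ccontinuous f u.

Lemma Ccont_int (f : R -> C) (a b : R) : Ccont f -> is_CInt f a b (CInt f a b).
Proof. intros H. apply CInt_correct. intros; apply H. Qed.

Lemma dominated_K (q eta K : R) (f : R -> C) : dominated q eta K f -> (0 <= K)%R.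
Proof.
  intros H. specialize (H 0%R). assert (P := exp_pos (q * 0 - eta * exp 0)).
  generalize (Cmod_ge_0 (f 0%R)). nra.
Qed.

Lemma dominated_const_nonneg (K q x : R) :
  (0 <= K)%R -> (0 < q)%R -> (0 <= K * gam_const q * exp x)%R.
Proof.
  intros HK Hq. apply Rmult_le_pos; [apply Rmult_le_pos; [exact HK|]|left; apply exp_pos].
  left. apply gam_const_pos, Hq.
Qed.

Lemma dominated_int (q eta K : R) (f : R -> C) (a b : R) :
  (0 < q)%R -> (0 < eta)%R -> Ccont f -> dominated q eta K f -> (a <= b)%R ->
  (Cmod (CInt f a b) <= K * gam_const q * exp (- (q * ln eta)) *
     (logistic q (b + ln eta) - logistic q (a + ln eta)))%R.
Proof.
  intros Hq He Hc Hd Hab. assert (HK := dominated_K _ _ _ _ Hd).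
  set (D := (K * gam_const q * exp (- (q * ln eta)))%R).
  apply (is_CInt_bound f (fun u => D * dlogistic q (u + ln eta))%R a b _ _ Hab).
  - intros u _. eapply Rle_trans; [apply Hd|]. unfold D.
    rewrite !Rmult_assoc. apply Rmult_le_compat_l; [exact HK|].
    rewrite <- Rmult_assoc. apply gam_dom_scale; assumption.
  - apply Ccont_int, Hc.
  - replace (D * (logistic q (b + ln eta) - logistic q (a + ln eta)))%R
      with (minus (D * logistic q (b + ln eta)) (D * logistic q (a + ln eta)))%R
      by (unfold minus, plus, opp; simpl; ring).
    apply (is_RInt_derive (V := R_CompleteNormedModule) (fun u => D * logistic q (u + ln eta))%R).
    + intros u _. eapply is_derive_eq.
      * apply (is_derive_Rmult (fun _ => D)); [apply (@is_derive_const R_AbsRing R_NormedModule)|].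
        apply (is_derive_comp_R (logistic q) (fun u => u + ln eta)%R); [apply logistic_derive|].
        auto_derive; [trivial|reflexivity].
      * unfold zero; simpl. ring.
    + intros u _. apply (continuous_mult (K := R_AbsRing) (fun _ => D)); [apply continuous_const|].
      apply (continuous_comp_R (fun u => u + ln eta)%R (dlogistic q)); [|apply dlogistic_continuous].
      apply (@ex_derive_continuous R_AbsRing R_NormedModule). auto_derive. trivial.
Qed.

(** Improper integral over the line with two independent ends; with u = ln lam it stands for a
    Mellin integral over the positive axis. *)
Definition is_CR (f : R -> C) (l : C) : Prop :=
  forall eps, (0 < eps)%R -> exists A, forall a b, (a <= - A)%R -> (A <= b)%R ->
    (Cmod (CInt f a b - l) < eps)%R.

Lemma is_CR_ext (f g : R -> C) (l : C) : (forall u, f u = g u) -> is_CR f l -> is_CR g l.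
Proof. intros E. assert (f = g) by (apply functional_extensionality; exact E). subst. trivial. Qed.

Lemma is_CR_eq (f : R -> C) (l l' : C) : is_CR f l -> l = l' -> is_CR f l'.
Proof. intros H <-. exact H. Qed.

Lemma is_CR_plus (f g : R -> C) (l m : C) : Ccont f -> Ccont g ->
  is_CR f l -> is_CR g m -> is_CR (fun u => f u + g u) (l + m).
Proof.
  intros Cf Cg Hf Hg eps He. destruct (Hf (eps / 2)%R) as [A HA]; [lra|].
  destruct (Hg (eps / 2)%R) as [B HB]; [lra|]. exists (Rmax A B). intros a b Ha Hb.
  assert (Q1 := Rmax_l A B). assert (Q2 := Rmax_r A B).
  specialize (HA a b ltac:(lra) ltac:(lra)). specialize (HB a b ltac:(lra) ltac:(lra)).
  rewrite (CInt_unique _ _ _ _ (is_CInt_plus _ _ _ _ _ _ (Ccont_int f a b Cf) (Ccont_int g a b Cg))).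
  assert (Ering : forall x y z t : C, x + y - (z + t) = (x - z) + (y - t)) by (intros; ring).
  rewrite Ering.
  eapply Rle_lt_trans; [apply Cmod_triangle|]. lra.
Qed.

Lemma is_CR_mult (f : R -> C) (c l : C) : Ccont f -> is_CR f l -> is_CR (fun u => c * f u) (c * l).
Proof.
  intros Cf Hf eps He. assert (P : (0 < Cmod c + 1)%R) by (generalize (Cmod_ge_0 c); lra).
  destruct (Hf (eps / (Cmod c + 1))%R) as [A HA]; [apply Rdiv_lt_0_compat; lra|].
  exists A. intros a b Ha Hb. specialize (HA a b Ha Hb).
  rewrite (CInt_unique _ _ _ _ (is_CInt_mult _ _ _ c _ (Ccont_int f a b Cf))).
  assert (Ering : forall x y z : C, x * y - x * z = x * (y - z)) by (intros; ring).
  rewrite Ering, Cmod_mult.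
  apply (Rmult_lt_compat_r (Cmod c + 1)) in HA; [|exact P].
  replace (eps / (Cmod c + 1) * (Cmod c + 1))%R with eps in HA by (field; lra).
  generalize (Cmod_ge_0 (CInt f a b - l)). nra.
Qed.

Lemma is_CR_minus (f g : R -> C) (l m : C) : Ccont f -> Ccont g ->
  is_CR f l -> is_CR g m -> is_CR (fun u => f u - g u) (l - m).
Proof.
  intros Cf Cg Hf Hg. apply (is_CR_ext (fun u => f u + - (1) * g u)); [intros; ring|].
  apply (is_CR_eq _ (l + - (1) * m)); [|ring]. apply is_CR_plus; auto.
  - intros u. apply continuous_Cmult; [apply continuous_const|apply Cg].
  - apply is_CR_mult; auto.
Qed.

Lemma is_CR_bound (q eta K : R) (f : R -> C) (l : C) :
  (0 < q)%R -> (0 < eta)%R -> Ccont f -> dominated q eta K f -> is_CR f l ->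
  (Cmod l <= K * gam_const q * exp (- (q * ln eta)))%R.
Proof.
  intros Hq He Hc Hd Hl. apply Rnot_lt_le. intros Hlt.
  set (D := (K * gam_const q * exp (- (q * ln eta)))%R) in *.
  destruct (Hl (Cmod l - D)%R ltac:(lra)) as [A HA].
  specialize (HA (- Rabs A)%R (Rabs A)). assert (Q := Rle_abs A). assert (Q' := Rabs_pos A).
  specialize (HA ltac:(lra) ltac:(lra)).
  assert (B := dominated_int q eta K f (- Rabs A) (Rabs A) Hq He Hc Hd ltac:(lra)). fold D in B.
  assert (D0 : (0 <= D)%R).
  { apply dominated_const_nonneg; [exact (dominated_K _ _ _ _ Hd)|exact Hq]. }
  assert (L1 := logistic_bounds q (Rabs A + ln eta)). assert (L2 := logistic_bounds q (- Rabs A + ln eta)).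
  rewrite Cmod_minus_sym in HA. assert (T := Cmod_triangle_minus l (CInt f (- Rabs A) (Rabs A))).
  nra.
Qed.

Lemma is_CR_exists (q eta K : R) (f : R -> C) :
  (0 < q)%R -> (0 < eta)%R -> Ccont f -> dominated q eta K f -> exists l, is_CR f l.
Proof.
  intros Hq He Hc Hd.
  set (D := (K * gam_const q * exp (- (q * ln eta)))%R).
  assert (D0 : (0 <= D)%R).
  { apply dominated_const_nonneg; [exact (dominated_K _ _ _ _ Hd)|exact Hq]. }
  (* [t c] bounds the integral of the majorant outside [-c, c]. *)
  set (t c := (D * (logistic q (- c + ln eta) + (1 - logistic q (c + ln eta))))%R).
  assert (Step : forall a b c, (0 <= c)%R -> (a <= - c)%R -> (c <= b)%R ->
     (Cmod (CInt f a b - CInt f (- c) c) <= t c)%R).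
  { intros a b c H0 Ha Hb.
    assert (E : CInt f a b = CInt f a (- c) + CInt f (- c) c + CInt f c b).
    { apply CInt_unique. eapply is_CInt_Chasles; [eapply is_CInt_Chasles|]; apply Ccont_int, Hc. }
    rewrite E.
    assert (B1 := dominated_int q eta K f a (- c) Hq He Hc Hd ltac:(lra)).
    assert (B2 := dominated_int q eta K f c b Hq He Hc Hd ltac:(lra)). fold D in B1, B2.
    assert (Ering : forall x y z : C, x + y + z - y = x + z) by (intros; ring).
    rewrite Ering. eapply Rle_trans; [apply Cmod_triangle|]. unfold t.
    assert (L1 := logistic_bounds q (a + ln eta)). assert (L2 := logistic_bounds q (b + ln eta)). nra. }
  assert (Small : forall eps, (0 < eps)%R -> exists A, (0 <= A)%R /\ forall c, (A <= c)%R -> (t c < eps)%R).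
  { intros eps Heps. destruct (logistic_p q (eps / (2 * (D + 1)))%R Hq) as [A HA].
    { apply Rdiv_lt_0_compat; lra. }
    exists (Rabs A + Rabs (ln eta))%R. assert (Q1 := Rle_abs A). assert (Q2 := Rabs_pos A).
    assert (Q3 := Rle_abs (ln eta)).
    assert (Q5 : (- Rabs (ln eta) <= ln eta)%R) by (generalize (Rcomplements.Rabs_maj2 (ln eta)); lra).
    split; [lra|]. intros c Hcc. destruct (HA (- c + ln eta)%R (c + ln eta)%R) as [H1 H2]; [lra|lra|].
    unfold t. assert (E : (eps = 2 * (D + 1) * (eps / (2 * (D + 1))))%R) by (field; lra).
    set (e := (eps / (2 * (D + 1)))%R) in *. assert (0 < e)%R by (unfold e; apply Rdiv_lt_0_compat; lra). nra. }
  destruct (Clim_cauchy (fun n => CInt f (- INR n) (INR n)) (fun n => t (INR n)) O) as [l [Hl Hb]].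
  - apply is_lim_seq_spec. intros eps. destruct (Small eps (cond_pos eps)) as [A [HA0 HA]].
    destruct (nfloor_ex A HA0) as [N HN]. exists (S N). intros n Hn. apply le_INR in Hn. rewrite S_INR in Hn.
    rewrite Rminus_0_r, Rabs_pos_eq; [apply HA; lra|].
    eapply Rle_trans; [apply Cmod_ge_0|apply (Step (- INR n)%R (INR n) (INR n)); generalize (pos_INR n); lra].
  - intros n m _ Hnm. apply le_INR in Hnm. apply Step; generalize (pos_INR n); lra.
  - exists l. intros eps Heps. destruct (Small (eps / 2)%R ltac:(lra)) as [A [HA0 HA]].
    destruct (nfloor_ex A HA0) as [N HN]. exists (INR (S N)). intros a b Ha Hb'.
    assert (Ht : (t (INR (S N)) < eps / 2)%R) by (apply HA; rewrite S_INR; lra).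
    assert (S1 := Step a b (INR (S N)) (pos_INR _) Ha Hb').
    assert (S2 := Hb (S N) ltac:(lia)). rewrite Cmod_minus_sym in S2.
    assert (T := Cmod_triangle (CInt f a b - CInt f (- INR (S N)) (INR (S N))) (CInt f (- INR (S N)) (INR (S N)) - l)).
    assert (Ering : forall x y z : C, (x - y) + (y - z) = x - z) by (intros; ring).
    rewrite Ering in T. lra.
Qed.

(** On the real axis [leftprim] of length n at T is the integral over [T - n, T]; letting n and then
    T grow exhausts the line. *)
Lemma is_prim_is_CR (h : C -> C) (X : C) :
  Ccont (fun u => h (RtoC u)) -> is_CR (fun u => h (RtoC u)) X ->
  forall eps, (0 < eps)%R -> exists T0, forall T l, (T0 <= T)%R -> is_prim h (RtoC T) l ->
    (Cmod (l - X) <= eps)%R.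
Proof.
  intros Hc HX eps He. destruct (HX (eps / 2)%R ltac:(lra)) as [A HA]. exists A. intros T l HT Hl.
  destruct (Hl (eps / 2)%R ltac:(lra)) as [N HN].
  destruct (nfloor_ex (Rabs (T + A)) (Rabs_pos _)) as [N1 HN1].
  specialize (HN (N + S N1)%nat ltac:(lia)).
  assert (Hn : (T + A <= INR (N + S N1))%R).
  { assert (Q := Rle_abs (T + A)). rewrite plus_INR, S_INR. generalize (pos_INR N). lra. }
  set (n := INR (N + S N1)) in *.
  assert (E : leftprim h n (RtoC T) = CInt (fun u => h (RtoC u)) (T - n) T).
  { apply CInt_unique. apply (is_CInt_ext (fun v => (fun u => h (RtoC u)) (v + T)%R)).
    { intros t _. rewrite RtoC_plus, Cplus_comm. reflexivity. }
    apply (is_CInt_shift (fun u => h (RtoC u))). replace (- n + T)%R with (T - n)%R by ring. rewrite Rplus_0_l.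
    apply (Ccont_int (fun u => h (RtoC u))), Hc. }
  rewrite E in HN. specialize (HA (T - n)%R T ltac:(lra) HT).
  assert (Tr := Cmod_triangle (l - CInt (fun u => h (RtoC u)) (T - n) T) (CInt (fun u => h (RtoC u)) (T - n) T - X)).
  assert (Ering : forall x y z : C, (x - y) + (y - z) = x - z) by (intros; ring).
  rewrite Ering in Tr. rewrite Cmod_minus_sym in HN. lra.
Qed.

(** * Euler's sine product *)

Definition Csin (z : C) : C := (Cexp (Ci * z) - Cexp (- (Ci * z))) / (2 * Ci).

Lemma Ci_nz : Ci <> 0.
Proof. intros H. apply (f_equal Im) in H. simpl in H. lra. Qed.

Lemma Ci_sqr : Ci * Ci = - (1).
Proof. apply C_eq; simpl; ring. Qed.

Lemma RtoC_neq (x : R) : x <> 0%R -> RtoC x <> 0.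
Proof. intros H E. apply H. apply (f_equal Re) in E. exact E. Qed.

Lemma Ccos_0 : Ccos 0 = 1.
Proof. unfold Ccos. replace (Ci * 0) with (RtoC 0) by ring. rewrite Copp_0, Cexp_0. field. Qed.

Lemma Csin_0 : Csin 0 = 0.
Proof.
  unfold Csin. replace (Ci * 0) with (RtoC 0) by ring. rewrite Copp_0, Cexp_0.
  field. apply Ci_nz.
Qed.

Lemma is_Cderive_linear (c : C) (t : R) : is_Cderive (fun t => c * RtoC t) t c.
Proof.
  eapply is_Cderive_eq.
  - apply is_Cderive_mult; [apply is_Cderive_const|].
    apply is_Cderive_RtoC, (is_derive_id (K := R_AbsRing)).
  - unfold one; simpl. ring.
Qed.

Lemma is_Cderive_Ccos (c : C) (t : R) :
  is_Cderive (fun t => Ccos (c * RtoC t)) t (- c * Csin (c * RtoC t)).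
Proof.
  unfold Ccos, Csin.
  apply (@is_derive_ext R_AbsRing C_R_NormedModule
    (fun t => / 2 * (Cexp (Ci * c * RtoC t) + Cexp (- (Ci * c) * RtoC t)))).
  { intros u. replace (- (Ci * (c * u))) with (- (Ci * c) * u) by ring.
    replace (Ci * (c * u)) with (Ci * c * u) by ring. unfold Cdiv. apply Cmult_comm. }
  eapply is_Cderive_eq.
  - apply is_Cderive_mult; [apply is_Cderive_const|].
    apply is_Cderive_plus; apply is_Cderive_exp, is_Cderive_linear.
  - cbv beta. replace (- (Ci * (c * t))) with (- (Ci * c) * t) by ring.
    replace (Ci * (c * t)) with (Ci * c * t) by ring.
    set (x := Cexp (Ci * c * t)). set (y := Cexp (- (Ci * c) * t)).
    transitivity (Ci * c * (x - y) / 2); [field|]. 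
    replace (- c * ((x - y) / (2 * Ci))) with (- (1) * c * (x - y) / (2 * Ci)) by (field; apply Ci_nz).
    rewrite <- Ci_sqr. field. apply Ci_nz.
Qed.

Lemma is_Cderive_Csin (c : C) (t : R) :
  is_Cderive (fun t => Csin (c * RtoC t)) t (c * Ccos (c * RtoC t)).
Proof.
  unfold Ccos, Csin.
  apply (@is_derive_ext R_AbsRing C_R_NormedModule
    (fun t => / (2 * Ci) * (Cexp (Ci * c * RtoC t) + - (1) * Cexp (- (Ci * c) * RtoC t)))).
  { intros u. replace (- (Ci * (c * u))) with (- (Ci * c) * u) by ring.
    replace (Ci * (c * u)) with (Ci * c * u) by ring. unfold Cdiv. rewrite Cmult_comm. f_equal. ring. }
  eapply is_Cderive_eq.
  - apply is_Cderive_mult; [apply is_Cderive_const|].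
    apply is_Cderive_plus; [apply is_Cderive_exp, is_Cderive_linear|].
    apply is_Cderive_mult; [apply is_Cderive_const|].
    apply is_Cderive_exp, is_Cderive_linear.
  - cbv beta. replace (- (Ci * (c * t))) with (- (Ci * c) * t) by ring.
    replace (Ci * (c * t)) with (Ci * c * t) by ring. field. apply Ci_nz.
Qed.

(** The integrals J_n(s) of the classical elementary proof of the sine product: for nonzero s,
    J_0(s) is sin (pi s) / (2 s), and J_n(s) / J_n(0) tends to 1. *)
Definition cosint (n : nat) (s : C) : C :=
  CInt (fun t => RtoC (cos t ^ (2 * n)) * Ccos (2 * s * RtoC t)) 0 (PI / 2).

Lemma cosint_correct (n : nat) (s : C) :
  is_CInt (fun t => RtoC (cos t ^ (2 * n)) * Ccos (2 * s * RtoC t)) 0 (PI / 2) (cosint n s).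
Proof.
  apply Ccont_int. intros t. apply continuous_Cmult.
  - apply continuous_RtoC. apply (continuous_comp_R cos (fun x => x ^ (2 * n))%R); [apply continuous_cos|].
    apply (@ex_derive_continuous R_AbsRing R_NormedModule). auto_derive. trivial.
  - eapply is_Cderive_continuous, is_Cderive_Ccos.
Qed.

(** Two integrations by parts. Compared with its own case s = 0, it says that passing from n to n +
    1 divides the ratio J_n(s) / J_n(0) by 1 - s^2 / (n+1)^2, a factor of [sinprod]. *)
Lemma cosint_rec (n : nat) (s : C) :
  (RtoC (INR (2 * n + 2)) * RtoC (INR (2 * n + 2)) - 4 * s * s) * cosint (S n) s
  = RtoC (INR (2 * n + 2)) * RtoC (INR (2 * n + 1)) * cosint n s.
Proof.
  set (N := RtoC (INR (2 * n + 2))).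
  assert (HN : RtoC (INR (2 * n + 1)) = N - 1).
  { unfold N. rewrite <- RtoC_minus. f_equal. rewrite !plus_INR. simpl. ring. }
  rewrite HN.
  set (c t := Ccos (2 * s * RtoC t)). set (S' t := Csin (2 * s * RtoC t)).
  (* An antiderivative of the difference of the two sides, vanishing at both ends. *)
  set (Psi t := N * (RtoC (cos t ^ (2 * n + 1) * sin t) * c t)
                - 2 * s * (RtoC (cos t ^ (2 * n + 2)) * S' t)).
  assert (I1 := is_CInt_mult _ _ _ (N * N - 4 * s * s) _ (cosint_correct (S n) s)).
  assert (I2 := is_CInt_mult _ _ _ (N * (N - 1)) _ (cosint_correct n s)).
  assert (I3 := is_CInt_minus _ _ _ _ _ _ I1 I2).
  assert (E : Psi (PI / 2)%R - Psi 0%R = 0).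
  { unfold Psi. rewrite cos_PI2, sin_0, Rmult_0_r.
    replace (2 * n + 1)%nat with (S (2 * n)) by lia. replace (2 * n + 2)%nat with (S (2 * n + 1)) by lia.
    simpl pow. rewrite !Rmult_0_l. unfold S'. rewrite (Cmult_0_r (2 * s)), Csin_0. ring. }
  assert (I4 : is_CInt (fun t => (N * N - 4 * s * s) * (RtoC (cos t ^ (2 * S n)) * Ccos (2 * s * RtoC t))
      - N * (N - 1) * (RtoC (cos t ^ (2 * n)) * Ccos (2 * s * RtoC t))) 0 (PI / 2)
      (Psi (PI / 2)%R - Psi 0%R)).
  { apply (is_CInt_derive Psi).
    - intros t _. unfold Psi.
      apply (@is_derive_ext R_AbsRing C_R_NormedModule
        (fun t => N * (RtoC (cos t ^ (2 * n + 1) * sin t) * c t)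
                + - (2 * s) * (RtoC (cos t ^ (2 * n + 2)) * S' t))).
      { intros u. unfold Cminus. f_equal. ring. }
      eapply is_Cderive_eq.
      + apply is_Cderive_plus.
        * apply is_Cderive_mult; [apply is_Cderive_const|apply is_Cderive_mult].
          -- apply (is_Cderive_RtoC _ _ (cos t ^ (2 * n + 2) - INR (2 * n + 1) * cos t ^ (2 * n) * (sin t * sin t))%R).
             auto_derive; [trivial|]. replace (Init.Nat.pred (n + (n + 0) + 1)) with (2 * n)%nat by lia.
             replace (n + (n + 0) + 1)%nat with (2 * n + 1)%nat by lia.
             replace (2 * n + 2)%nat with (S (2 * n + 1)) by lia. simpl pow. ring.
          -- apply is_Cderive_Ccos.
        * apply is_Cderive_mult; [apply is_Cderive_const|apply is_Cderive_mult].
          -- apply (is_Cderive_RtoC _ _ (- INR (2 * n + 2) * cos t ^ (2 * n + 1) * sin t)%R).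
             auto_derive; [trivial|]. replace (Init.Nat.pred (n + (n + 0) + 2)) with (2 * n + 1)%nat by lia.
             replace (n + (n + 0) + 2)%nat with (2 * n + 2)%nat by lia. ring.
          -- apply is_Cderive_Csin.
      + cbv beta. fold (c t) (S' t).
        replace (2 * n + 2)%nat with (S (S (2 * n))) by lia. replace (2 * n + 1)%nat with (S (2 * n)) by lia.
        replace (2 * S n)%nat with (S (S (2 * n))) by lia. simpl pow.
        replace (sin t * sin t)%R with (1 - cos t * cos t)%R
          by (generalize (sin2_cos2 t); unfold Rsqr; lra).
        rewrite !RtoC_minus, !RtoC_mult, RtoC_opp.
        assert (HN' : RtoC (INR (S (S (2 * n)))) = N) by (unfold N; f_equal; f_equal; lia).
        assert (HN2 : RtoC (INR (S (2 * n))) = N - 1) by (rewrite <- HN; f_equal; f_equal; lia).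
        rewrite RtoC_minus, !RtoC_mult, HN', HN2. ring.
    - intros t _. apply continuous_Cminus; (apply continuous_Cmult; [apply continuous_const|]);
      (apply continuous_Cmult; [apply continuous_RtoC|eapply is_Cderive_continuous, is_Cderive_Ccos]).
      + apply (continuous_comp_R cos (fun x => x ^ (2 * S n))%R); [apply continuous_cos|].
        apply (@ex_derive_continuous R_AbsRing R_NormedModule). auto_derive. trivial.
      + apply (continuous_comp_R cos (fun x => x ^ (2 * n))%R); [apply continuous_cos|].
        apply (@ex_derive_continuous R_AbsRing R_NormedModule). auto_derive. trivial. }
  rewrite E in I4. assert (Z := is_CInt_unique2 _ _ _ _ _ I3 I4).
  replace ((N * N - 4 * s * s) * cosint (S n) s)
    with ((N * N - 4 * s * s) * cosint (S n) s - N * (N - 1) * cosint n s + N * (N - 1) * cosint n s) by ring.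
  rewrite Z. ring.
Qed.

Fixpoint sinprod (s : C) (n : nat) : C :=
  match n with
  | O => 1
  | S k => sinprod s k * (1 - s * s / (RtoC (INR (S k)) * RtoC (INR (S k))))
  end.

(** The telescoped ratio, multiplied out to avoid denominators. *)
Lemma sinprod_cosint (n : nat) (s : C) :
  sinprod s n * cosint n s * cosint 0 0 = cosint 0 s * cosint n 0.
Proof.
  induction n as [|n IH]; [simpl; ring|].
  set (N := RtoC (INR (S n))).
  assert (HN : N <> 0) by (apply RtoC_neq, not_0_INR; lia).
  assert (E1 := cosint_rec n s). assert (E2 := cosint_rec n 0).
  replace (RtoC (INR (2 * n + 2))) with (2 * N) in E1, E2.
  2:{ unfold N. rewrite <- RtoC_mult. f_equal. rewrite S_INR, plus_INR, mult_INR. simpl. ring. }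
  set (M := RtoC (INR (2 * n + 1))) in *.
  change (sinprod s (S n)) with (sinprod s n * (1 - s * s / (N * N))).
  replace (sinprod s n * (1 - s * s / (N * N)) * cosint (S n) s * cosint 0 0)
    with (sinprod s n * cosint 0 0 * ((2 * N * (2 * N) - 4 * s * s) * cosint (S n) s) / (2 * N * (2 * N)))
    by (field; exact HN).
  rewrite E1.
  replace (sinprod s n * cosint 0 0 * (2 * N * M * cosint n s) / (2 * N * (2 * N)))
    with ((sinprod s n * cosint n s * cosint 0 0) * (2 * N * M) / (2 * N * (2 * N))) by (field; exact HN).
  rewrite IH.
  replace (cosint 0 s * cosint n 0 * (2 * N * M) / (2 * N * (2 * N)))
    with (cosint 0 s * (2 * N * M * cosint n 0) / (2 * N * (2 * N))) by (field; exact HN).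
  rewrite <- E2. field. exact HN.
Qed.

Lemma cosint_0 (s : C) : s <> 0 -> cosint 0 s = Csin (RtoC PI * s) / (2 * s).
Proof.
  intros Hs. apply (is_CInt_unique2 _ _ _ _ _ (cosint_correct 0 s)).
  apply (is_CInt_eq _ _ _ (Csin (2 * s * RtoC (PI / 2)) / (2 * s) - Csin (2 * s * RtoC 0) / (2 * s))).
  - apply (is_CInt_derive (fun t => Csin (2 * s * RtoC t) / (2 * s))).
    + intros t _. unfold Cdiv.
      eapply is_Cderive_eq.
      * apply is_Cderive_mult; [apply is_Cderive_Csin|apply is_Cderive_const].
      * cbv beta. simpl pow. field. exact Hs.
    + intros t _. simpl pow. apply continuous_Cmult; [apply continuous_const|].
      eapply is_Cderive_continuous, is_Cderive_Ccos.
  - rewrite Cmult_0_r, Csin_0. replace (2 * s * RtoC (PI / 2)) with (RtoC PI * s).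
    + unfold Cdiv. ring.
    + apply C_eq; simpl; field.
Qed.

Lemma cosint_00 : cosint 0 0 = RtoC (PI / 2).
Proof.
  apply (is_CInt_unique2 _ _ _ _ _ (cosint_correct 0 0)).
  apply (is_CInt_ext (fun _ => 1)).
  { intros t _. rewrite Cmult_0_r, Cmult_0_l, Ccos_0. simpl pow. ring. }
  apply (is_CInt_eq _ _ _ (RtoC (PI / 2) - RtoC 0)); [|ring].
  apply (is_CInt_derive RtoC).
  - intros t _. apply is_Cderive_RtoC, (is_derive_id (K := R_AbsRing)).
  - intros t _. apply continuous_const.
Qed.

Lemma cosint_real_pos (n : nat) : exists J : R, (0 < J)%R /\ cosint n 0 = RtoC J.
Proof.
  induction n as [|n [J [HJ E]]].
  - exists (PI / 2)%R. split; [generalize PI_RGT_0; lra|apply cosint_00].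
  - assert (R := cosint_rec n 0). rewrite E in R.
    assert (P2 : (0 < INR (2 * n + 2))%R) by (apply lt_0_INR; lia).
    assert (P1 : (0 < INR (2 * n + 1))%R) by (apply lt_0_INR; lia).
    exists (INR (2 * n + 1) / INR (2 * n + 2) * J)%R. split.
    { apply Rmult_lt_0_compat; [apply Rdiv_lt_0_compat|]; assumption. }
    rewrite RtoC_mult, RtoC_div by lra.
    assert (Q2 := RtoC_neq (INR (2 * n + 2)) ltac:(lra)).
    set (N := RtoC (INR (2 * n + 2))) in *.
    replace (cosint (S n) 0) with ((N * N - 4 * 0 * 0) * cosint (S n) 0 / (N * N)) by (field; exact Q2).
    rewrite R. field. exact Q2.
Qed.

(** sin t >= t - t^3/6, and t <= 2 makes the right side at least t/3. *)
Lemma sin_lower (t : R) : (0 <= t <= PI / 2)%R -> (t / 3 <= sin t)%R.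
Proof.
  intros Ht. assert (P4 := PI_4).
  destruct (pre_sin_bound t 0) as [H _]; [lra|lra|].
  unfold sin_approx, sin_term in H. simpl in H.
  assert (t * (t * t) <= t * 4)%R by nra. 
  eapply Rle_trans; [|exact H]. field_simplify. nra.
Qed.

(** With z = 2 i s t, cos (2 s t) - 1 = (e^z - 1)^2 e^(-z) / 2 is quadratic in t, hence in sin t,
    and cos^(2n) t sin^2 t integrates to J_n(0) - J_(n+1)(0). Since |z| <= 4 |s|, each of three
    exponentials costs e^(4 |s|); 72 is 4 . 4 / 2 times the 9 of t^2 <= 9 sin^2 t. *)
Lemma cosint_near (n : nat) (s : C) : (Cmod (cosint n s - cosint n 0)
  <= (72 * Cmod s ^ 2 * exp (3 * (4 * Cmod s))) * Re (cosint n 0 - cosint (S n) 0))%R.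
Proof.
  set (K := (72 * Cmod s ^ 2 * exp (3 * (4 * Cmod s)))%R).
  assert (Pi := PI_RGT_0). assert (P4 := PI_4).
  assert (I1 := is_CInt_minus _ _ _ _ _ _ (cosint_correct n s) (cosint_correct n 0)).
  assert (I2 := is_RInt_scal _ _ _ K _ (CInt_Re _ _ _ _
     (is_CInt_minus _ _ _ _ _ _ (cosint_correct n 0) (cosint_correct (S n) 0)))).
  refine (is_CInt_bound _ _ 0 (PI / 2) _ _ _ _ I1 I2); [lra|].
  intros t Ht. cbv beta. rewrite Cmult_0_r, Cmult_0_l, Ccos_0, !Cmult_1_r.
  replace (2 * S n)%nat with (S (S (2 * n))) by lia. change (cos t ^ S (S (2 * n)))%R with (cos t * (cos t * cos t ^ (2 * n)))%R.
  set (k := (cos t ^ (2 * n))%R).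
  assert (Hk : (0 <= k)%R). { unfold k. rewrite pow_mult. apply pow_le, pow2_ge_0. }
  replace (RtoC k * Ccos (2 * s * RtoC t) - RtoC k) with (RtoC k * (Ccos (2 * s * RtoC t) - 1)) by ring.
  rewrite Cmod_mult, Cmod_R, Rabs_pos_eq by exact Hk.
  replace (Re (RtoC k - RtoC (cos t * (cos t * k)))) with (k * (sin t * sin t))%R.
  2:{ simpl. generalize (sin2_cos2 t). unfold Rsqr. intros H.
      replace (sin t * sin t)%R with (1 - cos t * cos t)%R by lra. ring. }
  change (k * Cmod (Ccos (2 * s * t) - 1) <= K * (k * (sin t * sin t)))%R.
  replace (K * (k * (sin t * sin t)))%R with (k * (K * (sin t * sin t)))%R by ring.
  apply Rmult_le_compat_l; [exact Hk|].
  set (z := Ci * (2 * s * RtoC t)).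
  assert (E : Ccos (2 * s * RtoC t) - 1 = (Cexp z - 1) * (Cexp z - 1) * Cexp (- z) / 2).
  { unfold Ccos. fold z. rewrite Cexp_opp. field. apply Cexp_nz. }
  rewrite E. unfold Cdiv. rewrite !Cmod_mult, Cmod_inv, Cmod_R, (Rabs_pos_eq 2), Cmod_Cexp
    by (try apply RtoC_neq; lra).
  assert (Mz : Cmod z = (2 * Cmod s * t)%R).
  { unfold z. rewrite !Cmod_mult, Cmod_Ci, !Cmod_R, !Rabs_pos_eq by lra. ring. }
  assert (Hm := Cmod_ge_0 s). set (m := Cmod s) in *.
  assert (Bz : (Cmod (Cexp z - 1) <= 4 * m * t * exp (4 * m))%R).
  { eapply Rle_trans; [apply Cmod_exp_minus_1|]. rewrite Mz.
    replace (2 * (2 * m * t) * exp (2 * m * t))%R with (4 * m * t * exp (2 * m * t))%R by ring.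
    apply Rmult_le_compat_l; [nra|]. apply exp_le. nra. }
  assert (Be : (exp (Re (- z)) <= exp (4 * m))%R).
  { apply exp_le. assert (Q := re_le_Cmod (- z)). rewrite Cmod_opp, Mz in Q.
    assert (Q2 := Rle_abs (Re (- z))). nra. }
  assert (Hs := sin_lower t Ht).
  assert (Hss : (t * t <= 9 * (sin t * sin t))%R) by nra.
  assert (P0 := Cmod_ge_0 (Cexp z - 1)).
  assert (Pz := exp_pos (Re (- z))).
  apply Rle_trans with ((4 * m * t * exp (4 * m)) * (4 * m * t * exp (4 * m)) * exp (4 * m) * / 2)%R.
  - apply Rmult_le_compat_r; [lra|]. apply Rmult_le_compat; try lra; [nra|].
    apply Rmult_le_compat; lra.
  - unfold K. replace (3 * (4 * m))%R with (4 * m + 4 * m + 4 * m)%R by ring. rewrite !exp_plus.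
    set (e := exp (4 * m)) in *.
    assert (Pm : (0 <= m * m * (e * e * e))%R) by (repeat apply Rmult_le_pos; lra).
    replace (4 * m * t * e * (4 * m * t * e) * e * / 2)%R with (8 * (m * m * (e * e * e)) * (t * t))%R by field.
    replace (72 * m ^ 2 * (e * e * e) * (sin t * sin t))%R
      with (8 * (m * m * (e * e * e)) * (9 * (sin t * sin t)))%R by ring.
    apply Rmult_le_compat_l; [lra|exact Hss].
Qed.

Lemma is_lim_seq_inv_INR (K : R) : is_lim_seq (fun n => K / INR n)%R 0.
Proof.
  replace (Finite 0) with (Rbar_mult K 0) by (simpl; f_equal; ring).
  apply is_lim_seq_scal_l. replace (Finite 0) with (Rbar_inv p_infty) by reflexivity.
  apply is_lim_seq_inv; [apply is_lim_seq_INR|discriminate].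
Qed.

(** By the recurrence at s = 0, J_n(0) - J_(n+1)(0) = J_n(0) / (2n + 2), so the relative error is
    O(1/n). *)
Lemma cosint_ratio (s : C) : Clim (fun n => cosint n s / cosint n 0) 1.
Proof.
  set (K := (72 * Cmod s ^ 2 * exp (3 * (4 * Cmod s)))%R).
  apply (Clim_squeeze _ _ (fun n => K / INR n)%R); [|apply is_lim_seq_inv_INR].
  intros n Hn. destruct (cosint_real_pos n) as [J [HJ EJ]].
  assert (B := cosint_near n s). fold K in B.
  assert (R := cosint_rec n 0). rewrite EJ in *.
  assert (JC := RtoC_neq J ltac:(lra)).
  assert (P2 : (0 < INR (2 * n + 2))%R) by (apply lt_0_INR; lia).
  assert (Q2 := RtoC_neq (INR (2 * n + 2)) ltac:(lra)).
  assert (E : cosint (S n) 0 = RtoC (J - J / INR (2 * n + 2))).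
  { rewrite RtoC_minus, RtoC_div by lra.
    replace (RtoC (INR (2 * n + 1))) with (RtoC (INR (2 * n + 2)) - 1) in R.
    2:{ rewrite <- RtoC_minus. f_equal. rewrite !plus_INR. simpl. ring. }
    set (N := RtoC (INR (2 * n + 2))) in *.
    replace (cosint (S n) 0) with ((N * N - 4 * 0 * 0) * cosint (S n) 0 / (N * N)) by (field; exact Q2).
    rewrite R. field. exact Q2. }
  rewrite E in B.
  replace (Re (RtoC J - RtoC (J - J / INR (2 * n + 2)))) with (J / INR (2 * n + 2))%R in B by (simpl; ring).
  replace (cosint n s / J - 1) with ((cosint n s - J) / J) by (field; exact JC).
  rewrite Cmod_div, Cmod_R, Rabs_pos_eq by (try exact JC; lra).
  apply Rle_trans with (K * (J / INR (2 * n + 2)) / J)%R.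
  - apply Rmult_le_compat_r; [left; apply Rinv_0_lt_compat, HJ|exact B].
  - replace (K * (J / INR (2 * n + 2)) / J)%R with (K * / INR (2 * n + 2))%R by (field; lra).
    assert (0 <= K)%R.
    { unfold K. apply Rmult_le_pos; [|left; apply exp_pos]. assert (Q := pow2_ge_0 (Cmod s)). lra. }
    apply Rmult_le_compat_l; [assumption|]. apply Rinv_le_contravar; [apply lt_0_INR; lia|].
    apply le_INR. lia.
Qed.

(** * The Gamma integral and the reflection formula *)

(** Euler's integral for Gamma after lam = e^u, as a relation between s and the value. *)
Definition is_Gam (s l : C) : Prop := is_CR (fun u => Cexp (s * RtoC u - RtoC (exp u))) l.

Lemma Gam_cont (s c : C) : Ccont (fun u => Cexp (s * RtoC u - Cexp (RtoC u + c))).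
Proof.
  intros u. apply continuous_Cexp, continuous_Cminus.
  - apply continuous_Cmult; [apply continuous_const|apply continuous_RtoC, continuous_id].
  - apply continuous_Cexp, continuous_Cplus; [apply continuous_RtoC, continuous_id|apply continuous_const].
Qed.

Lemma Gam_dominated (s c : C) :
  dominated (Re s) (exp (Re c) * cos (Im c)) 1 (fun u => Cexp (s * RtoC u - Cexp (RtoC u + c))).
Proof.
  intros u. rewrite Cmod_Cexp, Rmult_1_l. right. f_equal.
  rewrite Cexp_add, Cexp_RtoC. unfold Cexp, Re, Im. simpl. ring.
Qed.

Lemma exp_dbl_small (q eta eps : R) : (0 < eta)%R -> (0 < eps)%R ->
  exists T0, forall T, (T0 <= T)%R -> (exp (q * T - eta * exp T) < eps)%R.
Proof.
  intros He Hep.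
  (* The spare 1 in the exponent p leaves q T <= p T - T for T >= 0, while p T - eta e^T is bounded
     above. *)
  set (p := (Rabs q + 1)%R). assert (Hp : (0 < p)%R) by (unfold p; generalize (Rabs_pos q); lra).
  assert (Hq := Rle_abs q).
  set (K := (p * ln p - p - p * ln eta)%R).
  exists (Rmax 0 (K - ln eps + 1)). intros T HT.
  assert (T1 := Rmax_l 0 (K - ln eps + 1)). assert (T2 := Rmax_r 0 (K - ln eps + 1)).
  assert (B := exp_pow_bound p (T + ln eta) Hp).
  rewrite <- (exp_ln eps) by exact Hep. apply exp_increasing.
  assert (B' : (p * (T + ln eta) - exp (T + ln eta) <= p * ln p - p)%R).
  { apply Rnot_lt_le. intros H. apply exp_increasing in H. lra. }
  rewrite exp_plus, exp_ln in B' by exact He.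
  assert (q * T <= p * T - T)%R by (unfold p; nra). unfold K in *. lra.
Qed.

Lemma Gam_exists (s : C) : (0 < Re s)%R -> exists l, is_Gam s l.
Proof.
  intros Hs. destruct (is_CR_exists (Re s) (exp (Re 0) * cos (Im 0)) 1
     (fun u => Cexp (s * RtoC u - Cexp (RtoC u + 0)))) as [l Hl].
  - exact Hs.
  - simpl. rewrite exp_0, cos_0. lra.
  - apply Gam_cont.
  - apply Gam_dominated.
  - exists l. revert Hl. apply is_CR_ext. intros u. rewrite Cplus_0_r, Cexp_RtoC. reflexivity.
Qed.

Lemma hol_True_open (z : C) : True -> @locally C_UniformSpace z (fun _ => True).
Proof. intros _. exists (mkposreal 1 Rlt_0_1). trivial. Qed.

Lemma leftprim_translate (h : C -> C) (c z : C) (N : R) :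
  leftprim (fun w => h (w + c)) N z = leftprim h N (z + c).
Proof.
  unfold leftprim. f_equal. apply functional_extensionality. intros v. f_equal. ring.
Qed.

(** Turning the ray of integration by e^c is the translation u -> u + c. The two lines have the same
    primitive, and the segment from T to T + c contributes nothing in the limit, because |Im c| <
    pi/2 keeps Re e^(T + t c) of order e^T. *)
Lemma Gam_scale (s c l : C) : (0 < Re s)%R -> (- (PI / 2) < Im c < PI / 2)%R -> is_Gam s l ->
  is_CR (fun u => Cexp (s * RtoC u - Cexp (RtoC u + c))) (Cexp (- (s * c)) * l).
Proof.
  intros Hs Hc Hl.
  assert (Hcos : forall t, (0 <= t <= 1)%R -> (cos (Im c) <= cos (t * Im c))%R).
  { intros t Ht. destruct (Rle_dec 0 (Im c)).
    - apply cos_decr_1; nra.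
    - rewrite <- (cos_neg (Im c)), <- (cos_neg (t * Im c)). apply cos_decr_1; nra. }
  assert (Heta : (0 < exp (Re c) * cos (Im c))%R).
  { apply Rmult_lt_0_compat; [apply exp_pos|apply cos_gt_0; lra]. }
  set (h w := Cexp (s * w - Cexp w)).
  set (hc w := h (w + c)).
  assert (Hol_h : hol (fun _ => True) h).
  { unfold h. apply hol_exp, hol_minus; [apply hol_mult; [apply hol_const|apply hol_id]|].
    apply hol_exp, hol_id. }
  assert (Dec : forall B : R, exists U K q : R, (0 < q)%R /\ forall z : C,
      (Re z <= U)%R -> (Rabs (Im z) <= B)%R -> (Cmod (h z) <= K * exp (q * Re z))%R).
  { intros B. exists 0%R, (exp (Rabs (Im s) * B + 1)), (Re s). split; [exact Hs|].
    intros z Hz HB. unfold h. rewrite Cmod_Cexp, <- exp_plus. apply exp_le.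
    assert (E : Re (s * z - Cexp z) = (Re s * Re z - Im s * Im z - exp (Re z) * cos (Im z))%R)
      by (unfold Cexp, Re, Im; simpl; ring).
    rewrite E.
    assert (A1 : (- (Im s * Im z) <= Rabs (Im s) * B)%R).
    { eapply Rle_trans; [apply Rle_abs|]. rewrite ?Rabs_Ropp, Rabs_mult, ?Rabs_Ropp.
      apply Rmult_le_compat_l; [apply Rabs_pos|exact HB]. }
    assert (A2 : (exp (Re z) <= 1)%R) by (rewrite <- exp_0; apply exp_le, Hz).
    assert (A3 := COS_bound (Im z)). assert (A4 := exp_pos (Re z)). nra. }
  assert (Cc : Ccont (fun u => hc (RtoC u))).
  { intros u. unfold hc, h. apply continuous_Cexp, continuous_Cminus.
    - apply continuous_Cmult; [apply continuous_const|].
      apply continuous_Cplus; [apply continuous_RtoC, continuous_id|apply continuous_const].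
    - apply continuous_Cexp, continuous_Cplus; [apply continuous_RtoC, continuous_id|apply continuous_const]. }
  destruct (is_CR_exists _ _ _ _ Hs Heta (Gam_cont s c) (Gam_dominated s c)) as [m Hm].
  assert (Hhc : is_CR (fun u => hc (RtoC u)) (Cexp (s * c) * m)).
  { apply (is_CR_ext (fun u => Cexp (s * c) * Cexp (s * RtoC u - Cexp (RtoC u + c)))).
    - intros u. unfold hc, h. rewrite <- Cexp_add. f_equal. ring.
    - apply is_CR_mult; [apply Gam_cont|exact Hm]. }
  assert (Hh : is_CR (fun u => h (RtoC u)) l).
  { apply (is_CR_ext (fun u => Cexp (s * RtoC u - RtoC (exp u)))); [|exact Hl].
    intros u. unfold h. rewrite Cexp_RtoC. reflexivity. }
  assert (Ch : Ccont (fun u => h (RtoC u))).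
  { intros u. generalize (Gam_cont s 0 u). apply continuous_ext_loc. 
    exists (mkposreal 1 Rlt_0_1). intros v _. unfold h. rewrite Cplus_0_r. reflexivity. }
  assert (Q : Cexp (s * c) * m = l).
  { destruct (Req_dec (Cmod (Cexp (s * c) * m - l)) 0) as [Z|Z].
    { apply Cmod_eq_0 in Z. replace (Cexp (s * c) * m) with (Cexp (s * c) * m - l + l) by ring.
      rewrite Z. ring. }
    exfalso. set (d := Cmod (Cexp (s * c) * m - l)) in *.
    assert (Hd : (0 < d)%R) by (generalize (Cmod_ge_0 (Cexp (s * c) * m - l)); fold d; lra).
    destruct (is_prim_is_CR h l Ch Hh (d / 4)%R ltac:(lra)) as [T1 HT1].
    destruct (is_prim_is_CR hc _ Cc Hhc (d / 4)%R ltac:(lra)) as [T2 HT2].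
    (* [eta] is a lower bound of e^(t Re c) cos (t Im c) for t in [0, 1]. *)
    set (q := Re s) in *. set (eta := (exp (- Rabs (Re c)) * cos (Im c))%R).
    assert (Heta' : (0 < eta)%R).
    { apply Rmult_lt_0_compat; [apply exp_pos|apply cos_gt_0; lra]. }
    set (K := exp (Cmod s * Cmod c)). assert (PK : (0 < K)%R) by apply exp_pos.
    assert (Pc := Cmod_ge_0 c).
    destruct (exp_dbl_small q eta (d / (4 * (K * (Cmod c + 1)))) Heta') as [T3 HT3].
    { apply Rdiv_lt_0_compat; [lra|]. apply Rmult_lt_0_compat; [lra|]. apply Rmult_lt_0_compat; lra. }
    set (T := Rmax T1 (Rmax T2 T3)).
    assert (M1 := Rmax_l T1 (Rmax T2 T3)). assert (M2 := Rmax_r T1 (Rmax T2 T3)).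
    assert (M3 := Rmax_l T2 T3). assert (M4 := Rmax_r T2 T3). fold T in M1, M2.
    destruct (is_prim_exists (fun _ => True) h Hol_h Dec (RtoC T)) as [lT HlT]; [trivial|].
    destruct (is_prim_exists (fun _ => True) h Hol_h Dec (RtoC T + c)) as [lc Hlc]; [trivial|].
    assert (B1 := HT1 T lT ltac:(lra) HlT).
    assert (B2 : (Cmod (lc - Cexp (s * c) * m) <= d / 4)%R).
    { apply (HT2 T lc ltac:(lra)). unfold is_prim.
      apply (Clim_ext (fun N => leftprim h (INR N) (RtoC T + c))); [|exact Hlc].
      intros n. symmetry. apply leftprim_translate. }
    assert (P := path_integral (fun _ => True) h hol_True_open Hol_h Dec
       (fun t => RtoC T + c * RtoC t) (fun _ => c) 0 1 lT lc).
    assert (B3 : (Cmod (lc - lT) <= (1 - 0) * (exp (q * T - eta * exp T) * K * Cmod c))%R).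
    { apply (is_CInt_bound_const (fun t => h (RtoC T + c * RtoC t) * c) 0 1); [lra| |].
      - intros t Ht. rewrite Cmod_mult. apply Rmult_le_compat_r; [exact Pc|].
        unfold h, K. rewrite Cmod_Cexp, <- exp_plus. apply exp_le.
        assert (E : Re (s * (RtoC T + c * RtoC t) - Cexp (RtoC T + c * RtoC t)) =
          (q * T + t * Re (s * c) - exp T * (exp (t * Re c) * cos (t * Im c)))%R).
        { unfold q. rewrite Cexp_add, Cexp_RtoC. unfold Cexp, Re, Im. simpl.
          replace (fst c * t - snd c * 0)%R with (t * fst c)%R by ring.
          replace (fst c * 0 + snd c * t)%R with (t * snd c)%R by ring. ring. }
        rewrite E.
        assert (A1 : (t * Re (s * c) <= Cmod s * Cmod c)%R).
        { rewrite <- Cmod_mult. assert (A := re_le_Cmod (s * c)). assert (A' := Rle_abs (Re (s * c))).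
          assert (A3 := Cmod_ge_0 (s * c)). nra. }
        assert (A2 : (eta <= exp (t * Re c) * cos (t * Im c))%R).
        { unfold eta. apply Rmult_le_compat.
          - left; apply exp_pos.
          - left; apply cos_gt_0; lra.
          - apply exp_le. assert (A := Rabs_pos (Re c)). assert (A' := Rcomplements.Rabs_maj2 (Re c)). nra.
          - apply Hcos, Ht. }
        assert (A4 := exp_pos T). nra.
      - apply P.
        + lra.
        + intros t _. exists (mkposreal 1 Rlt_0_1). intros u _.
          eapply is_Cderive_eq; [apply is_Cderive_plus; [apply is_Cderive_const|apply is_Cderive_linear]|ring].
        + intros; apply continuous_const.
        + trivial.
        + cbv beta. replace (RtoC T + c * RtoC 0) with (RtoC T) by ring. exact HlT.
        + cbv beta. replace (RtoC T + c * RtoC 1) with (RtoC T + c) by ring. exact Hlc. }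
    specialize (HT3 T ltac:(lra)).
    assert (B4 : (exp (q * T - eta * exp T) * K * Cmod c <= d / 4)%R).
    { apply Rle_trans with (d / (4 * (K * (Cmod c + 1))) * K * (Cmod c + 1))%R.
      - assert (A := exp_pos (q * T - eta * exp T)).
        apply Rmult_le_compat; try nra.
      - right. field. split; lra. }
    assert (Tr := Cmod_triangle (Cexp (s * c) * m - lc) (lc - lT + (lT - l))).
    assert (Tr2 := Cmod_triangle (lc - lT) (lT - l)).
    replace (Cexp (s * c) * m - lc + (lc - lT + (lT - l))) with (Cexp (s * c) * m - l) in Tr by ring.
    rewrite (Cmod_minus_sym (Cexp (s * c) * m) lc) in Tr. fold d in Tr. lra. }
  apply (is_CR_eq _ m); [exact Hm|]. rewrite <- Q, Cmult_assoc, Cexp_opp_l. ring.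
Qed.

(** * Beta integrals and the Gauss product *)

Lemma rising_shift (s : C) (n : nat) : s * rising (s + 1) n = rising s (S n).
Proof.
  induction n as [|n IH]; [simpl; ring|].
  change (rising (s + 1) (S n)) with (rising (s + 1) n * (s + 1 + RtoC (INR (S n)))).
  change (rising s (S (S n))) with (rising s (S n) * (s + RtoC (INR (S (S n))))).
  rewrite <- IH, (S_INR (S n)), RtoC_plus. ring.
Qed.

Lemma rising_nz (s : C) (n : nat) : (forall k : nat, s <> - RtoC (INR k)) -> rising s n <> 0.
Proof.
  intros H. induction n as [|n IH].
  - simpl. intros E. apply (H O). simpl. rewrite E. ring.
  - apply Cmult_neq_0; [exact IH|]. intros E. apply (H (S n)).
    replace s with (s + RtoC (INR (S n)) - RtoC (INR (S n))) by ring. rewrite E. ring.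
Qed.

Lemma Re_pos_not_pole (s : C) : (0 < Re s)%R -> forall k : nat, s <> - RtoC (INR k).
Proof. intros H k E. rewrite E in H. simpl in H. generalize (pos_INR k). lra. Qed.

(** This is max (0, 1 - e^u), written with an absolute value so that its continuity is immediate; it
    extends the integrand of the Beta integral over (0, 1) to the whole line. *)
Definition pospart (u : R) : R := ((1 - exp u + Rabs (1 - exp u)) / 2)%R.

Lemma pospart_neg (u : R) : (u <= 0)%R -> pospart u = (1 - exp u)%R.
Proof.
  intros H. unfold pospart. assert (exp u <= 1)%R by (rewrite <- exp_0; apply exp_le, H).
  rewrite Rabs_pos_eq by lra. field.
Qed.

Lemma pospart_pos (u : R) : (0 <= u)%R -> pospart u = 0%R.
Proof.
  intros H. unfold pospart. assert (1 <= exp u)%R by (rewrite <- exp_0; apply exp_le, H).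
  rewrite Rabs_left1 by lra. field.
Qed.

Lemma pospart_pow_continuous (n : nat) (u : R) : continuous (fun u => pospart u ^ n)%R u.
Proof.
  apply (continuous_comp_R pospart (fun x => x ^ n)%R).
  - unfold pospart. apply (continuous_mult (K := R_AbsRing)); [|apply continuous_const].
    assert (E : continuous (fun u => 1 - exp u)%R u).
    { apply (@ex_derive_continuous R_AbsRing R_NormedModule). auto_derive. trivial. }
    apply (continuous_plus (fun u => 1 - exp u)%R (fun u => Rabs (1 - exp u))%R); [exact E|].
    apply (continuous_comp_R _ Rabs); [exact E|apply continuous_Rabs].
  - apply (@ex_derive_continuous R_AbsRing R_NormedModule). auto_derive. trivial.
Qed.

Lemma beta_cont (s : C) (n : nat) : Ccont (fun u => Cexp (s * RtoC u) * RtoC (pospart u ^ n)).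
Proof.
  intros u. apply continuous_Cmult.
  - apply continuous_Cexp, continuous_Cmult; [apply continuous_const|apply continuous_RtoC, continuous_id].
  - apply continuous_RtoC, pospart_pow_continuous.
Qed.

(** The induction starts at exponent 1: with exponent 0 the integrand would be e^(s u) on the whole
    line, which is not integrable. *)
Lemma beta_base (s : C) : (0 < Re s)%R ->
  is_CR (fun u => Cexp (s * RtoC u) * RtoC (pospart u ^ 1)) (/ s - / (s + 1)).
Proof.
  intros Hs.
  assert (S0 : s <> 0) by (intros E; rewrite E in Hs; simpl in Hs; lra).
  assert (S1 : s + 1 <> 0) by (intros E; apply (f_equal Re) in E; simpl in E; unfold Re in Hs; lra).
  set (Fa u := / s * Cexp (s * RtoC u) + - / (s + 1) * Cexp ((s + 1) * RtoC u)).
  assert (I : forall a b, (a <= 0)%R -> (0 <= b)%R ->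
     CInt (fun u => Cexp (s * RtoC u) * RtoC (pospart u ^ 1)) a b = Fa 0%R - Fa a).
  { intros a b Ha Hb. apply CInt_unique. apply (is_CInt_eq _ _ _ (Fa 0%R - Fa a + RtoC 0)); [|ring].
    apply is_CInt_Chasles with 0%R.
    - apply (is_CInt_ext (fun u => Cexp (s * RtoC u) - Cexp ((s + 1) * RtoC u))).
      { rewrite Rmin_left, Rmax_right by exact Ha. intros t Ht.
        rewrite pow_1, pospart_neg by lra.
        rewrite Cmult_plus_distr_r, Cmult_1_l, Cexp_add, Cexp_RtoC, RtoC_minus. ring. }
      apply (is_CInt_derive Fa).
      + intros t _. unfold Fa. eapply is_Cderive_eq.
        * apply is_Cderive_plus; (apply is_Cderive_mult; [apply is_Cderive_const|]);
          apply is_Cderive_exp, is_Cderive_linear.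
        * cbv beta. field. split; assumption.
      + intros t _. apply continuous_Cminus; apply continuous_Cexp, continuous_Cmult;
        solve [apply continuous_const|apply continuous_RtoC, continuous_id].
    - apply (is_CInt_ext (fun _ => RtoC 0)).
      { rewrite Rmin_left, Rmax_right by exact Hb. intros t Ht.
        rewrite pow_1, pospart_pos by lra. ring. }
      assert (Z := @is_RInt_const C_R_NormedModule 0 b (RtoC 0)).
      apply (is_CInt_eq _ _ _ _ _ Z). apply C_eq; unfold scal; simpl; unfold scal; simpl; unfold mult; simpl; ring. }
  intros eps He. set (K := (Cmod (/ s) + Cmod (/ (s + 1)))%R).
  assert (HK : (0 < K + 1)%R) by (unfold K; generalize (Cmod_ge_0 (/ s)) (Cmod_ge_0 (/ (s + 1))); lra).
  exists (Rmax 0 (- (ln (eps / (K + 1)) / Re s) + 1)). intros a b Ha Hb.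
  assert (M1 := Rmax_l 0 (- (ln (eps / (K + 1)) / Re s) + 1)).
  assert (M2 := Rmax_r 0 (- (ln (eps / (K + 1)) / Re s) + 1)).
  rewrite I by lra.
  assert (F0 : Fa 0%R = / s - / (s + 1)) by (unfold Fa; rewrite !Cmult_0_r, Cexp_0; ring).
  assert (Er : forall x y z : C, x = z -> x - y - z = - y) by (intros; subst; ring).
  rewrite (Er _ _ _ F0), Cmod_opp.
  assert (Ea : (exp (Re s * a) < eps / (K + 1))%R).
  { rewrite <- (exp_ln (eps / (K + 1))) by (apply Rdiv_lt_0_compat; lra). apply exp_increasing.
    assert (a < ln (eps / (K + 1)) / Re s)%R by lra.
    apply (Rmult_lt_compat_l (Re s)) in H; [|exact Hs].
    replace (Re s * (ln (eps / (K + 1)) / Re s))%R with (ln (eps / (K + 1))) in H by (field; lra). exact H. }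
  apply Rle_lt_trans with (K * exp (Re s * a))%R.
  - unfold Fa. eapply Rle_trans; [apply Cmod_triangle|]. rewrite !Cmod_mult, Cmod_opp, !Cmod_Cexp.
    unfold K. rewrite Rmult_plus_distr_r.
    assert (E1 : Re (s * RtoC a) = (Re s * a)%R) by (unfold Re; simpl; ring).
    assert (E2 : Re ((s + 1) * RtoC a) = (Re s * a + a)%R) by (unfold Re; simpl; ring).
    rewrite E1, E2. apply Rplus_le_compat_l. apply Rmult_le_compat_l; [apply Cmod_ge_0|].
    apply exp_le. lra.
  - assert (P := exp_pos (Re s * a)).
    replace eps with ((K + 1) * (eps / (K + 1)))%R by (field; lra). nra.
Qed.

(** This is the integral of lam^(s-1) (1 - lam)^(n+1) over (0, 1). The step uses (1 - lam)^(n+2) =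
    (1 - lam)^(n+1) - lam (1 - lam)^(n+1), that is, the previous case at s and at s + 1. *)
Lemma beta_CR (n : nat) : forall s : C, (0 < Re s)%R ->
  is_CR (fun u => Cexp (s * RtoC u) * RtoC (pospart u ^ S n))
    (RtoC (INR (fact (S n))) / rising s (S n)).
Proof.
  induction n as [|n IH]; intros s Hs.
  - apply (is_CR_eq _ (/ s - / (s + 1))); [apply beta_base, Hs|].
    assert (N := rising_nz s 1 (Re_pos_not_pole s Hs)). simpl in *.
    assert (N1 : s <> 0) by (intros E; apply N; rewrite E; ring).
    assert (N2 : s + 1 <> 0) by (intros E; apply N; rewrite E; ring).
    field. split; assumption.
  - assert (Hs1 : (0 < Re (s + 1))%R) by (unfold Re in *; simpl; lra).
    assert (D := is_CR_minus _ _ _ _ (beta_cont s (S n)) (beta_cont (s + 1) (S n)) (IH s Hs) (IH (s + 1) Hs1)).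
    apply (is_CR_eq _ (RtoC (INR (fact (S n))) / rising s (S n) - RtoC (INR (fact (S n))) / rising (s + 1) (S n))).
    + revert D. apply is_CR_ext. intros u.
      rewrite Cmult_plus_distr_r, Cmult_1_l, Cexp_add, Cexp_RtoC.
      change (pospart u ^ S (S n))%R with (pospart u * pospart u ^ S n)%R. rewrite RtoC_mult.
      destruct (Rle_dec u 0).
      * rewrite (pospart_neg u) by assumption. rewrite RtoC_minus. ring.
      * rewrite (pospart_pos u) by lra. change (0 ^ S n)%R with (0 * 0 ^ n)%R. rewrite Rmult_0_l. ring.
    +
      assert (N2 := rising_nz (s + 1) (S n) (Re_pos_not_pole _ Hs1)).
      assert (N3 := rising_nz s (S (S n)) (Re_pos_not_pole s Hs)).
      assert (E := rising_shift s (S n)).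
      change (rising s (S (S n))) with (rising s (S n) * (s + RtoC (INR (S (S n))))) in *.
      replace (INR (fact (S (S n)))) with (INR (S (S n)) * INR (fact (S n)))%R
        by (rewrite <- mult_INR; reflexivity).
      rewrite RtoC_mult. set (k := RtoC (INR (S (S n)))) in *. set (r1 := rising s (S n)) in *.
      set (r2 := rising (s + 1) (S n)) in *. set (f := RtoC (INR (fact (S n)))).
      assert (N4 : s + k <> 0) by (intros Z; apply N3; rewrite Z; ring).
      assert (S0 : s <> 0) by (intros Z; apply (Re_pos_not_pole s Hs O); rewrite Z; simpl; ring).
      assert (R1 : r1 = s * r2 / (s + k)) by (rewrite E; field; exact N4).
      rewrite R1. field. repeat split; assumption.
Qed.

Lemma bernoulli_minus (n : nat) (x : R) : (0 <= x <= 1)%R -> (1 - INR n * x <= (1 - x) ^ n)%R.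
Proof.
  intros Hx. induction n as [|n IH]; [simpl; lra|].
  rewrite S_INR. simpl. assert (P := pos_INR n). nra.
Qed.

Lemma exp_minus_pow (n : nat) (v : R) : exp (- (INR n * v)) = (exp (- v) ^ n)%R.
Proof.
  induction n as [|n IH]; [simpl; rewrite Rmult_0_l, Ropp_0; apply exp_0|].
  rewrite S_INR. simpl. rewrite <- IH, <- exp_plus. f_equal. ring.
Qed.

(** Put v = e^u. For v <= 1 the bound n v^2 e^(-n v) comes from e^(-v) (1 - v^2) <= 1 - v <= e^(-v)
    and Bernoulli's inequality; for v >= 1 the power vanishes and n v^2 >= 1. *)
Lemma pospart_exp (n : nat) (u : R) : (1 <= n)%nat ->
  (Rabs (pospart u ^ n - exp (- (INR n * exp u))) <= INR n * exp (2 * u - INR n * exp u))%R.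
Proof.
  intros Hn. assert (Hn1 : (1 <= INR n)%R) by (apply (le_INR 1); exact Hn).
  replace (2 * u - INR n * exp u)%R with (u + u + - (INR n * exp u))%R by ring. rewrite !exp_plus.
  set (v := exp u). assert (Pv : (0 < v)%R) by apply exp_pos.
  assert (Pe := exp_pos (- (INR n * v))).
  destruct (Rle_lt_dec u 0).
  - rewrite pospart_neg by assumption. fold v.
    assert (Hv : (v <= 1)%R) by (unfold v; rewrite <- exp_0; apply exp_le; assumption).
    rewrite exp_minus_pow in *.
    assert (U : ((1 - v) ^ n <= exp (- v) ^ n)%R).
    { apply pow_incr. split; [lra|]. generalize (exp_ineq1_le (- v)). lra. }
    assert (Lw : (exp (- v) ^ n * (1 - v * v) ^ n <= (1 - v) ^ n)%R).
    { rewrite <- Rpow_mult_distr. apply pow_incr. split.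
      - apply Rmult_le_pos; [left; apply exp_pos|nra].
      - assert (Q := exp_ineq1_le v). assert (Q2 : (exp (- v) * exp v = 1)%R)
          by (rewrite <- exp_plus, Rplus_opp_l; apply exp_0).
        assert (Q3 := exp_pos (- v)).
        assert (exp (- v) * (1 + v) <= 1)%R by (rewrite <- Q2; apply Rmult_le_compat_l; lra).
        replace (exp (- v) * (1 - v * v))%R with (exp (- v) * (1 + v) * (1 - v))%R by ring. nra. }
    assert (Bn := bernoulli_minus n (v * v) ltac:(nra)).
    rewrite Rabs_left1 by lra. nra.
  - rewrite pospart_pos by lra.
    assert (Hv : (1 <= v)%R) by (unfold v; rewrite <- exp_0; apply exp_le; lra).
    rewrite pow_i by lia. rewrite Rminus_0_l, Rabs_Ropp, Rabs_pos_eq by lra.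
    assert (V3 : (1 <= INR n * (v * v))%R) by nra.
    rewrite <- Rmult_assoc. nra.
Qed.

Definition gauss (s : C) (n : nat) : C := RtoC (INR (fact n)) * Rcpow (INR n) s / rising s n.

(** Compares N^s times the Beta integral with N^s times the Gamma integral scaled by N. The
    difference of the integrands is dominated with exponent Re s + 2, scale N and constant N, so the
    error is of order N^(Re s) N N^(-(Re s + 2)) = 1/N. *)
Lemma gauss_lim (s l : C) : (0 < Re s)%R -> is_Gam s l -> Clim (gauss s) l.
Proof.
  intros Hs Hl. set (K := gam_const (Re s + 2)).
  apply (Clim_squeeze _ _ (fun n => K / INR n)%R); [|apply is_lim_seq_inv_INR].
  intros n Hn. destruct n as [|n]; [lia|]. set (N := INR (S n)).
  assert (HN : (0 < N)%R) by (apply lt_0_INR; lia).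
  set (c := RtoC (ln N)).
  assert (G := Gam_scale s c l Hs ltac:(simpl; generalize PI_RGT_0; lra) Hl).
  assert (D := is_CR_minus _ _ _ _ (beta_cont s (S n)) (Gam_cont s c) (beta_CR n s Hs) G).
  assert (Dom : dominated (Re s + 2) N N (fun u => Cexp (s * RtoC u) * RtoC (pospart u ^ S n)
       - Cexp (s * RtoC u - Cexp (RtoC u + c)))).
  { intros u.
    assert (E : Cexp (RtoC u + c) = RtoC (N * exp u)).
    { unfold c. rewrite <- RtoC_plus, Cexp_RtoC, exp_plus, exp_ln by exact HN. f_equal. ring. }
    rewrite E.
    replace (Cexp (s * RtoC u - RtoC (N * exp u))) with (Cexp (s * RtoC u) * RtoC (exp (- (N * exp u)))).
    2:{ unfold Cminus. rewrite Cexp_add, <- RtoC_opp, Cexp_RtoC. reflexivity. }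
    replace (Cexp (s * RtoC u) * RtoC (pospart u ^ S n) - Cexp (s * RtoC u) * RtoC (exp (- (N * exp u))))
      with (Cexp (s * RtoC u) * RtoC (pospart u ^ S n - exp (- (N * exp u)))) by (rewrite RtoC_minus; ring).
    rewrite Cmod_mult, Cmod_R, Cmod_Cexp.
    replace (Re (s * RtoC u)) with (Re s * u)%R by (unfold Re; simpl; ring).
    apply Rle_trans with (exp (Re s * u) * (N * exp (2 * u - N * exp u)))%R.
    - apply Rmult_le_compat_l; [left; apply exp_pos|]. apply pospart_exp. lia.
    - right. replace ((Re s + 2) * u - N * exp u)%R with (Re s * u + (2 * u - N * exp u))%R by ring.
      rewrite exp_plus. ring. }
  assert (B : (Cmod (RtoC (INR (fact (S n))) / rising s (S n) - Cexp (- (s * c)) * l)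
     <= N * K * exp (- ((Re s + 2) * ln N)))%R).
  { eapply is_CR_bound; [|exact HN| |exact Dom|exact D]; [lra|].
    intros u. apply continuous_Cminus; [apply beta_cont|apply Gam_cont]. }
  assert (Ec : Cexp (s * c) = Rcpow N s) by reflexivity.
  assert (E : gauss s (S n) - l = Cexp (s * c) *
     (RtoC (INR (fact (S n))) / rising s (S n) - Cexp (- (s * c)) * l)).
  { unfold gauss. fold N. rewrite <- Ec.
    replace (Cexp (s * c) * (RtoC (INR (fact (S n))) / rising s (S n) - Cexp (- (s * c)) * l))
      with (RtoC (INR (fact (S n))) * Cexp (s * c) / rising s (S n) - (Cexp (- (s * c)) * Cexp (s * c)) * l)
      by (unfold Cdiv; ring).
    rewrite Cexp_opp_l. ring. }
  rewrite E, Cmod_mult, Cmod_Cexp.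
  replace (Re (s * c)) with (Re s * ln N)%R by (unfold Re; simpl; ring).
  apply Rle_trans with (exp (Re s * ln N) * (N * K * exp (- ((Re s + 2) * ln N))))%R.
  - apply Rmult_le_compat_l; [left; apply exp_pos|exact B].
  - right. replace (exp (Re s * ln N) * (N * K * exp (- ((Re s + 2) * ln N))))%R
      with (N * K * (exp (Re s * ln N) * exp (- ((Re s + 2) * ln N))))%R by ring.
    rewrite <- exp_plus. replace (Re s * ln N + - ((Re s + 2) * ln N))%R with (- (ln N + ln N))%R by ring.
    rewrite exp_Ropp, exp_plus, exp_ln by exact HN. field. lra.
Qed.

(** Finite form of Gamma(z) = Gamma(z + 1) / z; the extra factor tends to 1. *)
Lemma gauss_shift (z : C) (n : nat) : (1 <= n)%nat -> (forall k : nat, z <> - RtoC (INR k)) ->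
  gauss z n = gauss (z + 1) n * ((z + 1) / RtoC (INR n) + 1) / z.
Proof.
  intros Hn Hz. unfold gauss.
  assert (N1 := rising_nz z n Hz). assert (N3 := rising_nz z (S n) Hz).
  assert (E := rising_shift z n). change (rising z (S n)) with (rising z n * (z + RtoC (INR (S n)))) in *.
  assert (Z0 : z <> 0). { intros Z. apply (Hz O). rewrite Z. simpl. ring. }
  assert (N2 : rising (z + 1) n <> 0). { intros Z. apply N3. rewrite <- E, Z. ring. }
  assert (HN : (0 < INR n)%R) by (apply lt_0_INR; lia).
  assert (NC : RtoC (INR n) <> 0) by (apply RtoC_neq; lra).
  assert (R1 : Rcpow (INR n) (z + 1) = Rcpow (INR n) z * RtoC (INR n)).
  { unfold Rcpow. rewrite Cmult_plus_distr_r, Cexp_add, Cmult_1_l, Cexp_RtoC, exp_ln by exact HN. reflexivity. }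
  rewrite R1. rewrite S_INR, RtoC_plus in E.
  replace (rising (z + 1) n) with (rising z n * (z + (RtoC (INR n) + 1)) / z).
  2:{ rewrite <- E. field. exact Z0. }
  rewrite S_INR, RtoC_plus in N3.
  assert (N4 : z + (RtoC (INR n) + 1) <> 0). { intros Z. apply N3. rewrite Z. ring. }
  field. repeat split; assumption.
Qed.

Lemma Clim_inv_INR (c : C) : Clim (fun n => c / RtoC (INR n)) 0.
Proof.
  apply (Clim_squeeze _ _ (fun n => Cmod c / INR n)%R); [|apply is_lim_seq_inv_INR].
  intros n Hn. rewrite Cminus_zero. assert (HN : (0 < INR n)%R) by (apply lt_0_INR; lia).
  rewrite Cmod_div, Cmod_R, Rabs_pos_eq by (try apply RtoC_neq; lra). lra.
Qed.

(** Extends the convergence of the Gauss product to the left, one unit strip per induction step; the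
    application is at 1 - s, on the far side of the domain of the Gamma integral. *)
Lemma gauss_converges (k : nat) : forall z : C, (forall j : nat, z <> - RtoC (INR j)) ->
  (0 < Re z + INR k)%R -> exists l, Clim (gauss z) l.
Proof.
  induction k as [|k IH]; intros z Hz Hk.
  - simpl in Hk. rewrite Rplus_0_r in Hk. destruct (Gam_exists z Hk) as [l Hl].
    exists l. apply gauss_lim; assumption.
  - destruct (IH (z + 1)) as [l Hl].
    + intros j E. apply (Hz (S j)). rewrite S_INR, RtoC_plus.
      replace z with (z + 1 - 1) by ring. rewrite E. ring.
    + rewrite S_INR in Hk. unfold Re in *. simpl. lra.
    + exists (/ z * (l * (0 + 1))).
      apply (Clim_ext_loc (fun n => / z * (gauss (z + 1) n * ((z + 1) / RtoC (INR n) + 1))) _ _ 1%nat).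
      * intros n Hn. rewrite (gauss_shift z n Hn Hz). unfold Cdiv. ring.
      * apply Clim_mult_const, Clim_mult; [exact Hl|].
        apply Clim_plus; [apply Clim_inv_INR|apply Clim_const].
Qed.

(** The factors s + k and k - s pair to k^2 - s^2 for 1 <= k <= n; since [rising] with index n has n
    + 1 factors, s and n + 1 - s are left over. *)
Lemma rising_reflect (s : C) (n : nat) :
  rising s n * rising (1 - s) n
  = RtoC (INR (fact n)) * RtoC (INR (fact n)) * s * sinprod s n * (RtoC (INR n) + 1 - s).
Proof.
  induction n as [|n IH]; [simpl; ring|].
  change (rising s (S n)) with (rising s n * (s + RtoC (INR (S n)))).
  change (rising (1 - s) (S n)) with (rising (1 - s) n * (1 - s + RtoC (INR (S n)))).
  change (sinprod s (S n)) with (sinprod s n * (1 - s * s / (RtoC (INR (S n)) * RtoC (INR (S n))))).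
  replace (INR (fact (S n))) with (INR (S n) * INR (fact n))%R by (rewrite <- mult_INR; reflexivity).
  rewrite RtoC_mult.
  assert (N : RtoC (INR (S n)) <> 0) by (apply RtoC_neq, not_0_INR; lia).
  replace (rising s n * (s + INR (S n)) * (rising (1 - s) n * (1 - s + INR (S n))))
    with (rising s n * rising (1 - s) n * ((s + INR (S n)) * (1 - s + INR (S n)))) by ring.
  rewrite IH.
  replace (RtoC (INR n) + 1) with (RtoC (INR (S n))) by (rewrite S_INR, RtoC_plus; ring).
  field. exact N.
Qed.

(** The finite Gauss products at s and 1 - s multiply to n / (s P_n (n + 1 - s)) with P_n the sine
    product. By [sinprod_cosint], P_n is J_0(s) J_n(0) / (J_0(0) J_n(s)), so that multiplication by
    s J_0(s) / J_0(0) and by (n + 1 - s) / n leaves a ratio tending to 1. *)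
Lemma reflection (s g : C) : (0 < Re s)%R -> (forall n : nat, s <> RtoC (INR n)) -> is_Gam s g ->
  g * CGamma (1 - s) * Csin (RtoC PI * s) = RtoC PI.
Proof.
  intros Hs Hn Hg.
  assert (S0 : s <> 0) by (intros E; rewrite E in Hs; simpl in Hs; lra).
  assert (Hp : forall j : nat, 1 - s <> - RtoC (INR j)).
  { intros j E. apply (Hn (S j)). rewrite S_INR, RtoC_plus.
    replace s with (1 - (1 - s)) by ring. rewrite E. ring. }
  destruct (nfloor_ex (Rabs (Re (1 - s))) (Rabs_pos _)) as [k Hk].
  destruct (gauss_converges (S k) (1 - s) Hp) as [g' Hg'].
  { rewrite S_INR. generalize (Rcomplements.Rabs_maj2 (Re (1 - s))). lra. }
  assert (EG : CGamma (1 - s) = g') by (apply Clim_CLim_seq; exact Hg').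
  rewrite EG.
  assert (L1 := Clim_mult _ _ _ _ (gauss_lim s g Hs Hg) Hg').
  assert (L2 : Clim (fun n => (1 - s) / RtoC (INR n) + 1) (0 + 1)).
  { apply Clim_plus; [apply Clim_inv_INR|apply Clim_const]. }
  assert (L3 := Clim_mult _ _ _ _ L1 L2).
  assert (PC : RtoC PI <> 0) by (apply RtoC_neq; generalize PI_RGT_0; lra).
  assert (P2 : cosint 0 0 <> 0). { rewrite cosint_00. apply RtoC_neq. generalize PI_RGT_0; lra. }
  assert (L4 := Clim_mult_const (s * (cosint 0 s / cosint 0 0)) _ _ L3).
  assert (U : s * (cosint 0 s / cosint 0 0) * (g * g' * (0 + 1)) = 1).
  { apply (Clim_unique _ _ _ L4).
    apply (Clim_ext_loc (fun n => cosint n s / cosint n 0) _ _ 1%nat); [|apply cosint_ratio].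
    intros n H1. destruct (cosint_real_pos n) as [J [HJ EJ]].
    assert (JC : cosint n 0 <> 0) by (rewrite EJ; apply RtoC_neq; lra).
    assert (N1 := rising_nz s n (Re_pos_not_pole s Hs)). assert (N2 := rising_nz (1 - s) n Hp).
    assert (HN : (0 < INR n)%R) by (apply lt_0_INR; lia).
    assert (NC : RtoC (INR n) <> 0) by (apply RtoC_neq; lra).
    assert (F0 : RtoC (INR (fact n)) <> 0) by (apply RtoC_neq, INR_fact_neq_0).
    assert (R1 : Rcpow (INR n) s * Rcpow (INR n) (1 - s) = RtoC (INR n)).
    { unfold Rcpow. rewrite <- Cexp_add. replace (s * RtoC (ln (INR n)) + (1 - s) * RtoC (ln (INR n)))
        with (RtoC (ln (INR n))) by ring. rewrite Cexp_RtoC, exp_ln by exact HN. reflexivity. }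
    assert (R2 := rising_reflect s n). assert (R3 := sinprod_cosint n s).
    assert (R12 : rising s n * rising (1 - s) n <> 0) by (apply Cmult_neq_0; assumption).
    assert (Q : RtoC (INR n) + 1 - s <> 0). { intros Z. apply R12. rewrite R2, Z. ring. }
    assert (Q' : sinprod s n <> 0). { intros Z. apply R12. rewrite R2, Z. ring. }
    unfold gauss.
    replace (INR (fact n) * Rcpow (INR n) s / rising s n *
       (INR (fact n) * Rcpow (INR n) (1 - s) / rising (1 - s) n))
      with (RtoC (INR (fact n)) * RtoC (INR (fact n)) * (Rcpow (INR n) s * Rcpow (INR n) (1 - s))
         / (rising s n * rising (1 - s) n)) by (field; split; assumption).
    rewrite R1, R2.
    replace (cosint 0 s / cosint 0 0) with (sinprod s n * cosint n s / cosint n 0).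
    2:{ replace (cosint 0 s / cosint 0 0) with (cosint 0 s * cosint n 0 / (cosint 0 0 * cosint n 0)) by (field; split; assumption).
        rewrite <- R3. field. split; assumption. }
    field. repeat split; assumption. }
  rewrite cosint_0, cosint_00 in U by exact S0.
  rewrite RtoC_div in U by lra.
  transitivity (RtoC PI * (s * (Csin (RtoC PI * s) / (2 * s) / (RtoC PI / 2)) * (g * g' * (0 + 1)))).
  - field. split; assumption.
  - rewrite U. ring.
Qed.

(** * Lattice sums over a cone *)

Fixpoint csum (n : nat) (f : nat -> C) : C :=
  match n with O => 0 | S k => csum k f + f k end.

Lemma csum_ext (n : nat) (f g : nat -> C) : (forall i, (i < n)%nat -> f i = g i) -> csum n f = csum n g.
Proof.
  induction n as [|n IH]; intros H; [reflexivity|]. simpl. rewrite IH, H by (intros; try apply H; lia). reflexivity.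
Qed.

Lemma csum_mult (c : C) (n : nat) (f : nat -> C) : csum n (fun i => c * f i) = c * csum n f.
Proof. induction n as [|n IH]; simpl; [ring|rewrite IH; ring]. Qed.

Lemma csum_plus (n : nat) (f g : nat -> C) : csum n (fun i => f i + g i) = csum n f + csum n g.
Proof. induction n as [|n IH]; simpl; [ring|rewrite IH; ring]. Qed.

Lemma Cmod_csum (n : nat) (f : nat -> C) (M : R) :
  (forall i, (i < n)%nat -> (Cmod (f i) <= M)%R) -> (Cmod (csum n f) <= INR n * M)%R.
Proof.
  induction n as [|n IH]; intros H.
  - simpl. rewrite Cmod_0. lra.
  - rewrite S_INR. simpl. eapply Rle_trans; [apply Cmod_triangle|].
    assert (A := H n ltac:(lia)). assert (B := IH ltac:(intros; apply H; lia)). lra.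
Qed.

Lemma csum_cont (n : nat) (f : nat -> R -> C) : (forall i, Ccont (f i)) -> Ccont (fun u => csum n (fun i => f i u)).
Proof.
  intros H. induction n as [|n IH]; intros u; simpl; [apply continuous_const|].
  apply continuous_Cplus; [apply IH|apply H].
Qed.

Lemma is_CR_csum (n : nat) (f : nat -> R -> C) (l : nat -> C) : (forall i, Ccont (f i)) ->
  (forall i, (i < n)%nat -> is_CR (f i) (l i)) -> is_CR (fun u => csum n (fun i => f i u)) (csum n l).
Proof.
  intros Hc. induction n as [|n IH]; intros H.
  - intros eps He. exists 0%R. intros a b _ _. simpl.
    rewrite (CInt_unique _ _ _ (RtoC 0)).
    + rewrite Cminus_zero, Cmod_0. exact He.
    + apply (is_CInt_eq _ _ _ (RtoC 1 - RtoC 1)); [|ring].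
      apply (is_CInt_derive (fun _ => RtoC 1)); intros; [apply is_Cderive_const|apply continuous_const].
  - simpl. apply is_CR_plus; [apply csum_cont, Hc|apply Hc|apply IH; intros; apply H; lia|apply H; lia].
Qed.

(* Sum over [|n| <= m] with half weights at the two ends. *)
Definition hsum (m : nat) (g : Z -> C) : C :=
  csum (2 * m) (fun j => (g (Z.of_nat j - Z.of_nat m)%Z + g (Z.of_nat j - Z.of_nat m + 1)%Z) / 2).

Lemma hsum_ext (m : nat) (f g : Z -> C) :
  (forall n, (- Z.of_nat m <= n <= Z.of_nat m)%Z -> f n = g n) -> hsum m f = hsum m g.
Proof. intros H. apply csum_ext. intros i Hi. rewrite !H by lia. reflexivity. Qed.

Lemma hsum_mult (c : C) (m : nat) (g : Z -> C) : hsum m (fun n => c * g n) = c * hsum m g.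
Proof.
  unfold hsum. rewrite <- csum_mult. apply csum_ext. intros. field.
Qed.

Lemma Cmod_hsum (m : nat) (g : Z -> C) (M : R) :
  (forall n, (- Z.of_nat m <= n <= Z.of_nat m)%Z -> (Cmod (g n) <= M)%R) ->
  (Cmod (hsum m g) <= 2 * INR m * M)%R.
Proof.
  intros H. replace (2 * INR m)%R with (INR (2 * m)) by (rewrite mult_INR; simpl; ring).
  apply Cmod_csum. intros i Hi. unfold Cdiv.
  assert (A := H (Z.of_nat i - Z.of_nat m)%Z ltac:(lia)).
  assert (B := H (Z.of_nat i - Z.of_nat m + 1)%Z ltac:(lia)).
  rewrite Cmod_mult, Cmod_inv, Cmod_R, Rabs_pos_eq by (try apply RtoC_neq; lra).
  assert (T := Cmod_triangle (g (Z.of_nat i - Z.of_nat m)%Z) (g (Z.of_nat i - Z.of_nat m + 1)%Z)). lra.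
Qed.

Lemma hsum_cont (m : nat) (f : Z -> R -> C) : (forall n, Ccont (f n)) -> Ccont (fun u => hsum m (fun n => f n u)).
Proof.
  intros H. apply csum_cont. intros i u. unfold Cdiv.
  apply continuous_Cmult; [apply continuous_Cplus; apply H|apply continuous_const].
Qed.

Lemma is_CR_hsum (m : nat) (f : Z -> R -> C) (l : Z -> C) : (forall n, Ccont (f n)) ->
  (forall n, (- Z.of_nat m <= n <= Z.of_nat m)%Z -> is_CR (f n) (l n)) ->
  is_CR (fun u => hsum m (fun n => f n u)) (hsum m l).
Proof.
  intros Hc H. unfold hsum.
  apply (is_CR_csum (2 * m) (fun j u => (f (Z.of_nat j - Z.of_nat m)%Z u + f (Z.of_nat j - Z.of_nat m + 1)%Z u) / 2)).
  - intros i u. unfold Cdiv. apply continuous_Cmult; [apply continuous_Cplus; apply Hc|apply continuous_const].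
  - intros i Hi.
    apply (is_CR_ext (fun u => / 2 * (f (Z.of_nat i - Z.of_nat m)%Z u + f (Z.of_nat i - Z.of_nat m + 1)%Z u))).
    { intros u. unfold Cdiv. apply Cmult_comm. }
    unfold Cdiv. rewrite Cmult_comm. apply is_CR_mult.
    + intros u. apply continuous_Cplus; apply Hc.
    + apply is_CR_plus; try apply Hc; apply H; lia.
Qed.

(** A logarithm for the right half plane only, where [atan] of the quotient is the argument; the
    cones below are first rotated into that half plane. *)
Definition Clog (z : C) : C := (ln (Cmod z), atan (Im z / Re z)).

Lemma Cexp_Clog (z : C) : (0 < Re z)%R -> Cexp (Clog z) = z.
Proof.
  intros H. assert (Hm : (0 < Cmod z)%R).
  { apply Cmod_gt_0. intros E. rewrite E in H. simpl in H. lra. }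
  assert (Hs : (sqrt (1 + (Im z / Re z)²) = Cmod z / Re z)%R).
  { rewrite <- (sqrt_Rsqr (Cmod z / Re z)) by (left; apply Rdiv_lt_0_compat; assumption).
    f_equal. unfold Rsqr. replace (Cmod z / Re z * (Cmod z / Re z))%R with (Cmod z ^ 2 / (Re z * Re z))%R by (field; lra).
    rewrite Cmod2_alt. field. lra. }
  unfold Cexp, Clog. cbn [Re Im fst snd]. rewrite exp_ln by exact Hm.
  rewrite cos_atan, sin_atan, Hs.
  apply C_eq; unfold Re, Im in *; simpl; field; lra.
Qed.

Lemma Clog_bound (z : C) : (- (PI / 2) < Im (Clog z) < PI / 2)%R.
Proof. generalize (atan_bound (Im z / Re z)). simpl. lra. Qed.

(* [z ^ (- s)], principal branch on the right half plane *)
Definition ppow (z s : C) : C := Cexp (- (s * Clog z)).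

(** [Gam_scale] at c = log om. *)
Lemma ppow_int (s g om : C) : (0 < Re s)%R -> is_Gam s g -> (0 < Re om)%R ->
  is_CR (fun u => Cexp (s * RtoC u) * Cexp (- (om * RtoC (exp u)))) (g * ppow om s).
Proof.
  intros Hs Hg Ho. assert (G := Gam_scale s (Clog om) g Hs (Clog_bound om) Hg).
  apply (is_CR_eq _ (Cexp (- (s * Clog om)) * g)); [|unfold ppow; ring].
  revert G. apply is_CR_ext. intros u. unfold Cminus. rewrite Cexp_add. do 2 f_equal.
  rewrite Cexp_add, Cexp_Clog, Cexp_RtoC by exact Ho. ring.
Qed.

(** * The kernel and its expansion over the cone *)

Definition kden (al be z : C) : C := (1 - Cexp (- ((al - be) * z))) * (1 - Cexp (- ((al + be) * z))).

(** e^(-al z) is a square root of the product of the other two exponentials, so 4 [knum] is a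
    perfect square. *)
Definition knum (al be z : C) : C :=
  (Cexp (- ((al - be) * z)) + Cexp (- ((al + be) * z)) + 2 * Cexp (- (al * z))) / 4.

Definition kern (al be z : C) : C := knum al be z / kden al be z.

(** Because e^(be z) and e^(-be z) are inverse to each other, the quadratic denominator in e^(-al z)
    factors and the numerator expands into [knum]. *)
Lemma kern_cosh (al be z : C) :
  Cexp (- (al * z)) * ((Ccosh (be * z / 2) * Ccosh (be * z / 2))
    / (1 - 2 * Cexp (- (al * z)) * Ccosh (be * z) + Cexp (- (2 * (al * z))))) = kern al be z.
Proof.
  unfold kern, Ccosh.
  replace (1 - 2 * Cexp (- (al * z)) * ((Cexp (be * z) + Cexp (- (be * z))) / 2) + Cexp (- (2 * (al * z))))
    with (kden al be z).
  - match goal with |- ?e * (?n / ?d) = _ =>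
      replace (e * (n / d)) with ((e * n) / d) by (unfold Cdiv; ring) end.
    apply (f_equal (fun k => k / kden al be z)). unfold knum.
    replace (- ((al - be) * z)) with (- (al * z) + (be * z / 2 + be * z / 2)) by field.
    replace (- ((al + be) * z)) with (- (al * z) + (- (be * z / 2) + - (be * z / 2))) by field.
    rewrite !Cexp_add. 
    assert (E := Cexp_opp_l (be * z / 2)).
    set (x := Cexp (be * z / 2)) in *. set (y := Cexp (- (be * z / 2))) in *.
    set (e := Cexp (- (al * z))).
    transitivity (e * (x * x + y * y + 2 * (y * x)) / 4); [field|rewrite E; field].
  - unfold kden.
    replace (- ((al - be) * z)) with (- (al * z) + be * z) by ring.
    replace (- ((al + be) * z)) with (- (al * z) + - (be * z)) by ring.
    replace (- (2 * (al * z))) with (- (al * z) + - (al * z)) by ring.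
    rewrite !Cexp_add. assert (E := Cexp_opp_l (be * z)).
    set (x := Cexp (be * z)) in *. set (y := Cexp (- (be * z))) in *.
    set (e := Cexp (- (al * z))).
    transitivity (1 - e * (x + y) + e * e * (y * x)); [ring|rewrite E; field].
Qed.

Lemma Cmod_knum (al be z : C) (x : R) :
  (Cmod (Cexp (- ((al - be) * z))) <= x)%R -> (Cmod (Cexp (- ((al + be) * z))) <= x)%R ->
  (Cmod (Cexp (- (al * z))) <= x)%R -> (Cmod (knum al be z) <= x)%R.
Proof.
  intros H1 H2 H3. unfold knum. rewrite Cmod_div, Cmod_R, Rabs_pos_eq by (try apply RtoC_neq; lra).
  assert (T1 := Cmod_triangle (Cexp (- ((al - be) * z)) + Cexp (- ((al + be) * z))) (2 * Cexp (- (al * z)))).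
  assert (T2 := Cmod_triangle (Cexp (- ((al - be) * z))) (Cexp (- ((al + be) * z)))).
  rewrite (Cmod_mult 2), Cmod_R, (Rabs_pos_eq 2) in T1 by lra. lra.
Qed.

(* Complete homogeneous polynomial of degree [m - 1] in [a] and [b] *)
Fixpoint hom (a b : C) (m : nat) : C :=
  match m with O => 0 | S k => a * hom a b k + b ^ k end.

Lemma hom_csum (p q : C) (k : nat) : csum k (fun j => p ^ (k - 1 - j) * q ^ j) = hom p q k.
Proof.
  induction k as [|k IH]; [reflexivity|]. simpl csum. simpl hom.
  rewrite <- IH, <- csum_mult. f_equal.
  - apply csum_ext. intros i Hi. replace (k - 0 - i)%nat with (S (k - 1 - i)) by lia. simpl. ring.
  - replace (k - 0 - k)%nat with O by lia. simpl. ring.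
Qed.

(** The monomials of odd degree 2m - 1 are grouped in neighbouring pairs, which extracts one factor
    p + q. *)
Lemma hom_double (p q : C) (m : nat) : hom p q (2 * m) = (p + q) * hom (p * p) (q * q) m.
Proof.
  induction m as [|m IH]; [simpl; ring|].
  replace (2 * S m)%nat with (S (S (2 * m))) by lia.
  change (hom p q (S (S (2 * m)))) with (p * (p * hom p q (2 * m) + q ^ (2 * m)) + q ^ S (2 * m)).
  change (hom (p * p) (q * q) (S m)) with (p * p * hom (p * p) (q * q) m + (q * q) ^ m).
  rewrite IH. change (q ^ S (2 * m)) with (q * q ^ (2 * m)).
  assert (E : q ^ (2 * m) = (q * q) ^ m).
  { rewrite Cpow_mult_r. f_equal. simpl. ring. }
  rewrite E. ring.
Qed.

Definition cone_exp (al be z : C) (m : nat) : C :=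
  hsum m (fun n => Cexp (- ((RtoC (INR m) * al + RtoC (IZR n) * be) * z))).

(** In terms of square roots p, q of the two exponentials, shell m consists of the monomials of
    degree 2m. Averaging neighbours, which is the effect of the half weights, gives (p + q)/2 times
    all monomials of degree 2m - 1; [hom_double] gives a second factor p + q and completes the
    square in [knum]. *)
Lemma cone_exp_hom (al be z : C) (m : nat) :
  cone_exp al be z m = 2 * knum al be z * hom (Cexp (- ((al - be) * z))) (Cexp (- ((al + be) * z))) m.
Proof.
  set (p := Cexp (- ((al - be) * z / 2))). set (q := Cexp (- ((al + be) * z / 2))).
  assert (Ep : Cexp (- ((al - be) * z)) = p * p).
  { unfold p. rewrite <- Cexp_add. f_equal. field. }
  assert (Eq : Cexp (- ((al + be) * z)) = q * q).
  { unfold q. rewrite <- Cexp_add. f_equal. field. }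
  assert (Epq : Cexp (- (al * z)) = p * q).
  { unfold p, q. rewrite <- Cexp_add. f_equal. field. }
  assert (Ek : 2 * knum al be z = (p + q) * (p + q) / 2).
  { unfold knum. rewrite Ep, Eq, Epq. field. }
  rewrite Ek, Ep, Eq.
  replace ((p + q) * (p + q) / 2 * hom (p * p) (q * q) m) with ((p + q) / 2 * ((p + q) * hom (p * p) (q * q) m)) by field.
  rewrite <- hom_double, <- hom_csum, <- csum_mult.
  unfold cone_exp, hsum. apply csum_ext. intros j Hj.
  assert (T : forall n : nat, (n <= 2 * m)%nat ->
    Cexp (- ((RtoC (INR m) * al + RtoC (IZR (Z.of_nat n - Z.of_nat m)) * be) * z)) = p ^ (2 * m - n) * q ^ n).
  { intros n Hn. unfold p, q. rewrite <- !Cexp_INR_mult, <- Cexp_add. f_equal.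
    rewrite minus_INR, mult_INR, minus_IZR, <- !INR_IZR_INZ, !RtoC_minus, RtoC_mult by exact Hn.
    simpl (INR 2). replace (1 + 1)%R with 2%R by ring. field. }
  replace (Z.of_nat j - Z.of_nat m + 1)%Z with (Z.of_nat (S j) - Z.of_nat m)%Z by lia.
  rewrite !T by lia.
  replace (2 * m - j)%nat with (S (2 * m - 1 - j)) by lia.
  replace (2 * m - S j)%nat with (2 * m - 1 - j)%nat by lia. simpl Cpow. field.
Qed.

(** The generating series of [hom] is 1 / ((1 - a)(1 - b)); this is its exact remainder after K
    terms. *)
Lemma geom_remainder (a b : C) (K : nat) : a <> 1 -> b <> 1 ->
  / ((1 - a) * (1 - b)) = csum K (fun i => hom a b (S i)) + (b ^ K / ((1 - a) * (1 - b)) + a * hom a b K / (1 - a)).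
Proof.
  intros Ha Hb.
  assert (A : 1 - a <> 0) by (intros E; apply Ha; replace a with (1 - (1 - a)) by ring; rewrite E; ring).
  assert (B : 1 - b <> 0) by (intros E; apply Hb; replace b with (1 - (1 - b)) by ring; rewrite E; ring).
  induction K as [|K IH].
  - simpl. field. split; assumption.
  - rewrite IH. change (csum (S K) (fun i => hom a b (S i))) with (csum K (fun i => hom a b (S i)) + hom a b (S K)).
    change (hom a b (S K)) with (a * hom a b K + b ^ K). simpl Cpow. field. split; assumption.
Qed.

(** The additional factor a raises the degree to m, so that the estimate by x^m involves no division
    by x. *)
Lemma Cmod_hom (a b : C) (x : R) (m : nat) : (Cmod a <= x)%R -> (Cmod b <= x)%R ->
  (Cmod (a * hom a b m) <= INR m * x ^ m)%R.
Proof.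
  intros Ha Hb.
  induction m as [|m IH].
  - simpl. rewrite Cmult_0_r, Cmod_0. lra.
  - change (hom a b (S m)) with (a * hom a b m + b ^ m). rewrite Cmod_mult, S_INR.
    assert (T := Cmod_triangle (a * hom a b m) (b ^ m)). rewrite Cmod_pow in T.
    assert (P : (Cmod b ^ m <= x ^ m)%R) by (apply pow_incr; split; [apply Cmod_ge_0|exact Hb]).
    simpl.
    assert (S : (Cmod (a * hom a b m + b ^ m) <= (INR m + 1) * x ^ m)%R) by lra.
    assert (P0 := Cmod_ge_0 (a * hom a b m + b ^ m)). assert (P1 := Cmod_ge_0 a).
    replace ((INR m + 1) * (x * x ^ m))%R with (x * ((INR m + 1) * x ^ m))%R by ring.
    apply Rmult_le_compat; assumption.
Qed.

Section Cone.
Variables al be : C.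
Hypothesis Hcone : (Rabs (Re be) < Re al)%R.
Let del := (Re al - Rabs (Re be))%R.

Lemma cone_Re (m : nat) (n : Z) : (- Z.of_nat m <= n <= Z.of_nat m)%Z ->
  (INR m * del <= Re (RtoC (INR m) * al + RtoC (IZR n) * be))%R.
Proof.
  intros Hn. replace (Re (INR m * al + IZR n * be)) with (INR m * Re al + IZR n * Re be)%R
    by (unfold Re; simpl; ring).
  assert (A : (Rabs (IZR n) <= INR m)%R).
  { rewrite INR_IZR_INZ, <- abs_IZR. apply IZR_le. lia. }
  assert (B : (- (Rabs (IZR n) * Rabs (Re be)) <= IZR n * Re be)%R).
  { rewrite <- Rabs_mult. generalize (Rcomplements.Rabs_maj2 (IZR n * Re be)). lra. }
  assert (C0 := Rabs_pos (Re be)). unfold del. nra.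
Qed.

Lemma kern_geom_bounds (lam : R) : (0 < lam)%R ->
  (Cmod (Cexp (- ((al - be) * RtoC lam))) <= exp (- (del * lam)) /\
   Cmod (Cexp (- ((al + be) * RtoC lam))) <= exp (- (del * lam)) /\
   Cmod (Cexp (- (al * RtoC lam))) <= exp (- (del * lam)))%R.
Proof.
  intros Hl. rewrite !Cmod_Cexp. assert (A := Rle_abs (Re be)).
  assert (A' := Rcomplements.Rabs_maj2 (Re be)).
  unfold del, Re in *; simpl. repeat split; apply exp_le; nra.
Qed.

(** Half of the exponential decay is spent on the polynomial factors: 1 + K y <= 2 e^(K y / 2) and
    (1 + y)^2 <= 16 e^(y/2), with y <= (1 + y)(1 - e^(-y)). The constant 64 is 2 . 2 . 16. *)
Lemma remainder_real (y : R) (K : nat) : (0 < y)%R ->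
  (2 * exp (- y) * (exp (- y) ^ K / ((1 - exp (- y)) * (1 - exp (- y))) + INR K * exp (- y) ^ K / (1 - exp (- y)))
   <= 64 * exp (- (INR (S K) * y / 2)) / (y * y))%R.
Proof.
  intros Hy. set (x := exp (- y)). assert (Px : (0 < x)%R) by apply exp_pos.
  assert (X1 : (1 - x <= y)%R) by (unfold x; generalize (exp_ineq1_le (- y)); lra).
  assert (X2 : (y <= (1 + y) * (1 - x))%R).
  { assert (Q := exp_ineq1_le y). assert (E : (x * exp y = 1)%R)
      by (unfold x; rewrite <- exp_plus, Rplus_opp_l; apply exp_0).
    assert (x * (1 + y) <= 1)%R by (rewrite <- E; apply Rmult_le_compat_l; lra). nra. }
  assert (X3 : (0 < 1 - x)%R) by nra.
  assert (PK := pos_INR K). assert (PxK := pow_lt x K Px).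
  assert (E1 : exp (- (INR (S K) * y / 2)) = (x * x ^ K * exp (INR K * y / 2) * exp (y / 2))%R).
  { unfold x. rewrite <- exp_minus_pow, <- !exp_plus, S_INR. f_equal. field. }
  assert (E2 : (1 + INR K * y <= 2 * exp (INR K * y / 2))%R).
  { assert (Q := exp_ineq1_le (INR K * y / 2)). nra. }
  assert (E3 : ((1 + y) * (1 + y) <= 16 * exp (y / 2))%R).
  { assert (Q := exp_ineq1_le (y / 4)). replace (y / 2)%R with (y / 4 + y / 4)%R by field.
    rewrite exp_plus. assert (1 + y <= 4 * exp (y / 4))%R by lra. nra. }
  rewrite E1.
  replace (2 * x * (x ^ K / ((1 - x) * (1 - x)) + INR K * x ^ K / (1 - x)))%R
    with (2 * (x * x ^ K) * ((1 + INR K * (1 - x)) * / ((1 - x) * (1 - x))))%R by (field; lra).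
  replace (64 * (x * x ^ K * exp (INR K * y / 2) * exp (y / 2)) / (y * y))%R
    with (2 * (x * x ^ K) * ((2 * exp (INR K * y / 2)) * ((16 * exp (y / 2)) / (y * y))))%R by (field; lra).
  apply Rmult_le_compat_l; [nra|].
  apply Rmult_le_compat.
  - nra.
  - left. apply Rinv_0_lt_compat. nra.
  - apply Rle_trans with (1 + INR K * y)%R; [nra|exact E2].
  - apply Rle_trans with ((1 + y) * (1 + y) / (y * y))%R.
    + apply Rmult_le_reg_r with ((1 - x) * (1 - x))%R; [nra|]. rewrite Rinv_l by nra.
      apply Rmult_le_reg_r with (y * y)%R; [nra|].
      replace ((1 + y) * (1 + y) / (y * y) * ((1 - x) * (1 - x)) * (y * y))%R
        with (((1 + y) * (1 - x)) * ((1 + y) * (1 - x)))%R by (field; lra).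
      nra.
    + apply Rmult_le_compat_r; [left; apply Rinv_0_lt_compat; nra|exact E3].
Qed.

(** At K = 0 the sum is empty and the bound is the growth of the kernel on the positive axis, of
    order lam^(-2) at 0; this is where the condition Re s > 2 comes from. *)
Lemma kern_remainder (lam : R) (K : nat) : (0 < lam)%R ->
  kden al be (RtoC lam) <> 0 /\
  (Cmod (2 * kern al be (RtoC lam) - csum K (fun i => cone_exp al be (RtoC lam) (S i)))
   <= 64 * exp (- (INR (S K) * (del * lam) / 2)) / ((del * lam) * (del * lam)))%R.
Proof.
  intros Hl. destruct (kern_geom_bounds lam Hl) as [Ba [Bb Be]].
  assert (Hd : (0 < del)%R) by (unfold del; lra).
  assert (Hy : (0 < del * lam)%R) by (apply Rmult_lt_0_compat; assumption).
  assert (Hx : (exp (- (del * lam)) < 1)%R) by (rewrite <- exp_0; apply exp_increasing; lra).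
  assert (Rb := remainder_real (del * lam) K Hy).
  assert (Ec : csum K (fun i => cone_exp al be lam (S i)) = 2 * knum al be lam *
    csum K (fun i => hom (Cexp (- ((al - be) * lam))) (Cexp (- ((al + be) * lam))) (S i))).
  { rewrite <- csum_mult. apply csum_ext. intros i _. apply cone_exp_hom. }
  rewrite Ec. unfold kern, kden.
  assert (Hn := Cmod_knum _ _ _ _ Ba Bb Be).
  set (a := Cexp (- ((al - be) * lam))) in *. set (b := Cexp (- ((al + be) * lam))) in *.
  set (x := exp (- (del * lam))) in *. set (k := knum al be lam) in *.
  assert (Aa : (1 - x <= Cmod (1 - a))%R).
  { assert (T := Cmod_triangle_minus 1 a). rewrite Cmod_1 in T. lra. }
  assert (Ab : (1 - x <= Cmod (1 - b))%R).
  { assert (T := Cmod_triangle_minus 1 b). rewrite Cmod_1 in T. lra. }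
  assert (Na : 1 - a <> 0) by (apply Cmod_gt_0; lra).
  assert (Nb : 1 - b <> 0) by (apply Cmod_gt_0; lra).
  assert (Na1 : a <> 1) by (intros E; apply Na; rewrite E; ring).
  assert (Nb1 : b <> 1) by (intros E; apply Nb; rewrite E; ring).
  split; [apply Cmult_neq_0; assumption|].
  replace (2 * (k / ((1 - a) * (1 - b))) - 2 * k * csum K (fun i => hom a b (S i)))
    with (2 * k * (b ^ K / ((1 - a) * (1 - b)) + a * hom a b K / (1 - a))).
  2:{ change (k / ((1 - a) * (1 - b))) with (k * / ((1 - a) * (1 - b))). rewrite (geom_remainder a b K Na1 Nb1). ring. }
  eapply Rle_trans; [|exact Rb].
  rewrite !Cmod_mult, Cmod_R, (Rabs_pos_eq 2) by lra.
  apply Rmult_le_compat; [generalize (Cmod_ge_0 k); lra|apply Cmod_ge_0|lra|].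
  eapply Rle_trans; [apply Cmod_triangle|].
  apply Rplus_le_compat.
  - rewrite Cmod_div, Cmod_mult, Cmod_pow by (apply Cmult_neq_0; assumption).
    apply Rmult_le_compat.
    + apply pow_le, Cmod_ge_0.
    + left. apply Rinv_0_lt_compat. nra.
    + apply pow_incr. split; [apply Cmod_ge_0|exact Bb].
    + apply Rinv_le_contravar; [nra|]. apply Rmult_le_compat; lra.
  - rewrite Cmod_div by exact Na. apply Rmult_le_compat.
    + apply Cmod_ge_0.
    + left. apply Rinv_0_lt_compat. lra.
    + apply Cmod_hom; assumption.
    + apply Rinv_le_contravar; lra.
Qed.

Definition cone_sum (s : C) (K : nat) : C :=
  csum K (fun i => hsum (S i) (fun n => ppow (RtoC (INR (S i)) * al + RtoC (IZR n) * be) s)).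

Lemma kern_cont (u : R) : Ccontinuous (fun u => kern al be (RtoC (exp u))) u.
Proof.
  assert (Ce : forall c : C, Ccontinuous (fun u => Cexp (- (c * RtoC (exp u)))) u).
  { intros c. apply continuous_Cexp, continuous_Copp, continuous_Cmult; [apply continuous_const|].
    apply continuous_RtoC, continuous_exp. }
  apply continuous_Cdiv.
  - apply (kern_remainder (exp u) 0), exp_pos.
  - unfold knum, Cdiv. apply continuous_Cmult; [|apply continuous_const].
    apply continuous_Cplus; [apply continuous_Cplus; apply Ce|].
    apply continuous_Cmult; [apply continuous_const|apply Ce].
  - apply continuous_Cmult; (apply continuous_Cminus; [apply continuous_const|apply Ce]).
Qed.

Lemma exp_lin_cont (s : C) : Ccont (fun u => Cexp (s * RtoC u)).
Proof.
  intros u. apply continuous_Cexp, continuous_Cmult; [apply continuous_const|].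
  apply continuous_RtoC, continuous_id.
Qed.

Lemma Mellin_cont (s : C) : Ccont (fun u => Cexp (s * RtoC u) * kern al be (RtoC (exp u))).
Proof. intros u. apply continuous_Cmult; [apply exp_lin_cont|apply kern_cont]. Qed.

(** The division by lam^2 lowers the Mellin exponent from Re s to Re s - 2, while the scale grows
    with K. *)
Lemma Mellin_rem_dominated (s : C) (K : nat) :
  dominated (Re s - 2) (INR (S K) * del / 2) (64 / (del * del))
    (fun u => Cexp (s * RtoC u) *
      (2 * kern al be (RtoC (exp u)) - csum K (fun i => cone_exp al be (RtoC (exp u)) (S i)))).
Proof.
  assert (Hd : (0 < del)%R) by (unfold del; lra).
  intros u. destruct (kern_remainder (exp u) K (exp_pos u)) as [_ B].
  rewrite Cmod_mult, Cmod_Cexp. replace (Re (s * RtoC u)) with (Re s * u)%R by (unfold Re; simpl; ring).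
  eapply Rle_trans; [apply Rmult_le_compat_l; [left; apply exp_pos|exact B]|]. right.
  replace ((Re s - 2) * u - INR (S K) * del / 2 * exp u)%R
    with (Re s * u + (- u + - u) + - (INR (S K) * (del * exp u) / 2))%R by field.
  rewrite !exp_plus, (exp_Ropp u). assert (P := exp_pos u). field. lra.
Qed.

Lemma Mellin_exists (s : C) : (2 < Re s)%R ->
  exists X, is_CR (fun u => Cexp (s * RtoC u) * kern al be (RtoC (exp u))) X.
Proof.
  intros Hs. assert (Hd : (0 < del)%R) by (unfold del; lra).
  assert (D := Mellin_rem_dominated s 0).
  destruct (is_CR_exists (Re s - 2) (INR 1 * del / 2) (64 / (del * del) / 2)
    (fun u => Cexp (s * RtoC u) * kern al be (RtoC (exp u)))) as [X HX].
  - lra.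
  - simpl. lra.
  - apply Mellin_cont.
  - intros u. specialize (D u). cbn [csum] in D.
    replace (Cexp (s * u) * (2 * kern al be (exp u) - 0)) with (2 * (Cexp (s * u) * kern al be (exp u))) in D by ring.
    rewrite (Cmod_mult 2), Cmod_R, (Rabs_pos_eq 2) in D by lra.
    set (M := exp ((Re s - 2) * u - INR 1 * del / 2 * exp u)) in *. lra.
  - exists X. exact HX.
Qed.

Lemma cone_sum_int (s g : C) (K : nat) : (0 < Re s)%R -> is_Gam s g ->
  is_CR (fun u => Cexp (s * RtoC u) * csum K (fun i => cone_exp al be (RtoC (exp u)) (S i)))
    (g * cone_sum s K).
Proof.
  intros Hs Hg. assert (Hd : (0 < del)%R) by (unfold del; lra).
  assert (Ct : forall om : C, Ccont (fun u => Cexp (s * RtoC u) * Cexp (- (om * RtoC (exp u))))).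
  { intros om u. apply continuous_Cmult; [apply exp_lin_cont|].
    apply continuous_Cexp, continuous_Copp, continuous_Cmult; [apply continuous_const|].
    apply continuous_RtoC, continuous_exp. }
  apply (is_CR_ext (fun u => csum K (fun i => hsum (S i) (fun n =>
     Cexp (s * RtoC u) * Cexp (- ((RtoC (INR (S i)) * al + RtoC (IZR n) * be) * RtoC (exp u))))))).
  { intros u. rewrite <- csum_mult. apply csum_ext. intros i _. apply hsum_mult. }
  unfold cone_sum. rewrite <- csum_mult.
  apply (is_CR_csum K (fun i u => hsum (S i) (fun n =>
     Cexp (s * RtoC u) * Cexp (- ((RtoC (INR (S i)) * al + RtoC (IZR n) * be) * RtoC (exp u)))))).
  - intros i. apply hsum_cont. intros n. apply Ct.
  - intros i _. rewrite <- hsum_mult. apply is_CR_hsum; [intros; apply Ct|].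
    intros n Hn. apply ppow_int; [exact Hs|exact Hg|].
    eapply Rlt_le_trans; [|apply cone_Re, Hn].
    apply Rmult_lt_0_compat; [apply lt_0_INR; lia|exact Hd].
Qed.

Lemma cone_exp_cont (K : nat) : Ccont (fun u => csum K (fun i => cone_exp al be (RtoC (exp u)) (S i))).
Proof.
  apply csum_cont. intros i. apply hsum_cont. intros n u.
  apply continuous_Cexp, continuous_Copp, continuous_Cmult; [apply continuous_const|].
  apply continuous_RtoC, continuous_exp.
Qed.

(** The Mellin integral of the remainder after K shells is O(K^(-(Re s - 2))) by the scale factor in
    [is_CR_bound], which justifies the exchange of sum and integral. *)
Lemma cone_sum_Mellin (s g X : C) : (2 < Re s)%R -> is_Gam s g ->
  is_CR (fun u => Cexp (s * RtoC u) * kern al be (RtoC (exp u))) X ->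
  Clim (fun K => g * cone_sum s K) (2 * X).
Proof.
  intros Hs Hg HX. assert (Hd : (0 < del)%R) by (unfold del; lra).
  set (q := (Re s - 2)%R). assert (Hq : (0 < q)%R) by (unfold q; lra).
  set (D := (64 / (del * del) * gam_const q * exp (- (q * ln (del / 2))))%R).
  apply (Clim_squeeze _ _ (fun K => D * exp (- (q * ln (INR K))))%R).
  - intros K HK.
    assert (HK0 : (0 < INR K)%R) by (apply lt_0_INR; lia).
    assert (B := is_CR_bound (Re s - 2) (INR (S K) * del / 2) (64 / (del * del))
       (fun u => Cexp (s * RtoC u) *
      (2 * kern al be (RtoC (exp u)) - csum K (fun i => cone_exp al be (RtoC (exp u)) (S i))))
       (2 * X - g * cone_sum s K)).
    rewrite Cmod_minus_sym. eapply Rle_trans; [apply B|].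
    + lra.
    + assert (0 < INR (S K))%R by (apply lt_0_INR; lia). nra.
    + intros u. apply continuous_Cmult; [apply exp_lin_cont|].
      apply continuous_Cminus; [apply continuous_Cmult; [apply continuous_const|apply kern_cont]|apply cone_exp_cont].
    + apply Mellin_rem_dominated.
    + apply (is_CR_ext (fun u => 2 * (Cexp (s * RtoC u) * kern al be (RtoC (exp u)))
         - Cexp (s * RtoC u) * csum K (fun i => cone_exp al be (RtoC (exp u)) (S i)))); [intros; ring|].
      apply is_CR_minus.
      * intros u. apply continuous_Cmult; [apply continuous_const|apply Mellin_cont].
      * intros u. apply continuous_Cmult; [apply exp_lin_cont|apply cone_exp_cont].
      * apply is_CR_mult; [apply Mellin_cont|exact HX].
      * apply cone_sum_int; [lra|exact Hg].
    + fold q. unfold D. rewrite (Rmult_assoc _ (exp _) (exp _)), <- exp_plus. apply Rmult_le_compat_l.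
      * apply Rmult_le_pos; [|left; apply gam_const_pos, Hq].
        left. apply Rdiv_lt_0_compat; [lra|]. apply Rmult_lt_0_compat; assumption.
      * apply exp_le. rewrite <- Ropp_plus_distr, <- Rmult_plus_distr_l, <- ln_mult by lra.
        apply Ropp_le_contravar, Rmult_le_compat_l; [lra|].
        apply Rlt_le, ln_increasing; [nra|]. rewrite S_INR. nra.
  - replace (Finite 0) with (Rbar_mult D 0) by (simpl; f_equal; ring).
    apply is_lim_seq_scal_l, is_lim_seq_exp_ln, Hq.
Qed.

End Cone.

(** * Convergence of the cone sums *)

Section Convergence.
Variables al be : C.
Hypothesis Hcone : (Rabs (Re be) < Re al)%R.

(** |arg om| <= pi/2 <= 2 accounts for the factor 2. *)
Lemma ppow_bound (s om : C) (c : R) : (0 < c)%R -> (c <= Re om)%R -> (0 <= Re s)%R ->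
  (Cmod (ppow om s) <= exp (- (Re s * ln c) + Rabs (Im s) * 2))%R.
Proof.
  intros Hc Ho Hs. unfold ppow. rewrite Cmod_Cexp. apply exp_le.
  replace (Re (- (s * Clog om))) with (- (Re s * ln (Cmod om)) + Im s * Im (Clog om))%R
    by (unfold Re, Im; simpl; ring).
  assert (L : (ln c <= ln (Cmod om))%R).
  { apply Rcomplements.ln_le; [exact Hc|]. eapply Rle_trans; [exact Ho|].
    eapply Rle_trans; [apply Rle_abs|apply re_le_Cmod]. }
  assert (B : (Im s * Im (Clog om) <= Rabs (Im s) * 2)%R).
  { eapply Rle_trans; [apply Rle_abs|]. rewrite Rabs_mult. apply Rmult_le_compat_l; [apply Rabs_pos|].
    assert (Q := Clog_bound om). assert (P := PI_4). apply Rabs_le. lra. }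
  nra.
Qed.

(** Discrete form of the integral of x^(-q-1): ln x - ln (x - 1) >= 1/x, and e^(q h) >= 1 + q h. *)
Lemma power_telescope (q x : R) : (0 < q)%R -> (1 < x)%R ->
  (exp (- ((q + 1) * ln x)) <= / q * (exp (- (q * ln (x - 1))) - exp (- (q * ln x))))%R.
Proof.
  intros Hq Hx.
  assert (L : (/ x <= ln x - ln (x - 1))%R).
  { rewrite <- ln_div by lra.
    assert (Q := exp_ineq1_le (- ln (x / (x - 1)))).
    rewrite exp_Ropp, exp_ln in Q by (apply Rdiv_lt_0_compat; lra).
    replace (/ (x / (x - 1)))%R with (1 - / x)%R in Q by (field; lra). lra. }
  assert (Q := exp_ineq1_le (q * (ln x - ln (x - 1)))).
  assert (E : exp (- (q * ln (x - 1))) = (exp (- (q * ln x)) * exp (q * (ln x - ln (x - 1))))%R)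
    by (rewrite <- exp_plus; f_equal; ring).
  assert (E2 : exp (- ((q + 1) * ln x)) = (exp (- (q * ln x)) * / x)%R).
  { replace (- ((q + 1) * ln x))%R with (- (q * ln x) + - ln x)%R by ring.
    rewrite exp_plus, (exp_Ropp (ln x)), exp_ln by lra. reflexivity. }
  rewrite E, E2. assert (P := exp_pos (- (q * ln x))).
  apply Rmult_le_reg_l with q; [exact Hq|].
  rewrite <- !Rmult_assoc, Rinv_r, Rmult_1_l by lra.
  assert (q * / x <= exp (q * (ln x - ln (x - 1))) - 1)%R.
  { assert (q * / x <= q * (ln x - ln (x - 1)))%R by (apply Rmult_le_compat_l; lra). lra. }
  nra.
Qed.

(** Shell m has total weight 2m and terms of size m^(-s1), so it is O(m^(-(q + 1))) with q = s1 - 2,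
    and the tail telescopes. The bound is uniform on a rectangle of s, as continuity of the limit
    requires. *)
Lemma cone_sum_tail (s1 s2 B : R) : (2 < s1)%R -> exists b : nat -> R, is_lim_seq b 0 /\
  forall s : C, (s1 <= Re s <= s2)%R -> (Rabs (Im s) <= B)%R ->
  forall K L, (1 <= K)%nat -> (K <= L)%nat ->
  (Cmod (cone_sum al be s L - cone_sum al be s K) <= b K)%R.
Proof.
  intros H1. set (del := (Re al - Rabs (Re be))%R). assert (Hd : (0 < del)%R) by (unfold del; lra).
  set (q := (s1 - 2)%R). assert (Hq : (0 < q)%R) by (unfold q; lra).
  (* The factor e^(s2 |ln del|) bounds del^(-Re s), and e^(2 B) the contribution of the argument. *)
  set (M := exp (s2 * Rabs (ln del) + B * 2)). assert (PM : (0 < M)%R) by apply exp_pos.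
  set (c K := exp (- (q * ln (INR K)))).
  exists (fun K => 2 * M / q * c K)%R. split.
  - replace (Finite 0) with (Rbar_mult (2 * M / q)%R 0) by (simpl; f_equal; ring).
    apply is_lim_seq_scal_l. apply is_lim_seq_exp_ln, Hq.
  - intros s Hs HB K L HK HL.
    assert (Shell : forall m, (1 <= m)%nat -> (Cmod (hsum m (fun n => ppow (RtoC (INR m) * al + RtoC (IZR n) * be) s))
        <= 2 * M * exp (- ((q + 1) * ln (INR m))))%R).
    { intros m Hm. assert (Pm : (0 < INR m)%R) by (apply lt_0_INR; lia).
      eapply Rle_trans; [apply (Cmod_hsum m _ (M * exp (- (s1 * ln (INR m)))))|].
      - intros n Hn. eapply Rle_trans; [apply (ppow_bound s _ (INR m * del)%R)|].
        + apply Rmult_lt_0_compat; assumption.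
        + apply cone_Re; assumption.
        + lra.
        + unfold M. rewrite <- exp_plus. apply exp_le. rewrite ln_mult by assumption.
          assert (P0 := Rabs_pos (ln del)). assert (P1 := Rcomplements.Rabs_maj2 (ln del)).
          assert (P2 : (0 <= ln (INR m))%R).
          { rewrite <- ln_1. apply Rcomplements.ln_le; [lra|]. apply (le_INR 1). exact Hm. }
          assert (- (Re s * ln (INR m)) <= - (s1 * ln (INR m)))%R by nra.
          assert (- (Re s * ln del) <= s2 * Rabs (ln del))%R by nra. nra.
      - right. replace (- ((q + 1) * ln (INR m)))%R with (ln (INR m) + - (s1 * ln (INR m)))%R by (unfold q; ring).
        rewrite exp_plus, exp_ln by exact Pm. ring. }
    assert (Main : (Cmod (cone_sum al be s L - cone_sum al be s K) <= 2 * M / q * (c K - c L))%R).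
    { induction HL as [|L HL IH].
      - replace (cone_sum al be s K - cone_sum al be s K) with (RtoC 0) by ring. rewrite Cmod_0. right. ring.
      - unfold cone_sum in *. simpl csum.
        match goal with |- (Cmod (?a + ?b - ?d) <= _)%R =>
          replace (a + b - d) with ((a - d) + b) by ring; assert (T := Cmod_triangle (a - d) b) end.
        assert (S1 := Shell (S L) ltac:(lia)).
        assert (P := power_telescope q (INR (S L)) Hq ltac:(apply (lt_INR 1); lia)).
        replace (INR (S L) - 1)%R with (INR L) in P by (rewrite S_INR; ring).
        fold (c L) (c (S L)) in P.
        assert (2 * M * exp (- ((q + 1) * ln (INR (S L)))) <= 2 * M / q * (c L - c (S L)))%R.
        { unfold Rdiv. rewrite (Rmult_assoc (2 * M)). apply Rmult_le_compat_l; lra. }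
        replace (2 * M / q * (c K - c (S L)))%R with (2 * M / q * (c K - c L) + 2 * M / q * (c L - c (S L)))%R by ring.
        eapply Rle_trans; [exact T|]. apply Rplus_le_compat; [exact IH|].
        eapply Rle_trans; [exact S1|assumption]. }
    assert (PL := exp_pos (- (q * ln (INR L)))). fold (c L) in PL.
    assert (0 < 2 * M / q)%R by (apply Rdiv_lt_0_compat; lra). nra.
Qed.

Definition cone_lim (s : C) : C := CLim_seq (cone_sum al be s).

Lemma cone_lim_tail (s1 s2 B : R) : (2 < s1)%R -> exists b : nat -> R, is_lim_seq b 0 /\
  forall s : C, (s1 <= Re s <= s2)%R -> (Rabs (Im s) <= B)%R ->
  Clim (cone_sum al be s) (cone_lim s) /\
  forall K, (1 <= K)%nat -> (Cmod (cone_lim s - cone_sum al be s K) <= b K)%R.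
Proof.
  intros H1. destruct (cone_sum_tail s1 s2 B H1) as [b [Hb H]]. exists b. split; [exact Hb|].
  intros s Hs HB. destruct (Clim_cauchy (cone_sum al be s) b 1 Hb) as [l [Hl Hl2]].
  - intros n m Hn Hm. apply H; assumption.
  - assert (E : cone_lim s = l) by (apply Clim_CLim_seq, Hl). rewrite E. split; assumption.
Qed.

Lemma cone_lim_correct (s : C) : (2 < Re s)%R -> Clim (cone_sum al be s) (cone_lim s).
Proof.
  intros Hs. destruct (cone_lim_tail (Re s) (Re s) (Rabs (Im s)) Hs) as [b [_ H]].
  apply H; lra.
Qed.

Lemma csum_continuous {T : UniformSpace} (n : nat) (f : nat -> T -> C) (x : T) :
  (forall i, Ccontinuous (f i) x) -> Ccontinuous (fun t => csum n (fun i => f i t)) x.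
Proof.
  intros H. induction n as [|n IH]; simpl; [apply continuous_const|].
  apply continuous_Cplus; [exact IH|apply H].
Qed.

Lemma cone_sum_continuous (K : nat) (s : C) : Ccontinuous (fun s => cone_sum al be s K) s.
Proof.
  apply csum_continuous. intros i. unfold hsum.
  assert (P : forall om : C, Ccontinuous (fun s => ppow om s) s).
  { intros om. apply continuous_Cexp, continuous_Copp, continuous_Cmult; [apply continuous_id|apply continuous_const]. }
  apply (csum_continuous (2 * S i) (fun j s =>
     (ppow (RtoC (INR (S i)) * al + RtoC (IZR (Z.of_nat j - Z.of_nat (S i))) * be) s
      + ppow (RtoC (INR (S i)) * al + RtoC (IZR (Z.of_nat j - Z.of_nat (S i) + 1)) * be) s) / 2)).
  intros j. unfold Cdiv. apply continuous_Cmult; [apply continuous_Cplus; apply P|apply continuous_const].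
Qed.

Lemma ball_Cmod (z w : C) (eps : R) : @ball C_UniformSpace z eps w -> (Cmod (w - z) < 2 * eps)%R.
Proof.
  intros [H1 H2]. eapply Rle_lt_trans; [apply Cmod_le_abs|].
  change (Rabs (fst w - fst z) + Rabs (snd w - snd z) < 2 * eps)%R.
  change (Rabs (fst w - fst z) < eps)%R in H1. change (Rabs (snd w - snd z) < eps)%R in H2. lra.
Qed.

Lemma Cmod_ball (z w : C) (eps : R) : (Cmod (w - z) < eps)%R -> @ball C_UniformSpace z eps w.
Proof.
  intros H. split.
  - change (Rabs (fst w - fst z) < eps)%R. eapply Rle_lt_trans; [apply (re_le_Cmod (w - z))|exact H].
  - change (Rabs (snd w - snd z) < eps)%R. eapply Rle_lt_trans; [apply (im_le_Cmod (w - z))|exact H].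
Qed.

Lemma cone_lim_continuous (s : C) : (2 < Re s)%R -> Ccontinuous cone_lim s.
Proof.
  (* The midpoint of 2 and Re s keeps a rectangle around s inside the half plane of convergence. *)
  intros Hs. set (s1 := ((2 + Re s) / 2)%R).
  destruct (cone_lim_tail s1 (Re s + 1) (Rabs (Im s) + 1) ltac:(unfold s1; lra)) as [b [Hb H]].
  apply filterlim_locally. intros eps.
  (* Two tails below e and a difference of partial sums below 2 (e/2) add up to less than eps = 4
     e. *)
  set (e := (eps / 4)%R). assert (He : (0 < e)%R) by (unfold e; destruct eps; simpl; lra).
  apply is_lim_seq_spec in Hb. destruct (Hb (mkposreal e He)) as [N HN].
  specialize (HN (S N) ltac:(lia)). simpl in HN. rewrite Rminus_0_r in HN.
  assert (Hbn := Rle_abs (b (S N))).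
  assert (Cc := proj1 (filterlim_locally _ _) (cone_sum_continuous (S N) s) (mkposreal (e / 2) ltac:(lra))).
  assert (Hr : (0 < Rmin 1 ((Re s - 2) / 2))%R) by (apply Rmin_pos; lra).
  assert (Loc : @locally C_UniformSpace s (fun t => (s1 <= Re t <= Re s + 1)%R /\ (Rabs (Im t) <= Rabs (Im s) + 1)%R)).
  { exists (mkposreal _ Hr). intros t [H1 H2].
    change (Rabs (Re t - Re s) < Rmin 1 ((Re s - 2) / 2))%R in H1.
    change (Rabs (Im t - Im s) < Rmin 1 ((Re s - 2) / 2))%R in H2.
    assert (M1 := Rmin_l 1 ((Re s - 2) / 2)). assert (M2 := Rmin_r 1 ((Re s - 2) / 2)).
    apply Rabs_def2 in H1. unfold s1. split; [lra|].
    assert (Q := Rabs_triang (Im t - Im s) (Im s)). replace (Im t - Im s + Im s)%R with (Im t) in Q by ring. lra. }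
  generalize (filter_and _ _ Cc Loc). apply filter_imp. intros t [B1 [B2 B3]].
  apply Cmod_ball. apply ball_Cmod in B1. simpl in B1.
  destruct (H t B2 B3) as [_ T1]. specialize (T1 (S N) ltac:(lia)).
  destruct (H s ltac:(unfold s1; lra) ltac:(lra)) as [_ T2]. specialize (T2 (S N) ltac:(lia)).
  set (u := cone_sum al be t (S N)) in *. set (v := cone_sum al be s (S N)) in *.
  replace (cone_lim t - cone_lim s) with ((cone_lim t - u) + ((u - v) + (v - cone_lim s))) by ring.
  assert (Q1 := Cmod_triangle (cone_lim t - u) ((u - v) + (v - cone_lim s))).
  assert (Q2 := Cmod_triangle (u - v) (v - cone_lim s)).
  rewrite (Cmod_minus_sym v) in Q2. unfold e in *. destruct eps as [eps Heps]; simpl in *. lra.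
Qed.

End Convergence.

(** * Logarithms and branches of powers *)

Lemma Carg_exp (w : C) : (- PI < Im w <= PI)%R -> Carg (Cexp w) = Im w.
Proof.
  intros H. unfold Carg. rewrite Cmod_Cexp.
  assert (E1 : Im (Cexp w) = (exp (Re w) * sin (Im w))%R) by (unfold Cexp, Re, Im; simpl; ring).
  assert (E2 : (Re (Cexp w) / exp (Re w))%R = cos (Im w)).
  { unfold Cexp, Re, Im; simpl. field. apply Rgt_not_eq, exp_pos. }
  rewrite E1, E2. assert (P := exp_pos (Re w)).
  destruct (Rle_lt_dec 0 (Im w)) as [Hy|Hy].
  - assert (0 <= sin (Im w))%R by (apply sin_ge_0; lra).
    destruct (Rle_dec 0 (exp (Re w) * sin (Im w))) as [_|N]; [|exfalso; apply N; nra].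
    apply acos_cos. lra.
  - assert (sin (Im w) < 0)%R by (apply sin_lt_0_var; lra).
    destruct (Rle_dec 0 (exp (Re w) * sin (Im w))) as [N|_]; [exfalso; nra|].
    rewrite <- cos_neg, acos_cos by lra. ring.
Qed.

Lemma Cexp_period (w : C) (k : Z) : Cexp (w + Ci * RtoC (2 * IZR k * PI)) = Cexp w.
Proof. rewrite Cexp_add, Cexp_2PI. ring. Qed.

(** A branch of the power is selected by a logarithm w in the right window; both cuts, at
    [theta_cut] and at the positive axis, are then treated by the one rule e^(s w). *)
Lemma Cpow_cut_exp (theta : R) (w s : C) : (- PI < theta <= PI)%R ->
  (theta <= Im w < theta + 2 * PI)%R -> Cpow_cut theta (Cexp w) s = Cexp (s * w).
Proof.
  intros Ht Hw. assert (A : Carg_from theta (Cexp w) = Im w).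
  { unfold Carg_from. destruct (Rle_lt_dec (Im w) PI) as [H|H].
    - rewrite Carg_exp by lra. destruct (Rle_dec theta (Im w)); [reflexivity|exfalso; lra].
    - assert (E : Carg (Cexp w) = (Im w - 2 * PI)%R).
      { rewrite <- (Cexp_period w (-1)), Carg_exp; unfold Im in *; simpl; lra. }
      rewrite E. destruct (Rle_dec theta (Im w - 2 * PI)); [exfalso; lra|ring]. }
  unfold Cpow_cut, Rcpow. rewrite A, Cmod_Cexp, ln_exp, <- Cexp_add. f_equal.
  apply C_eq; unfold Re, Im; simpl; ring.
Qed.

Lemma Clog_unique (c : C) : (- (PI / 2) < Im c < PI / 2)%R -> Clog (Cexp c) = c.
Proof.
  intros H. unfold Clog. rewrite Cmod_Cexp, ln_exp. apply C_eq; [reflexivity|].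
  change (atan (Im (Cexp c) / Re (Cexp c)) = Im c).
  assert (P := cos_gt_0 (Im c) ltac:(lra) ltac:(lra)).
  replace (Im (Cexp c) / Re (Cexp c))%R with (tan (Im c)).
  - apply atan_tan. lra.
  - unfold tan, Cexp, Re, Im in *; simpl. assert (Q := exp_pos (fst c)). field.
    split; lra.
Qed.

(** * Square partial sums and their frames *)

Lemma csum_first (n : nat) (f : nat -> C) : csum (S n) f = f O + csum n (fun i => f (S i)).
Proof.
  induction n as [|n IH]; [simpl; ring|].
  change (csum (S (S n)) f) with (csum (S n) f + f (S n)). rewrite IH. simpl. ring.
Qed.

Lemma csum_rev (n : nat) (f : nat -> C) : csum n (fun i => f (n - 1 - i)%nat) = csum n f.
Proof.
  induction n as [|n IH]; [reflexivity|].
  rewrite csum_first. change (csum (S n) f) with (csum n f + f n).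
  rewrite <- IH. replace (S n - 1 - 0)%nat with n by lia.
  rewrite (csum_ext n (fun i => f (S n - 1 - S i)%nat) (fun i => f (n - 1 - i)%nat)).
  - ring.
  - intros i Hi. f_equal. lia.
Qed.

Lemma hsum_flip (m : nat) (g : Z -> C) : hsum m (fun n => g (- n)%Z) = hsum m g.
Proof.
  unfold hsum. rewrite <- csum_rev. apply csum_ext. intros i Hi.
  replace (- (Z.of_nat (2 * m - 1 - i) - Z.of_nat m))%Z with (Z.of_nat i - Z.of_nat m + 1)%Z by lia.
  replace (- (Z.of_nat (2 * m - 1 - i) - Z.of_nat m + 1))%Z with (Z.of_nat i - Z.of_nat m)%Z by lia.
  unfold Cdiv. f_equal. ring.
Qed.

Lemma csum_trapezoid (n : nat) (f : nat -> C) :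
  csum n (fun j => (f j + f (S j)) / 2) = csum (S n) f - (f O + f n) / 2.
Proof. induction n as [|n IH]; [simpl; field|]. simpl in *. rewrite IH. field. Qed.

Lemma hsum_full (m : nat) (g : Z -> C) :
  hsum m g = csum (S (2 * m)) (fun j => g (Z.of_nat j - Z.of_nat m)%Z) - (g (- Z.of_nat m)%Z + g (Z.of_nat m)) / 2.
Proof.
  assert (T := csum_trapezoid (2 * m) (fun j => g (Z.of_nat j - Z.of_nat m)%Z)). cbv beta in T.
  replace (Z.of_nat 0 - Z.of_nat m)%Z with (- Z.of_nat m)%Z in T by lia.
  replace (Z.of_nat (2 * m) - Z.of_nat m)%Z with (Z.of_nat m) in T by lia.
  rewrite <- T. unfold hsum. apply csum_ext. intros i _.
  replace (Z.of_nat (S i) - Z.of_nat m)%Z with (Z.of_nat i - Z.of_nat m + 1)%Z by lia. reflexivity.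
Qed.

Lemma sum_n_csum (f : nat -> C) (n : nat) : sum_n (G := C_AbelianMonoid) f n = csum (S n) f.
Proof.
  induction n as [|n IH].
  - rewrite sum_O. simpl. ring.
  - rewrite sum_Sn, IH. reflexivity.
Qed.

Definition square (t : Z -> Z -> C) (K : nat) : C :=
  csum (S (2 * K)) (fun i => csum (S (2 * K)) (fun j =>
    t (Z.of_nat i - Z.of_nat K)%Z (Z.of_nat j - Z.of_nat K)%Z)).

Lemma csum_ends (K : nat) (g : Z -> C) :
  csum (S (2 * S K)) (fun j => g (Z.of_nat j - Z.of_nat (S K))%Z)
  = g (- Z.of_nat (S K))%Z + csum (S (2 * K)) (fun j => g (Z.of_nat j - Z.of_nat K)%Z) + g (Z.of_nat (S K)).
Proof.
  replace (2 * S K)%nat with (S (S (2 * K))) by lia.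
  change (csum (S (S (S (2 * K)))) (fun j => g (Z.of_nat j - Z.of_nat (S K))%Z))
    with (csum (S (S (2 * K))) (fun j => g (Z.of_nat j - Z.of_nat (S K))%Z)
          + g (Z.of_nat (S (S (2 * K))) - Z.of_nat (S K))%Z).
  rewrite csum_first.
  replace (Z.of_nat (S (S (2 * K))) - Z.of_nat (S K))%Z with (Z.of_nat (S K)) by lia.
  replace (Z.of_nat 0 - Z.of_nat (S K))%Z with (- Z.of_nat (S K))%Z by lia.
  f_equal. f_equal. apply csum_ext. intros i _. f_equal. lia.
Qed.

(** A frame of the square consists of four full sides; each corner lies on two of them, with half
    weight on each. *)
Lemma square_ring (t : Z -> Z -> C) (K : nat) : let M := Z.of_nat (S K) in
  square t (S K) = square t K + (hsum (S K) (fun n => t M n) + hsum (S K) (fun n => t (- M)%Z n)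
     + (hsum (S K) (fun m => t m M) + hsum (S K) (fun m => t m (- M)%Z))).
Proof.
  intros M. unfold square.
  rewrite (csum_ends K (fun m => csum (S (2 * S K)) (fun j => t m (Z.of_nat j - Z.of_nat (S K))%Z))).
  rewrite (csum_ext (S (2 * K)) _ (fun i =>
     (t (Z.of_nat i - Z.of_nat K)%Z (- M)%Z + t (Z.of_nat i - Z.of_nat K)%Z M)
     + csum (S (2 * K)) (fun j => t (Z.of_nat i - Z.of_nat K)%Z (Z.of_nat j - Z.of_nat K)%Z))).
  2:{ intros i _. rewrite (csum_ends K (fun n => t (Z.of_nat i - Z.of_nat K)%Z n)). fold M. ring. }
  rewrite !csum_plus, !hsum_full.
  rewrite (csum_ends K (fun m => t m M)), (csum_ends K (fun m => t m (- M)%Z)). fold M.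
  field.
Qed.

(** Made for the left and bottom sides, whose common corner lies on the cut: there only the sum of
    the two formulas is right, not each of them. *)
Lemma hsum_two_ends (m : nat) (f f' g g' : Z -> C) : (1 <= m)%nat -> let M := Z.of_nat m in
  (forall n, (- M < n <= M)%Z -> f n = g n) -> (forall n, (- M < n <= M)%Z -> f' n = g' n) ->
  f (- M)%Z + f' (- M)%Z = g (- M)%Z + g' (- M)%Z ->
  hsum m f + hsum m f' = hsum m g + hsum m g'.
Proof.
  intros Hm M H H' E.
  rewrite !hsum_full. fold M. rewrite !csum_first.
  replace (Z.of_nat 0 - M)%Z with (- M)%Z by lia.
  rewrite (H M), (H' M) by lia.
  rewrite (csum_ext (2 * m) _ (fun i => g (Z.of_nat (S i) - M)%Z)) by (intros; apply H; lia).
  rewrite (csum_ext (2 * m) (fun i => f' (Z.of_nat (S i) - M)%Z) (fun i => g' (Z.of_nat (S i) - M)%Z))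
    by (intros; apply H'; lia).
  set (X := csum _ _). set (Y := csum _ _).
  transitivity ((f (- M)%Z + f' (- M)%Z) / 2 + X + Y - g M / 2 - g' M / 2); [field|rewrite E; field].
Qed.

(** * Decomposition of the lattice into four cones *)

Lemma Cexp_PI2 : Cexp (Ci * RtoC (PI / 2)) = Ci.
Proof.
  apply C_eq; simpl; replace (0 * (PI / 2) - 1 * 0)%R with 0%R by ring;
  replace (0 * 0 + 1 * (PI / 2))%R with (PI / 2)%R by ring; rewrite exp_0, cos_PI2, sin_PI2; ring.
Qed.

Lemma cone_sum_S (al be s : C) (K : nat) : cone_sum al be s (S K) =
  cone_sum al be s K + hsum (S K) (fun n => ppow (RtoC (INR (S K)) * al + RtoC (IZR n) * be) s).
Proof. reflexivity. Qed.

Section Lattice.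
Variable tau : C.
Hypothesis Hre : (- 1 < Re tau < 1)%R.
Hypothesis Him : (0 < Im tau)%R.

Let psi := Im (Clog (1 + tau)).

Lemma psi_bounds : (0 < psi < PI / 2)%R.
Proof.
  split; [|apply Clog_bound].
  unfold psi, Clog. simpl. unfold Re, Im in *.
  rewrite <- atan_0. apply atan_increasing. rewrite ?atan_0. apply Rdiv_lt_0_compat; lra.
Qed.

Lemma Cexp_minus_PI (w : C) : Cexp (w - Ci * RtoC PI) = - Cexp w.
Proof. unfold Cminus. rewrite Cexp_add, Cexp_opp, Cexp_PI. field. Qed.

Lemma Cexp_plus_PI (w : C) : Cexp (w + Ci * RtoC PI) = - Cexp w.
Proof. rewrite Cexp_add, Cexp_PI. ring. Qed.

(** The logarithm of -1 - tau is that of 1 + tau minus i pi. As psi = arg (1 + tau) lies in (0,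
    pi/2), the window of the branch runs from psi - pi to psi + pi. *)
Lemma theta_cut_psi : theta_cut tau = (psi - PI)%R.
Proof.
  unfold theta_cut. assert (B := psi_bounds).
  assert (P : (0 < Re (1 + tau))%R) by (unfold Re in *; simpl; lra).
  replace (- 1 - tau) with (Cexp (Clog (1 + tau) - Ci * RtoC PI)).
  - assert (E : Im (Clog (1 + tau) - Ci * RtoC PI) = (psi - PI)%R).
    { unfold psi. generalize (Clog (1 + tau)). intros [a b]. unfold Im. simpl. ring. }
    rewrite Carg_exp; rewrite E; [reflexivity|]. generalize PI_RGT_0. lra.
  - rewrite Cexp_minus_PI, Cexp_Clog by exact P. ring.
Qed.

(** Reduces the evaluation of a term off the cut to exhibiting a logarithm of the lattice point in
    the window of the branch. *)
Lemma lattice_term_exp (s w : C) (m n : Z) :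
  (m <> 0 \/ n <> 0)%Z -> ~ (m = n /\ m < 0)%Z ->
  Cexp w = RtoC (IZR m) + RtoC (IZR n) * tau ->
  (psi - PI <= Im w < psi + PI)%R -> lattice_term tau s m n = Cexp (- (s * w)).
Proof.
  intros H0 H1 Ew Hw. unfold lattice_term. assert (B := psi_bounds).
  destruct (Z.eqb_spec m 0); destruct (Z.eqb_spec n 0); try (exfalso; lia);
  simpl; destruct (Z.eqb_spec m n); try (exfalso; lia); simpl;
  try (destruct (Z.ltb_spec m 0); [exfalso; lia|]);
  rewrite <- Ew, Cpow_cut_exp, Cexp_opp; try (rewrite theta_cut_psi; lra);
  unfold Cdiv; ring.
Qed.

(** Points of a frame turned into the right half plane: [om M n] is M + n tau itself, and [om' M n]
    below is (n + M tau) / i. *)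
Definition om (M : nat) (n : Z) : C := RtoC (INR M) * 1 + RtoC (IZR n) * tau.
Definition om' (M : nat) (n : Z) : C := RtoC (INR M) * (- (Ci * tau)) + RtoC (IZR n) * (- Ci).

Lemma om_Re (M : nat) (n : Z) : (1 <= M)%nat -> (- Z.of_nat M <= n <= Z.of_nat M)%Z -> (0 < Re (om M n))%R.
Proof.
  intros HM Hn.
  replace (Re (om M n)) with (INR M + IZR n * Re tau)%R by (unfold om, Re; simpl; ring).
  assert (P : (1 <= INR M)%R) by (apply (le_INR 1); exact HM).
  destruct Hn as [H1 H2]. apply IZR_le in H1, H2. rewrite opp_IZR in H1. rewrite <- INR_IZR_INZ in *.
  destruct (Rle_dec 0 (IZR n)); nra.
Qed.

Lemma om'_Re (M : nat) (n : Z) : (1 <= M)%nat -> (0 < Re (om' M n))%R.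
Proof.
  intros HM. replace (Re (om' M n)) with (INR M * Im tau)%R by (unfold om', Re, Im; simpl; ring).
  apply Rmult_lt_0_compat; [apply lt_0_INR; lia|exact Him].
Qed.

Lemma term_right (s : C) (M : nat) (n : Z) : (1 <= M)%nat -> (- Z.of_nat M <= n <= Z.of_nat M)%Z ->
  lattice_term tau s (Z.of_nat M) n = ppow (om M n) s.
Proof.
  intros HM Hn. apply lattice_term_exp; [lia|lia| |].
  - rewrite Cexp_Clog by (apply om_Re; assumption). unfold om. rewrite INR_IZR_INZ. ring.
  - generalize (Clog_bound (om M n)) psi_bounds. lra.
Qed.

(** The argument of a point on the left side is that of its opposite M - n tau plus pi. It stays
    below psi + pi because -n < M puts the opposite below the direction of 1 + tau; at n = -M the
    point is on the cut. *)
Lemma term_left (s : C) (M : nat) (n : Z) : (1 <= M)%nat -> (- Z.of_nat M < n <= Z.of_nat M)%Z ->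
  lattice_term tau s (- Z.of_nat M) n = Cexp (- (s * (Ci * RtoC PI))) * ppow (om M (- n)) s.
Proof.
  intros HM Hn. assert (P := om_Re M (- n) HM ltac:(lia)).
  rewrite (lattice_term_exp s (Clog (om M (- n)) + Ci * RtoC PI)).
  - unfold ppow. rewrite <- Cexp_add. f_equal. ring.
  - lia.
  - lia.
  - rewrite Cexp_plus_PI, Cexp_Clog by exact P. unfold om. rewrite !opp_IZR, INR_IZR_INZ, !RtoC_opp. ring.
  - replace (Im (Clog (om M (- n)) + Ci * RtoC PI)) with (Im (Clog (om M (- n))) + PI)%R
      by (generalize (Clog (om M (- n))); intros [a b]; unfold Im; simpl; ring).
    assert (B := Clog_bound (om M (- n))). assert (B' := psi_bounds).
    assert (A : (Im (Clog (om M (- n))) < psi)%R).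
    { unfold psi, Clog. cbn [Im snd]. apply atan_increasing.
      replace (Re (om M (- n))) with (INR M + IZR (- n) * Re tau)%R in * by (unfold om, Re; simpl; ring).
      replace (Im (om M (- n))) with (IZR (- n) * Im tau)%R by (unfold om, Im; simpl; ring).
      replace (Im (1 + tau)) with (Im tau) by (unfold Im; simpl; ring).
      replace (Re (1 + tau)) with (1 + Re tau)%R by (unfold Re; simpl; ring).
      assert (Hlt : (IZR (- n) < INR M)%R) by (rewrite INR_IZR_INZ; apply IZR_lt; lia).
      apply Rmult_lt_reg_r with (INR M + IZR (- n) * Re tau)%R; [exact P|].
      apply Rmult_lt_reg_r with (1 + Re tau)%R; [lra|].
      replace (IZR (- n) * Im tau / (INR M + IZR (- n) * Re tau) * (INR M + IZR (- n) * Re tau) * (1 + Re tau))%R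
        with (IZR (- n) * Im tau * (1 + Re tau))%R by (field; lra).
      replace (Im tau / (1 + Re tau) * (INR M + IZR (- n) * Re tau) * (1 + Re tau))%R
        with (Im tau * (INR M + IZR (- n) * Re tau))%R by (field; lra).
      nra. }
    lra.
Qed.

Lemma term_top (s : C) (M : nat) (m : Z) : (1 <= M)%nat -> (- Z.of_nat M <= m <= Z.of_nat M)%Z ->
  lattice_term tau s m (Z.of_nat M) = Cexp (- (s * (Ci * RtoC (PI / 2)))) * ppow (om' M m) s.
Proof.
  intros HM Hn. assert (P := om'_Re M m HM).
  rewrite (lattice_term_exp s (Clog (om' M m) + Ci * RtoC (PI / 2))).
  - unfold ppow. rewrite <- Cexp_add. f_equal. ring.
  - lia.
  - lia.
  - rewrite Cexp_add, Cexp_PI2, Cexp_Clog by exact P. unfold om'. rewrite INR_IZR_INZ.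
    transitivity (- (Ci * Ci) * (RtoC (IZR (Z.of_nat M)) * tau + RtoC (IZR m))); [ring|rewrite Ci_sqr; ring].
  - replace (Im (Clog (om' M m) + Ci * RtoC (PI / 2))) with (Im (Clog (om' M m)) + PI / 2)%R
      by (generalize (Clog (om' M m)); intros [a b]; unfold Im; simpl; ring).
    generalize (Clog_bound (om' M m)) psi_bounds. lra.
Qed.

Lemma Clog_rot : Clog (- (Ci * (1 + tau))) = Clog (1 + tau) - Ci * RtoC (PI / 2).
Proof.
  assert (P : (0 < Re (1 + tau))%R) by (unfold Re in *; simpl; lra).
  rewrite <- (Clog_unique (Clog (1 + tau) - Ci * RtoC (PI / 2))).
  - f_equal. unfold Cminus. rewrite Cexp_add, Cexp_opp, Cexp_PI2, Cexp_Clog by exact P.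
    replace (/ Ci) with (- Ci); [ring|]. 
    replace (- Ci) with (- (Ci * Ci) / Ci) by (field; apply Ci_nz). rewrite Ci_sqr. field. apply Ci_nz.
  - replace (Im (Clog (1 + tau) - Ci * RtoC (PI / 2))) with (psi - PI / 2)%R
      by (unfold psi; generalize (Clog (1 + tau)); intros [a b]; unfold Im; simpl; ring).
    generalize psi_bounds. lra.
Qed.

(** The bottom side takes arguments from psi - pi upwards. Strictness again leaves out the corner,
    whose direction after rotation is -i (1 + tau). *)
Lemma term_bottom (s : C) (M : nat) (m : Z) : (1 <= M)%nat -> (- Z.of_nat M < m <= Z.of_nat M)%Z ->
  lattice_term tau s m (- Z.of_nat M) = Cexp (s * (Ci * RtoC (PI / 2))) * ppow (om' M (- m)) s.
Proof.
  intros HM Hn. assert (P := om'_Re M (- m) HM).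
  rewrite (lattice_term_exp s (Clog (om' M (- m)) - Ci * RtoC (PI / 2))).
  - unfold ppow. rewrite <- Cexp_add. f_equal. ring.
  - lia.
  - lia.
  - unfold Cminus. rewrite Cexp_add, Cexp_opp, Cexp_PI2, Cexp_Clog by exact P. unfold om'. rewrite !opp_IZR, INR_IZR_INZ, !RtoC_opp.
    field. apply Ci_nz.
  - replace (Im (Clog (om' M (- m)) - Ci * RtoC (PI / 2))) with (Im (Clog (om' M (- m))) - PI / 2)%R
      by (generalize (Clog (om' M (- m))); intros [a b]; unfold Im; simpl; ring).
    assert (B := Clog_bound (om' M (- m))). assert (B' := psi_bounds).
    assert (A : (psi - PI / 2 < Im (Clog (om' M (- m))))%R).
    { replace (psi - PI / 2)%R with (Im (Clog (- (Ci * (1 + tau)))))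
        by (rewrite Clog_rot; unfold psi; generalize (Clog (1 + tau)); intros [a b]; unfold Im; simpl; ring).
      unfold Clog. cbn [Im snd]. apply atan_increasing.
      replace (Re (om' M (- m))) with (INR M * Im tau)%R in * by (unfold om', Re, Im; simpl; ring).
      replace (Im (om' M (- m))) with (- (INR M * Re tau + IZR (- m)))%R by (unfold om', Re, Im; simpl; ring).
      replace (Im (- (Ci * (1 + tau)))) with (- (1 + Re tau))%R by (unfold Re, Im; simpl; ring).
      replace (Re (- (Ci * (1 + tau)))) with (Im tau)%R by (unfold Re, Im; simpl; ring).
      assert (Hlt : (IZR (- m) < INR M)%R) by (rewrite INR_IZR_INZ; apply IZR_lt; lia).
      apply Rmult_lt_reg_r with (INR M * Im tau)%R; [exact P|].
      replace (- (1 + Re tau) / Im tau * (INR M * Im tau))%R with (- (1 + Re tau) * INR M)%R by (field; lra).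
      replace (- (INR M * Re tau + IZR (- m)) / (INR M * Im tau) * (INR M * Im tau))%R
        with (- (INR M * Re tau + IZR (- m)))%R by (field; split; [lra|apply not_0_INR; lia]).
      nra. }
    lra.
Qed.

(** The two boundary arguments psi + pi and psi - pi at the corner are those that the formulas of
    the left and of the bottom side would give there. The corner is counted on both sides, and twice
    its averaged value is the sum of the two. *)
Lemma term_corner (s : C) (M : nat) : (1 <= M)%nat -> let t := lattice_term tau s (- Z.of_nat M) (- Z.of_nat M) in
  t + t = Cexp (- (s * (Ci * RtoC PI))) * ppow (om M (- (- Z.of_nat M))) s
        + Cexp (s * (Ci * RtoC (PI / 2))) * ppow (om' M (- (- Z.of_nat M))) s.
Proof.
  intros HM t.
  assert (PM : (0 < INR M)%R) by (apply lt_0_INR; lia).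
  assert (P : (0 < Re (1 + tau))%R) by (unfold Re in *; simpl; lra).
  assert (Pm : (0 < Cmod (1 + tau))%R).
  { apply Cmod_gt_0. intros E. rewrite E in P. simpl in P. lra. }
  assert (L1 : Clog (om M (- - Z.of_nat M)) = RtoC (ln (INR M)) + Clog (1 + tau)).
  { rewrite <- (Clog_unique (RtoC (ln (INR M)) + Clog (1 + tau))).
    - f_equal. rewrite Cexp_add, Cexp_RtoC, exp_ln, Cexp_Clog by assumption. unfold om.
      rewrite Z.opp_involutive, <- INR_IZR_INZ. ring.
    - replace (Im (RtoC (ln (INR M)) + Clog (1 + tau))) with psi
        by (unfold psi; generalize (Clog (1 + tau)); intros [a b]; unfold Im; simpl; ring).
      generalize psi_bounds. lra. }
  assert (L2 : Clog (om' M (- - Z.of_nat M)) = RtoC (ln (INR M)) + Clog (1 + tau) - Ci * RtoC (PI / 2)).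
  { rewrite <- (Clog_unique (RtoC (ln (INR M)) + Clog (1 + tau) - Ci * RtoC (PI / 2))).
    - f_equal. replace (RtoC (ln (INR M)) + Clog (1 + tau) - Ci * RtoC (PI / 2))
        with (RtoC (ln (INR M)) + (Clog (1 + tau) - Ci * RtoC (PI / 2))) by ring.
      rewrite <- Clog_rot, Cexp_add, Cexp_RtoC, exp_ln, Cexp_Clog.
      + unfold om'. rewrite Z.opp_involutive, <- INR_IZR_INZ. ring.
      + replace (Re (- (Ci * (1 + tau)))) with (Im tau)%R by (unfold Re, Im; simpl; ring). exact Him.
      + exact PM.
    - replace (Im (RtoC (ln (INR M)) + Clog (1 + tau) - Ci * RtoC (PI / 2))) with (psi - PI / 2)%R
        by (unfold psi; generalize (Clog (1 + tau)); intros [a b]; unfold Im; simpl; ring).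
      generalize psi_bounds. lra. }
  unfold ppow. rewrite L1, L2, <- !Cexp_add.
  assert (Et : t = 1 / (2 * Rcpow (INR M * Cmod (1 + tau)) s)
    * (Cexp (- (Ci * RtoC (theta_cut tau) * s)) + Cexp (- (Ci * RtoC (theta_cut tau + 2 * PI) * s)))).
  { unfold t, lattice_term. 
    replace (Z.eqb (- Z.of_nat M) 0) with false by (symmetry; apply Z.eqb_neq; lia).
    rewrite Z.eqb_refl. replace (Z.ltb (- Z.of_nat M) 0) with true by (symmetry; apply Z.ltb_lt; lia).
    cbn [andb]. rewrite Z.opp_involutive, <- INR_IZR_INZ. reflexivity. }
  rewrite Et, theta_cut_psi.
  assert (Ec : Clog (1 + tau) = RtoC (ln (Cmod (1 + tau))) + Ci * RtoC psi).
  { unfold psi. apply C_eq; unfold Clog, Re, Im; simpl; ring. }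
  rewrite Ec.
  replace (Rcpow (INR M * Cmod (1 + tau)) s) with (Cexp (s * (RtoC (ln (INR M)) + RtoC (ln (Cmod (1 + tau)))))).
  2:{ unfold Rcpow. rewrite ln_mult, RtoC_plus by assumption. reflexivity. }
  set (l := RtoC (ln (INR M)) + RtoC (ln (Cmod (1 + tau)))).
  replace (1 / (2 * Cexp (s * l))) with (Cexp (- (s * l)) / 2).
  2:{ rewrite Cexp_opp. field. apply Cexp_nz. }
  match goal with |- _ = Cexp ?A + Cexp ?B =>
    transitivity (Cexp (- (s * l)) * Cexp (- (Ci * RtoC (psi - PI + 2 * PI) * s))
        + Cexp (- (s * l)) * Cexp (- (Ci * RtoC (psi - PI) * s))) end.
  { field. }
  rewrite <- !Cexp_add. f_equal; f_equal; unfold l.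
  - rewrite !RtoC_plus, RtoC_minus, RtoC_mult. ring.
  - rewrite !RtoC_minus. replace (RtoC PI) with (RtoC (PI / 2) + RtoC (PI / 2)) by (rewrite <- RtoC_plus; f_equal; field).
    ring.
Qed.

Lemma Etilde_partial_square (s : C) (K : nat) : Etilde_partial tau s K = square (lattice_term tau s) K.
Proof.
  unfold Etilde_partial, square. rewrite sum_n_csum. apply csum_ext. intros i _. apply sum_n_csum.
Qed.

(** The right and left cones carry 1 and e^(-i pi s), the top and bottom ones e^(-i pi s / 2) and
    e^(i pi s / 2), from the shifts of the logarithm by i pi, i pi / 2 and -i pi / 2. *)
Lemma Etilde_cones (s : C) (K : nat) : Etilde_partial tau s K =
  (1 + Cexp (- (s * (Ci * RtoC PI)))) * cone_sum 1 tau s K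
  + (Cexp (- (s * (Ci * RtoC (PI / 2)))) + Cexp (s * (Ci * RtoC (PI / 2)))) * cone_sum (- (Ci * tau)) (- Ci) s K.
Proof.
  rewrite Etilde_partial_square. induction K as [|K IH].
  (* The square of size 0 is the origin alone, where the term is 0 by convention. *)
  - assert (Z : square (lattice_term tau s) 0 = 0 + (0 + 0)) by reflexivity.
    rewrite Z. unfold cone_sum. simpl. ring.
  - rewrite square_ring, IH, !cone_sum_S. set (M := S K).
    assert (H1 : hsum M (fun n => lattice_term tau s (Z.of_nat M) n) = hsum M (fun n => ppow (om M n) s)).
    { apply hsum_ext. intros n Hn. apply term_right; [unfold M; lia|exact Hn]. }
    assert (H2 : hsum M (fun m => lattice_term tau s m (Z.of_nat M))
       = Cexp (- (s * (Ci * RtoC (PI / 2)))) * hsum M (fun n => ppow (om' M n) s)).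
    { rewrite <- hsum_mult. apply hsum_ext. intros n Hn. apply term_top; [unfold M; lia|exact Hn]. }
    assert (H3 : hsum M (fun n => lattice_term tau s (- Z.of_nat M) n) + hsum M (fun m => lattice_term tau s m (- Z.of_nat M))
       = Cexp (- (s * (Ci * RtoC PI))) * hsum M (fun n => ppow (om M n) s)
         + Cexp (s * (Ci * RtoC (PI / 2))) * hsum M (fun n => ppow (om' M n) s)).
    { rewrite <- (hsum_flip M (fun n => ppow (om M n) s)), <- (hsum_flip M (fun n => ppow (om' M n) s)).
      rewrite <- !hsum_mult. apply hsum_two_ends; [unfold M; lia| | |].
      - intros n Hn. apply term_left; [unfold M; lia|exact Hn].
      - intros n Hn. apply term_bottom; [unfold M; lia|exact Hn].
      - apply term_corner. unfold M; lia. }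
    change (hsum M (fun n => ppow (RtoC (INR M) * 1 + RtoC (IZR n) * tau) s)) with (hsum M (fun n => ppow (om M n) s)).
    change (hsum M (fun n => ppow (RtoC (INR M) * (- (Ci * tau)) + RtoC (IZR n) * (- Ci)) s)) with (hsum M (fun n => ppow (om' M n) s)).
    set (A := hsum M (fun n => ppow (om M n) s)) in *. set (B := hsum M (fun n => ppow (om' M n) s)) in *.
    rewrite H1, H2.
    set (c1 := cone_sum 1 tau s K). set (c2 := cone_sum (- (Ci * tau)) (- Ci) s K).
    set (L := hsum M (fun n => lattice_term tau s (- Z.of_nat M) n)) in *.
    set (D := hsum M (fun m => lattice_term tau s m (- Z.of_nat M))) in *.
    match goal with |- ?x + (A + L + (?y + D)) = _ => transitivity (x + A + y + (L + D)); [ring|] end.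
    rewrite H3. ring.
Qed.

End Lattice.

(** * Size and singularities of the kernel *)

(** cos z = cosh (-i z) identifies the second summand with the kernel of parameters -i tau and
    -i. *)
Lemma F_kern (tau s z : C) : F tau s z =
  Cexp (- (Ci * s * RtoC PI / 2)) * kern 1 tau z + kern (- (Ci * tau)) (- Ci) z.
Proof.
  unfold F. f_equal.
  - f_equal. rewrite <- kern_cosh. replace (1 * z) with z by ring. reflexivity.
  - rewrite <- kern_cosh.
    replace (Ccosh (- Ci * z / 2)) with (Ccos (z / 2)).
    2:{ unfold Ccosh, Ccos. replace (- Ci * z / 2) with (- (Ci * (z / 2))) by field.
        match goal with |- context [- - ?x] => replace (- - x) with x by ring end.
        f_equal. apply Cplus_comm. }
    replace (Ccosh (- Ci * z)) with (Ccos z).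
    2:{ unfold Ccosh, Ccos. replace (- Ci * z) with (- (Ci * z)) by field.
        match goal with |- context [- - ?x] => replace (- - x) with x by ring end.
        f_equal. apply Cplus_comm. }
    replace (- (- (Ci * tau) * z)) with (Ci * tau * z) by ring.
    replace (- (2 * (- (Ci * tau) * z))) with (2 * Ci * tau * z) by ring. reflexivity.
Qed.

Lemma exp_inv_8 : (exp (/ 8) <= 2)%R.
Proof.
  assert (E := exp_ineq1_le (- / 8)). assert (E' : (exp (/ 8) * exp (- / 8) = 1)%R)
    by (rewrite <- exp_plus, Rplus_opp_r; apply exp_0).
  nra.
Qed.

(** e^z - 1 - z is the integral of z (e^(z t) - 1) over [0, 1]; for |z| <= 1/8 the bracket is at
    most 2 . (1/8) . 2 = 1/2. *)
Lemma Cexp_minus_1_lower (z : C) : (Cmod z <= / 8)%R -> (Cmod z / 2 <= Cmod (Cexp z - 1))%R.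
Proof.
  intros Hz. assert (Pz := Cmod_ge_0 z).
  assert (I1 : is_CInt (fun t => z * Cexp (z * RtoC t)) 0 1 (Cexp (z * RtoC 1) - Cexp (z * RtoC 0))).
  { apply (is_CInt_derive (fun t => Cexp (z * RtoC t))).
    - intros t _. eapply is_Cderive_eq; [apply is_Cderive_exp, is_Cderive_linear|cbv beta; ring].
    - intros t _. apply continuous_Cmult; [apply continuous_const|].
      apply continuous_Cexp, continuous_Cmult; [apply continuous_const|apply continuous_RtoC, continuous_id]. }
  assert (I2 : is_CInt (fun _ => z) 0 1 (z * RtoC 1 - z * RtoC 0)).
  { apply (is_CInt_derive (fun t => z * RtoC t)); intros t _; [apply is_Cderive_linear|apply continuous_const]. }
  assert (I3 := is_CInt_minus _ _ _ _ _ _ I1 I2).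
  assert (B : (Cmod (Cexp (z * RtoC 1) - Cexp (z * RtoC 0) - (z * RtoC 1 - z * RtoC 0)) <= (1 - 0) * (Cmod z / 2))%R).
  { refine (is_CInt_bound_const _ 0 1 _ _ _ _ I3); [lra|]. intros t Ht. cbv beta.
    replace (z * Cexp (z * t) - z) with (z * (Cexp (z * t) - 1)) by ring.
    rewrite Cmod_mult. apply Rmult_le_compat_l; [exact Pz|].
    eapply Rle_trans; [apply Cmod_exp_minus_1|].
    assert (Em : (Cmod (z * t) <= / 8)%R).
    { rewrite Cmod_mult, Cmod_R, Rabs_pos_eq by lra. nra. }
    assert (Q := Cmod_ge_0 (z * t)).
    assert (E2 : (exp (Cmod (z * t)) <= 2)%R).
    { apply Rle_trans with (exp (/ 8)); [apply exp_le, Em|apply exp_inv_8]. }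
    nra. }
  rewrite Cmult_1_r, Cmult_0_r, Cexp_0 in B.
  replace (Cexp z - 1 - (z - 0)) with ((Cexp z - 1) - z) in B by ring.
  rewrite Cmod_minus_sym in B. assert (T := Cmod_triangle_minus z (Cexp z - 1)). lra.
Qed.

(** The double pole, estimated in all directions: the two factors of the denominator are at least c1
    |z| / 2 and c2 |z| / 2, the numerator at most 2. The radius keeps all three exponents within
    1/8. *)
Lemma kern_near_0 (al be : C) : al - be <> 0 -> al + be <> 0 -> exists r0 K : R, (0 < r0)%R /\ (0 <= K)%R /\
  forall z : C, z <> 0 -> (Cmod z <= r0)%R -> (Cmod (kern al be z) <= K / (Cmod z * Cmod z))%R.
Proof.
  intros H1 H2. assert (P1 := proj1 (Cmod_gt_0 _) H1). assert (P2 := proj1 (Cmod_gt_0 _) H2).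
  set (c1 := Cmod (al - be)) in *. set (c2 := Cmod (al + be)) in *. assert (P3 := Cmod_ge_0 al).
  set (c := (c1 + c2 + Cmod al)%R).
  exists (/ (8 * c))%R, (8 / (c1 * c2))%R. assert (Pc : (0 < c)%R) by (unfold c; lra).
  split; [apply Rinv_0_lt_compat; lra|]. split; [left; apply Rdiv_lt_0_compat; nra|].
  intros z Hz0 Hz. assert (Pz := proj1 (Cmod_gt_0 _) Hz0).
  assert (Hc : (c * Cmod z <= / 8)%R).
  { apply (Rmult_le_compat_l c) in Hz; [|lra]. replace (c * / (8 * c))%R with (/ 8)%R in Hz by (field; lra). exact Hz. }
  assert (B1 : (Cmod (- ((al - be) * z)) <= / 8)%R) by (rewrite Cmod_opp, Cmod_mult; fold c1; unfold c in Hc; nra).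
  assert (B2 : (Cmod (- ((al + be) * z)) <= / 8)%R) by (rewrite Cmod_opp, Cmod_mult; fold c2; unfold c in Hc; nra).
  assert (B3 : (Cmod (- (al * z)) <= / 8)%R) by (rewrite Cmod_opp, Cmod_mult; unfold c in Hc; nra).
  assert (Ex : forall x, (Cmod x <= / 8 -> Cmod (Cexp x) <= 2)%R).
  { intros x Hx. rewrite Cmod_Cexp. apply Rle_trans with (exp (/ 8)).
    - apply exp_le. eapply Rle_trans; [apply Rle_abs|]. eapply Rle_trans; [apply re_le_Cmod|exact Hx].
    - apply exp_inv_8. }
  assert (L1 := Cexp_minus_1_lower _ B1). assert (L2 := Cexp_minus_1_lower _ B2).
  rewrite Cmod_opp, Cmod_mult in L1, L2. fold c1 in L1. fold c2 in L2. rewrite Cmod_minus_sym in L1, L2.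
  assert (N1 : 1 - Cexp (- ((al - be) * z)) <> 0) by (apply Cmod_gt_0; nra).
  assert (N2 : 1 - Cexp (- ((al + be) * z)) <> 0) by (apply Cmod_gt_0; nra).
  unfold kern, kden. rewrite Cmod_div by (apply Cmult_neq_0; assumption). rewrite Cmod_mult.
  assert (Hn := Cmod_knum _ _ _ _ (Ex _ B1) (Ex _ B2) (Ex _ B3)).
  replace (8 / (c1 * c2) / (Cmod z * Cmod z))%R with (2 * / ((c1 * Cmod z / 2) * (c2 * Cmod z / 2)))%R
    by (field; repeat split; lra).
  apply Rmult_le_compat; [apply Cmod_ge_0| |exact Hn|].
  - left. apply Rinv_0_lt_compat, Rmult_lt_0_compat; apply Cmod_gt_0; assumption.
  - apply Rinv_le_contravar.
    + assert (0 < c1 * Cmod z)%R by nra. assert (0 < c2 * Cmod z)%R by nra. nra.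
    + apply Rmult_le_compat; try assumption; nra.
Qed.

(** In a strip of half-width y the imaginary parts cost at most a factor e^m. From (m + 1) / d on,
    each exponential is at most e^(-1) <= 1/2, so the denominator is at least 1/4. *)
Lemma kern_far (al be : C) (y : R) : (Rabs (Re be) < Re al)%R -> exists K T0 : R, (0 <= K)%R /\
  forall T k, (T0 <= T)%R -> (Rabs k <= y)%R ->
    (Cmod (kern al be (T, k)) <= K * exp (- ((Re al - Rabs (Re be)) * T)))%R.
Proof.
  intros Hc. set (d := (Re al - Rabs (Re be))%R). assert (Hd : (0 < d)%R) by (unfold d; lra).
  set (m := ((Rabs (Im al) + Rabs (Im be)) * y)%R).
  exists (4 * exp m)%R, (Rmax 0 ((m + 1) / d)). split; [generalize (exp_pos m); lra|].
  intros T k HT Hk. assert (M1 := Rmax_l 0 ((m + 1) / d)). assert (M2 := Rmax_r 0 ((m + 1) / d)).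
  assert (Hd1 : (m + 1 <= d * T)%R).
  { assert (Q : ((m + 1) / d <= T)%R) by lra. apply (Rmult_le_compat_l d) in Q; [|lra].
    replace (d * ((m + 1) / d))%R with (m + 1)%R in Q by (field; lra). exact Q. }
  assert (G : forall c : C, (d <= Re c)%R -> (Rabs (Im c) <= Rabs (Im al) + Rabs (Im be))%R ->
     (Cmod (Cexp (- (c * (T, k)))) <= exp m * exp (- (d * T)))%R).
  { intros c Hc1 Hc2. rewrite Cmod_Cexp, <- exp_plus. apply exp_le.
    replace (Re (- (c * (T, k)))) with (- (Re c * T) + Im c * k)%R by (unfold Re, Im; simpl; ring).
    assert (Im c * k <= m)%R.
    { eapply Rle_trans; [apply Rle_abs|]. rewrite Rabs_mult. unfold m.
      apply Rmult_le_compat; try apply Rabs_pos; assumption. }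
    nra. }
  assert (A := Rle_abs (Re be)). assert (A' := Rcomplements.Rabs_maj2 (Re be)).
  assert (G1 := G (al - be)). assert (G2 := G (al + be)). assert (G3 := G al).
  specialize (G1 ltac:(unfold d, Re in *; simpl; lra)).
  specialize (G2 ltac:(unfold d, Re in *; simpl; lra)).
  specialize (G3 ltac:(unfold d, Re in *; simpl; lra)).
  assert (Ia := Rabs_pos (Im be)).
  specialize (G1 ltac:(change (Im (al - be)) with (Im al + - Im be)%R;
     eapply Rle_trans; [apply Rabs_triang|rewrite Rabs_Ropp; lra])).
  specialize (G2 ltac:(change (Im (al + be)) with (Im al + Im be)%R; apply Rabs_triang)).
  specialize (G3 ltac:(lra)).
  set (x := (exp m * exp (- (d * T)))%R) in *.
  assert (Hx : (x <= / 2)%R).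
  { unfold x. rewrite <- exp_plus. apply Rle_trans with (exp (Ropp 1)); [apply exp_le; lra|].
    rewrite exp_Ropp. apply Rinv_le_contravar; [lra|]. generalize (exp_ineq1_le 1). lra. }
  unfold kern, kden.
  set (a := Cexp (- ((al - be) * (T, k)))) in *. set (b := Cexp (- ((al + be) * (T, k)))) in *.
  assert (Aa : (/ 2 <= Cmod (1 - a))%R).
  { assert (Q := Cmod_triangle_minus 1 a). rewrite Cmod_1 in Q. lra. }
  assert (Ab : (/ 2 <= Cmod (1 - b))%R).
  { assert (Q := Cmod_triangle_minus 1 b). rewrite Cmod_1 in Q. lra. }
  assert (Na : 1 - a <> 0) by (apply Cmod_gt_0; lra).
  assert (Nb : 1 - b <> 0) by (apply Cmod_gt_0; lra).
  rewrite Cmod_div by (apply Cmult_neq_0; assumption). rewrite Cmod_mult.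
  replace (4 * exp m * exp (- (d * T)))%R with (x * / (/ 2 * / 2))%R by (unfold x; field).
  apply Rmult_le_compat.
  - apply Cmod_ge_0.
  - left. apply Rinv_0_lt_compat, Rmult_lt_0_compat; lra.
  - apply Cmod_knum; assumption.
  - apply Rinv_le_contravar; [lra|]. apply Rmult_le_compat; lra.
Qed.

Lemma kden_zero (al be z : C) : kden al be z = 0 -> exists k : Z,
  (al - be) * z = RtoC (2 * IZR k * PI) * Ci \/ (al + be) * z = RtoC (2 * IZR k * PI) * Ci.
Proof.
  intros H. unfold kden in H.
  assert (K : forall x, 1 - Cexp (- x) = 0 -> exists k : Z, x = RtoC (2 * IZR k * PI) * Ci).
  { intros x Hx. assert (E : Cexp (- x) = 1).
    { replace (Cexp (- x)) with (1 - (1 - Cexp (- x))) by ring. rewrite Hx. ring. }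
    apply Cexp_eq_1 in E. destruct E as [k Hk]. exists (- k)%Z.
    replace x with (- - x) by ring. rewrite Hk, opp_IZR.
    replace (2 * - IZR k * PI)%R with (- (2 * IZR k * PI))%R by ring. rewrite RtoC_opp. ring. }
  destruct (Ceq_dec (1 - Cexp (- ((al - be) * z))) 0) as [E|E].
  - destruct (K _ E) as [k Hk]. exists k. left. exact Hk.
  - assert (E' : 1 - Cexp (- ((al + be) * z)) = 0).
    { set (u := 1 - Cexp (- ((al - be) * z))) in *. set (v := 1 - Cexp (- ((al + be) * z))) in *.
      replace v with (/ u * (u * v)) by (field; exact E). rewrite H. ring. }
    destruct (K _ E') as [k Hk]. exists k. right. exact Hk.
Qed.

Lemma is_Cderive_Clog (g : R -> C) (t : R) (g' : C) : (0 < Re (g t))%R -> is_Cderive g t g' ->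
  is_Cderive (fun u => Clog (g u)) t (g' / g t).
Proof.
  intros Hp Hg. assert (A := is_Cderive_Re _ _ _ Hg). assert (B := is_Cderive_Im _ _ _ Hg).
  assert (D0 : (0 < Re (g t) * Re (g t) + Im (g t) * Im (g t))%R) by nra.
  assert (D : is_derive (fun u => Re (g u) * Re (g u) + Im (g u) * Im (g u))%R t
     (2 * (Re (g t) * Re g' + Im (g t) * Im g'))%R).
  { eapply is_derive_eq.
    - apply is_derive_Rplus; apply is_derive_Rmult; eassumption.
    - cbv beta. ring. }
  apply is_Cderive_pair; unfold Clog; cbn [Re Im fst snd].
  - apply (is_derive_ext (fun u => ln (sqrt (Re (g u) * Re (g u) + Im (g u) * Im (g u)))%R)).
    { intros u. unfold Cmod, Re, Im. f_equal. f_equal. ring. }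
    eapply is_derive_eq.
    + apply (is_derive_comp_R ln (fun u => sqrt (Re (g u) * Re (g u) + Im (g u) * Im (g u)))%R).
      * apply is_derive_ln. apply sqrt_lt_R0. exact D0.
      * exact (is_derive_sqrt (fun u => Re (g u) * Re (g u) + Im (g u) * Im (g u))%R t _ D D0).
    + set (q := (Re (g t) * Re (g t) + Im (g t) * Im (g t))%R) in *.
      assert (Sq := sqrt_lt_R0 _ D0). assert (SS := sqrt_sqrt q ltac:(lra)).
      replace (/ sqrt q * (2 * (Re (g t) * Re g' + Im (g t) * Im g') / (2 * sqrt q)))%R
        with ((Re (g t) * Re g' + Im (g t) * Im g') / (sqrt q * sqrt q))%R by (field; lra).
      rewrite SS. unfold q in *. destruct (g t) as [a b], g' as [a' b']. unfold Re, Im in *; simpl in *. field.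
      nra.
  - eapply is_derive_eq.
    + apply (is_derive_comp_R atan (fun u => Im (g u) / Re (g u))%R).
      * apply is_derive_atan.
      * apply (is_derive_div (fun u => Im (g u)) (fun u => Re (g u))); [exact B|exact A|lra].
    + destruct (g t) as [a b], g' as [a' b']. unfold Re, Im in *; simpl in *. unfold Rsqr. field.
      split; nra.
Qed.

(** * Evaluation of the contour integral *)

Lemma neq0_open (f : C -> C) (z : C) : Ccontinuous f z -> f z <> 0 ->
  @locally C_UniformSpace z (fun w => f w <> 0).
Proof.
  intros Hf H0. assert (Hm := continuous_Cmod f z Hf).
  assert (P := proj1 (Cmod_gt_0 _) H0).
  assert (L := Hm (fun x => (0 < x)%R) (open_gt 0 _ P)).
  unfold filtermap in L. revert L. apply filter_imp. intros w Hw. apply Cmod_gt_0. exact Hw.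
Qed.

Lemma hol_kexp (nonsingular : C -> Prop) (c : C) : hol nonsingular (fun w => Cexp (- (c * Cexp w))).
Proof. apply hol_exp, hol_opp, hol_mult; [apply hol_const|apply hol_exp, hol_id]. Qed.

Lemma hol_kden (nonsingular : C -> Prop) (al be : C) : hol nonsingular (fun w => kden al be (Cexp w)).
Proof.
  unfold kden. apply (hol_mult nonsingular (fun w => 1 - Cexp (- ((al - be) * Cexp w))) (fun w => 1 - Cexp (- ((al + be) * Cexp w))));
  (apply hol_minus; [apply hol_const|apply hol_kexp]).
Qed.

Lemma hol_kern (nonsingular : C -> Prop) (al be : C) : (forall w, nonsingular w -> kden al be (Cexp w) <> 0) ->
  hol nonsingular (fun w => kern al be (Cexp w)).
Proof.
  intros H. unfold kern. apply (hol_div nonsingular (fun w => knum al be (Cexp w)) (fun w => kden al be (Cexp w))).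
  - exact H.
  - unfold knum. apply (hol_mult nonsingular _ (fun _ => / 4)); [|apply hol_const].
    apply (hol_plus nonsingular (fun w => Cexp (- ((al - be) * Cexp w)) + Cexp (- ((al + be) * Cexp w))) (fun w => 2 * Cexp (- (al * Cexp w)))).
    + apply (hol_plus nonsingular (fun w => Cexp (- ((al - be) * Cexp w)))); apply hol_kexp.
    + apply (hol_mult nonsingular (fun _ => 2)); [apply hol_const|apply hol_kexp].
  - apply hol_kden.
Qed.

Lemma is_RInt_gen_to_infty (f : R -> C) (a : R) (g : R -> C) (l : C) :
  (forall T, (a <= T)%R -> is_CInt f a T (g T)) ->
  (forall eps, (0 < eps)%R -> exists T0, forall T, (T0 <= T)%R -> (Cmod (g T - l) < eps)%R) ->
  @is_RInt_gen C_R_NormedModule f (at_point a) (Rbar_locally p_infty) l.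
Proof.
  intros Hi Hl P [eps HP]. destruct (Hl eps (cond_pos eps)) as [T0 HT0].
  exists (fun x => x = a) (fun x => (Rmax a T0 < x)%R).
  - reflexivity.
  - exists (Rmax a T0). intros x Hx. exact Hx.
  - intros x T -> HT. simpl. assert (M1 := Rmax_l a T0). assert (M2 := Rmax_r a T0).
    exists (g T). split; [apply Hi; lra|]. apply HP. apply Cmod_ball. apply HT0. lra.
Qed.

Section Contour.
Variables (tau s : C) (r y : R).
Hypothesis Hre : (- (1 / 2) < Re tau <= 1 / 2)%R.
Hypothesis Him : (0 < Im tau)%R.
Hypothesis Hy : (0 < y)%R.
Hypothesis Hyr : (y < r)%R.
Hypothesis Hencl : forall z : C, sing tau z -> ~ enclosed r y z.
Hypothesis Hs : (2 < Re s)%R.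

Let a2 := - (Ci * tau).
Let b2 := - Ci.

Definition nonsingular (w : C) : Prop := kden 1 tau (Cexp w) <> 0 /\ kden a2 b2 (Cexp w) <> 0.
(** The exponential is e^(s w) and not e^((s - 1) w) because dz = e^w dw is included. As a function
    of w it has no branch. *)
Definition log_integrand (w : C) : C := Cexp (s * w) * F tau s (Cexp w).

Lemma cone1 : (Rabs (Re tau) < Re 1)%R.
Proof. simpl. apply Rabs_def1; lra. Qed.

Lemma cone2 : (Rabs (Re b2) < Re a2)%R.
Proof. unfold a2, b2, Re, Im in *. simpl. rewrite Ropp_0, Rabs_R0. lra. Qed.

Lemma dirs_nz : 1 - tau <> 0 /\ 1 + tau <> 0.
Proof. split; intros E; apply (f_equal Im) in E; unfold Im in *; simpl in E; lra. Qed.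

(** The sign of k and its absolute value provide the sign and the positive integer of [sing]; z <> 0
    excludes k = 0. *)
Lemma sing_of_eq (z : C) (e' : R) (k : Z) : (e' = 1 \/ e' = -1)%R -> z <> 0 ->
  ((1 + RtoC e' * tau) * z = RtoC (2 * IZR k * PI) * Ci \/ (1 + RtoC e' * tau) * z = RtoC (2 * IZR k * PI)) ->
  sing tau z.
Proof.
  intros He' Hz H.
  assert (N : 1 + RtoC e' * tau <> 0).
  { destruct dirs_nz as [N1 N2]. destruct He' as [-> | ->]; intros E; [apply N2|apply N1]; rewrite <- E;
    rewrite ?RtoC_opp; ring. }
  assert (Hk : k <> 0%Z).
  { intros ->. assert (E : (1 + RtoC e' * tau) * z = 0).
    { destruct H as [H|H]; rewrite H; replace (2 * 0 * PI)%R with 0%R by ring; ring. }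
    apply Hz. replace z with (/ (1 + RtoC e' * tau) * ((1 + RtoC e' * tau) * z)) by (field; exact N).
    rewrite E. ring. }
  exists (Z.abs_nat k), (IZR (Z.sgn k)), e'. split; [lia|]. split.
  { destruct k; [lia|left; reflexivity|right; reflexivity]. }
  split; [exact He'|].
  assert (Ek : (IZR (Z.sgn k) * INR (Z.abs_nat k) = IZR k)%R).
  { rewrite INR_IZR_INZ, <- mult_IZR. f_equal. lia. }
  assert (Ez : z = / (1 + RtoC e' * tau) * ((1 + RtoC e' * tau) * z)) by (field; exact N).
  destruct H as [H|H]; [left|right]; rewrite Ez, H, <- Ek; rewrite !RtoC_mult; field; exact N.
Qed.

(** Since a2 - b2 = i (1 - tau) and a2 + b2 = -i (1 + tau), the zeros of the second denominator are
    those of the first turned by a right angle; these are the two families of [sing]. *)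
Lemma enclosed_nonsingular (w : C) : enclosed r y (Cexp w) -> nonsingular w.
Proof.
  intros He. assert (Hz := Cexp_nz w). set (z := Cexp w) in *.
  assert (NS : ~ sing tau z) by (intros S; exact (Hencl z S He)).
  assert (M1 : RtoC (-1) = - (1)) by (rewrite <- RtoC_opp; f_equal; lra).
  split; fold z; intros E; apply kden_zero in E; destruct E as [k [E|E]]; apply NS.
  - apply (sing_of_eq z (-1) k); [right; reflexivity|exact Hz|]. left. rewrite <- E, M1. ring.
  - apply (sing_of_eq z 1 k); [left; reflexivity|exact Hz|]. left. rewrite <- E. ring.
  - apply (sing_of_eq z (-1) k); [right; reflexivity|exact Hz|]. right. rewrite M1.
    transitivity (- (Ci * ((a2 - b2) * z))); [unfold a2, b2; transitivity (- (Ci * Ci) * ((1 - tau) * z)); [rewrite Ci_sqr; ring|ring]|].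
    rewrite E. transitivity (- (Ci * Ci) * RtoC (2 * IZR k * PI)); [ring|rewrite Ci_sqr; ring].
  - apply (sing_of_eq z 1 (- k)); [left; reflexivity|exact Hz|]. right.
    transitivity (Ci * ((a2 + b2) * z)); [unfold a2, b2; transitivity (- (Ci * Ci) * ((1 + tau) * z)); [rewrite Ci_sqr; ring|ring]|].
    rewrite E, opp_IZR. replace (2 * - IZR k * PI)%R with (- (2 * IZR k * PI))%R by ring. rewrite RtoC_opp.
    transitivity ((Ci * Ci) * RtoC (2 * IZR k * PI)); [ring|rewrite Ci_sqr; ring].
Qed.

Lemma enclosed_star (w : C) (v : R) : (v <= 0)%R -> enclosed r y (Cexp w) -> enclosed r y (Cexp (w + RtoC v)).
Proof.
  intros Hv He. rewrite Cexp_add, Cexp_RtoC.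
  assert (P := exp_pos v). assert (P1 : (exp v <= 1)%R) by (rewrite <- exp_0; apply exp_le, Hv).
  destruct He as [He|[H1 H2]].
  - left. rewrite Cmod_mult, Cmod_R, Rabs_pos_eq by lra. generalize (Cmod_ge_0 (Cexp w)). nra.
  - right. set (z := Cexp w) in *.
    replace (Re (z * RtoC (exp v))) with (Re z * exp v)%R by (unfold Re; simpl; ring).
    replace (Im (z * RtoC (exp v))) with (Im z * exp v)%R by (unfold Im; simpl; ring).
    rewrite Rabs_mult, (Rabs_pos_eq (exp v)) by lra. generalize (Rabs_pos (Im z)). nra.
Qed.

Lemma enclosed_nonsingular_star (w : C) : enclosed r y (Cexp w) -> forall v, (v <= 0)%R -> nonsingular (w + RtoC v).
Proof. intros He v Hv. apply enclosed_nonsingular, enclosed_star; assumption. Qed.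

Lemma nonsingular_open (z : C) : nonsingular z -> @locally C_UniformSpace z nonsingular.
Proof.
  intros [H1 H2]. apply filter_and.
  - destruct (hol_kden (fun _ => True) 1 tau) as [? [Hc _]].
    apply (neq0_open (fun w => kden 1 tau (Cexp w))); [apply Hc; trivial|exact H1].
  - destruct (hol_kden (fun _ => True) a2 b2) as [? [Hc _]].
    apply (neq0_open (fun w => kden a2 b2 (Cexp w))); [apply Hc; trivial|exact H2].
Qed.

Lemma log_integrand_hol : hol nonsingular log_integrand.
Proof.
  unfold log_integrand. apply (hol_mult nonsingular (fun w => Cexp (s * w)) (fun w => F tau s (Cexp w))).
  - apply hol_exp, hol_mult; [apply hol_const|apply hol_id].
  - apply (hol_ext nonsingular (fun w => Cexp (- (Ci * s * RtoC PI / 2)) * kern 1 tau (Cexp w) + kern a2 b2 (Cexp w))).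
    { intros w. symmetry. apply F_kern. }
    apply (hol_plus nonsingular (fun w => Cexp (- (Ci * s * RtoC PI / 2)) * kern 1 tau (Cexp w))).
    + apply (hol_mult nonsingular (fun _ => Cexp (- (Ci * s * RtoC PI / 2)))); [apply hol_const|].
      apply hol_kern. intros w H; apply H.
    + apply hol_kern. intros w H; apply H.
Qed.

Lemma log_integrand_decay (B : R) : exists U K q : R, (0 < q)%R /\ forall z : C,
  (Re z <= U)%R -> (Rabs (Im z) <= B)%R -> (Cmod (log_integrand z) <= K * exp (q * Re z))%R.
Proof.
  destruct dirs_nz as [D1 D2].
  destruct (kern_near_0 1 tau D1 D2) as [r1 [K1 [Pr1 [PK1 H1]]]].
  assert (E1 : a2 - b2 <> 0).
  { intros E. apply D1. transitivity (- (Ci * (a2 - b2))); [|rewrite E; ring].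
    unfold a2, b2. transitivity (- (Ci * Ci) * (1 - tau)); [rewrite Ci_sqr; ring|ring]. }
  assert (E2 : a2 + b2 <> 0).
  { intros E. apply D2. transitivity (Ci * (a2 + b2)); [|rewrite E; ring].
    unfold a2, b2. transitivity (- (Ci * Ci) * (1 + tau)); [rewrite Ci_sqr; ring|ring]. }
  destruct (kern_near_0 a2 b2 E1 E2) as [r2 [K2 [Pr2 [PK2 H2]]]].
  set (e0 := Cmod (Cexp (- (Ci * s * RtoC PI / 2)))).
  exists (Rmin (ln r1) (ln r2)), (exp (Rabs (Im s) * B) * (e0 * K1 + K2))%R, (Re s - 2)%R.
  split; [lra|]. intros z Hz HB.
  assert (M1 := Rmin_l (ln r1) (ln r2)). assert (M2 := Rmin_r (ln r1) (ln r2)).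
  assert (Hz1 : (Cmod (Cexp z) <= r1)%R).
  { rewrite Cmod_Cexp, <- (exp_ln r1) by exact Pr1. apply exp_le. lra. }
  assert (Hz2 : (Cmod (Cexp z) <= r2)%R).
  { rewrite Cmod_Cexp, <- (exp_ln r2) by exact Pr2. apply exp_le. lra. }
  specialize (H1 _ (Cexp_nz z) Hz1). specialize (H2 _ (Cexp_nz z) Hz2).
  rewrite Cmod_Cexp in H1, H2. set (x := exp (Re z)) in *. assert (Px : (0 < x)%R) by apply exp_pos.
  unfold log_integrand. rewrite Cmod_mult, Cmod_Cexp, F_kern.
  assert (He0 : (0 <= e0)%R) by apply Cmod_ge_0.
  assert (T := Cmod_triangle (Cexp (- (Ci * s * RtoC PI / 2)) * kern 1 tau (Cexp z)) (kern a2 b2 (Cexp z))).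
  rewrite (Cmod_mult (Cexp (- (Ci * s * RtoC PI / 2)))) in T. fold e0 in T.
  apply Rle_trans with ((exp (Rabs (Im s) * B) * exp (Re s * Re z)) * ((e0 * K1 + K2) / (x * x)))%R.
  - apply Rmult_le_compat; [left; apply exp_pos|apply Cmod_ge_0| |].
    + rewrite <- exp_plus. apply exp_le.
      replace (Re (s * z)) with (Re s * Re z + - (Im s * Im z))%R by (unfold Re, Im; simpl; ring).
      assert (Q := Rle_abs (- (Im s * Im z))). rewrite Rabs_Ropp, Rabs_mult in Q.
      assert (Q2 := Rmult_le_compat_l _ _ _ (Rabs_pos (Im s)) HB). lra.
    + eapply Rle_trans; [exact T|].
      replace ((e0 * K1 + K2) / (x * x))%R with (e0 * (K1 / (x * x)) + K2 / (x * x))%R by (field; lra).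
      apply Rplus_le_compat; [|exact H2]. apply Rmult_le_compat_l; assumption.
  - right. replace ((Re s - 2) * Re z)%R with (Re s * Re z + (- Re z + - Re z))%R by ring.
    rewrite !exp_plus, (exp_Ropp (Re z)). fold x. field. lra.
Qed.

Lemma hprim_exists (w : C) : enclosed r y (Cexp w) -> exists l, is_prim log_integrand w l.
Proof.
  intros He. apply (is_prim_exists nonsingular log_integrand log_integrand_hol log_integrand_decay). apply enclosed_nonsingular_star, He.
Qed.

Lemma hpath (w w' : R -> C) (a b : R) (la lb : C) :
  (a <= b)%R ->
  (forall t, (a <= t <= b)%R -> locally t (fun u => is_Cderive w u (w' u))) ->
  (forall t, (a <= t <= b)%R -> Ccontinuous w' t) ->
  (forall t, (a <= t <= b)%R -> enclosed r y (Cexp (w t))) ->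
  is_prim log_integrand (w a) la -> is_prim log_integrand (w b) lb ->
  is_CInt (fun t => log_integrand (w t) * w' t) a b (lb - la).
Proof.
  intros Hab H1 H2 H3 Ha Hb.
  apply (path_integral nonsingular log_integrand nonsingular_open log_integrand_hol log_integrand_decay); try assumption.
  intros t Ht. apply enclosed_nonsingular_star, H3, Ht.
Qed.

(** Monodromy of z^s around 0. *)
Definition mono : C := Cexp (s * (Ci * RtoC (2 * PI))).

Lemma Cexp_turn (w : C) : Cexp (w + Ci * RtoC (2 * PI)) = Cexp w.
Proof.
  replace (2 * PI)%R with (2 * IZR 1 * PI)%R by ring. apply Cexp_period.
Qed.

Lemma log_integrand_mono (w : C) : log_integrand (w + Ci * RtoC (2 * PI)) = mono * log_integrand w.
Proof.
  unfold log_integrand, mono. rewrite Cexp_turn, Cmult_plus_distr_l, Cexp_add. ring.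
Qed.

(** One turn around 0 multiplies the primitive by [mono] without additive constant, because it is
    normalised at the left end, that is, at z = 0. *)
Lemma hprim_mono (w l : C) : enclosed r y (Cexp w) -> is_prim log_integrand w l ->
  is_prim log_integrand (w + Ci * RtoC (2 * PI)) (mono * l).
Proof.
  intros He Hl. unfold is_prim.
  apply (Clim_ext (fun N => mono * leftprim log_integrand (INR N) w)); [|apply Clim_mult_const, Hl].
  intros n. symmetry. unfold leftprim. apply CInt_unique.
  apply (is_CInt_ext (fun v => mono * log_integrand (w + RtoC v))).
  { intros t _. rewrite <- log_integrand_mono. f_equal. ring. }
  apply is_CInt_mult. apply CInt_correct. rewrite Rmin_left, Rmax_right by (generalize (pos_INR n); lra).
  intros t Ht. apply (h_line_continuous nonsingular log_integrand log_integrand_hol). apply enclosed_nonsingular_star; [exact He|lra].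
Qed.

Lemma strip_enclosed (T k : R) : (0 <= T)%R -> (Rabs k <= y)%R -> enclosed r y (T, k).
Proof. intros HT Hk. right. split; assumption. Qed.

Variable X : C.
Hypothesis HX : is_CR (fun u => log_integrand (RtoC u)) X.

Lemma real_nonsingular (u : R) : nonsingular (RtoC u).
Proof.
  apply enclosed_nonsingular. rewrite Cexp_RtoC. apply strip_enclosed; [left; apply exp_pos|].
  rewrite Rabs_R0. lra.
Qed.

Lemma log_integrand_real_cont : Ccont (fun u => log_integrand (RtoC u)).
Proof.
  intros u. apply (continuous_C_comp log_integrand RtoC); [apply continuous_RtoC, continuous_id|].
  apply (hol_continuous nonsingular log_integrand log_integrand_hol). apply real_nonsingular.
Qed.

(** For T >= y one has |T + i k| <= 2 T, which explains ln 2; the argument is at most pi/2 <= 2. *)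
Lemma log_integrand_far : exists K T0 d : R, (0 < d)%R /\ (0 <= K)%R /\ forall T k, (T0 <= T)%R -> (Rabs k <= y)%R ->
  (Cmod (log_integrand (Clog (T, k))) <= K * exp (Re s * ln T - d * T))%R.
Proof.
  destruct (kern_far 1 tau y cone1) as [K1 [T1 [P1 H1]]].
  destruct (kern_far a2 b2 y cone2) as [K2 [T2 [P2 H2]]].
  set (d1 := (Re 1 - Rabs (Re tau))%R) in *. set (d2 := (Re a2 - Rabs (Re b2))%R) in *.
  assert (D1 : (0 < d1)%R) by (unfold d1; generalize cone1; lra).
  assert (D2 : (0 < d2)%R) by (unfold d2; generalize cone2; lra).
  set (d := Rmin d1 d2). assert (Hd : (0 < d)%R) by (apply Rmin_pos; assumption).
  assert (M1 := Rmin_l d1 d2). assert (M2 := Rmin_r d1 d2). fold d in M1, M2.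
  set (e0 := Cmod (Cexp (- (Ci * s * RtoC PI / 2)))). assert (He0 : (0 <= e0)%R) by apply Cmod_ge_0.
  exists (exp (Re s * ln 2 + Rabs (Im s) * 2) * (e0 * K1 + K2))%R, (Rmax (Rmax T1 T2) (Rmax 1 y)), d.
  split; [exact Hd|]. split.
  { apply Rmult_le_pos; [left; apply exp_pos|]. assert (0 <= e0 * K1)%R by (apply Rmult_le_pos; assumption). lra. }
  intros T k HT Hk.
  assert (Q1 := Rmax_l (Rmax T1 T2) (Rmax 1 y)). assert (Q2 := Rmax_r (Rmax T1 T2) (Rmax 1 y)).
  assert (Q3 := Rmax_l T1 T2). assert (Q4 := Rmax_r T1 T2). assert (Q6 := Rmax_r 1 y).
  assert (PT : (0 < T)%R) by lra.
  unfold log_integrand. rewrite Cexp_Clog by exact PT. rewrite Cmod_mult, Cmod_Cexp, F_kern.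
  specialize (H1 T k ltac:(lra) Hk). specialize (H2 T k ltac:(lra) Hk).
  assert (T3 := Cmod_triangle (Cexp (- (Ci * s * RtoC PI / 2)) * kern 1 tau (T, k)) (kern a2 b2 (T, k))).
  rewrite (Cmod_mult (Cexp (- (Ci * s * RtoC PI / 2)))) in T3. fold e0 in T3.
  assert (B1 : (exp (- (d1 * T)) <= exp (- (d * T)))%R) by (apply exp_le; nra).
  assert (B2 : (exp (- (d2 * T)) <= exp (- (d * T)))%R) by (apply exp_le; nra).
  assert (B3 : (Cmod (Cexp (- (Ci * s * RtoC PI / 2)) * kern 1 tau (T, k) + kern a2 b2 (T, k))
     <= (e0 * K1 + K2) * exp (- (d * T)))%R).
  { eapply Rle_trans; [exact T3|]. rewrite Rmult_plus_distr_r. apply Rplus_le_compat.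
    - rewrite Rmult_assoc. apply Rmult_le_compat_l; [exact He0|]. eapply Rle_trans; [exact H1|].
      apply Rmult_le_compat_l; assumption.
    - eapply Rle_trans; [exact H2|]. apply Rmult_le_compat_l; assumption. }
  assert (B4 : (exp (Re (s * Clog (T, k))) <= exp (Re s * ln 2 + Rabs (Im s) * 2) * exp (Re s * ln T))%R).
  { rewrite <- exp_plus. apply exp_le.
    replace (Re (s * Clog (T, k))) with (Re s * ln (Cmod (T, k)) + - (Im s * Im (Clog (T, k))))%R
      by (unfold Re, Im; simpl; ring).
    assert (L : (ln (Cmod (T, k)) <= ln 2 + ln T)%R).
    { rewrite <- ln_mult by lra. apply Rcomplements.ln_le.
      - apply Cmod_gt_0. intros E. apply (f_equal Re) in E. simpl in E. lra.
      - eapply Rle_trans; [apply Cmod_le_abs|]. simpl. rewrite (Rabs_pos_eq T) by lra. lra. }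
    assert (A : (- (Im s * Im (Clog (T, k))) <= Rabs (Im s) * 2)%R).
    { eapply Rle_trans; [apply Rle_abs|]. rewrite Rabs_Ropp, Rabs_mult.
      apply Rmult_le_compat_l; [apply Rabs_pos|].
      assert (Q := Clog_bound (T, k)). assert (P := PI_4). apply Rabs_le. lra. }
    nra. }
  eapply Rle_trans; [apply Rmult_le_compat; [left; apply exp_pos|apply Cmod_ge_0|exact B4|exact B3]|].
  right. unfold Rminus. rewrite (exp_plus (Re s * ln T)). ring.
Qed.

Lemma Clog_real (T : R) : (0 < T)%R -> Clog (RtoC T) = RtoC (ln T).
Proof.
  intros HT. unfold Clog. rewrite Cmod_R, Rabs_pos_eq by lra. simpl.
  unfold Rdiv. rewrite Rmult_0_l, atan_0. reflexivity.
Qed.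

(** At abscissa T the ray at height k is joined to the real axis by a vertical segment of length at
    most y, on which the integrand is exponentially small; so the primitive has the same limit X
    along all rays of the half strip. *)
Lemma ray_limit (k : R) : (Rabs k <= y)%R -> forall eps, (0 < eps)%R -> exists T0, forall T l,
  (T0 <= T)%R -> is_prim log_integrand (Clog (T, k)) l -> (Cmod (l - X) < eps)%R.
Proof.
  intros Hk eps He. destruct log_integrand_far as [K [T1 [d [Hd [HK HF]]]]].
  destruct (is_prim_is_CR log_integrand X log_integrand_real_cont HX (eps / 4)%R ltac:(lra)) as [T2 HT2].
  destruct (exp_dbl_small (Re s) d (eps / (4 * (K + 1) * (y + 1))) Hd) as [T3 HT3].
  { apply Rdiv_lt_0_compat; [lra|]. apply Rmult_lt_0_compat; lra. }
  exists (Rmax (Rmax 1 T1) (Rmax (exp T2) (exp T3))). intros T l HT Hl.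
  assert (Q1 := Rmax_l (Rmax 1 T1) (Rmax (exp T2) (exp T3))). assert (Q2 := Rmax_r (Rmax 1 T1) (Rmax (exp T2) (exp T3))).
  assert (Q3 := Rmax_l 1 T1). assert (Q4 := Rmax_r 1 T1).
  assert (Q5 := Rmax_l (exp T2) (exp T3)). assert (Q6 := Rmax_r (exp T2) (exp T3)).
  assert (PT : (0 < T)%R) by lra.
  assert (G2 : (T2 <= ln T)%R). { rewrite <- (ln_exp T2). apply Rcomplements.ln_le; [apply exp_pos|lra]. }
  assert (G3 : (T3 <= ln T)%R). { rewrite <- (ln_exp T3). apply Rcomplements.ln_le; [apply exp_pos|lra]. }
  specialize (HT3 (ln T) G3). rewrite exp_ln in HT3 by exact PT.
  destruct (hprim_exists (RtoC (ln T))) as [l0 Hl0].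
  { rewrite Cexp_RtoC. apply strip_enclosed; [left; apply exp_pos|rewrite Rabs_R0; lra]. }
  assert (B0 := HT2 (ln T) l0 G2 Hl0).
  (* The segment z = T + i t k, 0 <= t <= 1, in the variable w = log z. *)
  set (w t := Clog ((T, (t * k)%R) : C)). set (w' t := (0%R, k) / ((T, (t * k)%R) : C)).
  assert (Dg : forall t, is_Cderive (fun t => (T, (t * k)%R) : C) t (0%R, k)).
  { intros t. apply is_Cderive_pair; simpl.
    - apply (@is_derive_const R_AbsRing R_NormedModule).
    - auto_derive; [trivial|ring]. }
  assert (Nz : forall t, (T, (t * k)%R) <> RtoC 0).
  { intros t E. apply (f_equal Re) in E. simpl in E. lra. }
  assert (I : is_CInt (fun t => log_integrand (w t) * w' t) 0 1 (l - l0)).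
  { apply hpath; [lra| | | | |].
    - intros t Ht. exists (mkposreal 1 Rlt_0_1). intros u _. unfold w, w'.
      apply (is_Cderive_Clog (fun t => (T, (t * k)%R) : C)); [exact PT|apply Dg].
    - intros t Ht. apply continuous_Cdiv; [apply Nz|apply continuous_const|].
      eapply is_Cderive_continuous, Dg.
    - intros t Ht. unfold w. rewrite Cexp_Clog by exact PT. apply strip_enclosed; [lra|].
      rewrite Rabs_mult, (Rabs_pos_eq t) by lra. generalize (Rabs_pos k). nra.
    - unfold w. rewrite Rmult_0_l. change (T, 0%R) with (RtoC T). rewrite Clog_real by exact PT. exact Hl0.
    - unfold w. rewrite Rmult_1_l. exact Hl. }
  assert (Bd : (Cmod (l - l0) <= (1 - 0) * (K * exp (Re s * ln T - d * T) * y))%R).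
  { apply (is_CInt_bound_const _ 0 1 _ _ ltac:(lra)) with (2 := I). intros t Ht. rewrite Cmod_mult.
    assert (Htk : (Rabs (t * k) <= y)%R).
    { rewrite Rabs_mult, (Rabs_pos_eq t) by lra. generalize (Rabs_pos k). nra. }
    apply Rmult_le_compat; try apply Cmod_ge_0.
    - apply HF; [lra|exact Htk].
    - unfold w'. rewrite Cmod_div by apply Nz.
      assert (A1 : (Cmod (0%R, k) <= y)%R).
      { eapply Rle_trans; [apply Cmod_le_abs|]. simpl. rewrite Rabs_R0. lra. }
      assert (A2 : (1 <= Cmod (T, (t * k)%R))%R).
      { eapply Rle_trans; [|apply re_le_Cmod]. simpl. rewrite Rabs_pos_eq; lra. }
      assert (A3 := Cmod_ge_0 (0%R, k)).
      apply Rle_trans with (Cmod (0%R, k) * / 1)%R; [|lra].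
      apply Rmult_le_compat_l; [exact A3|]. apply Rinv_le_contravar; lra. }
  assert (B4 : (K * exp (Re s * ln T - d * T) * y <= eps / 4)%R).
  { apply Rle_trans with ((K + 1) * (eps / (4 * (K + 1) * (y + 1))) * (y + 1))%R.
    - assert (Pe := exp_pos (Re s * ln T - d * T)).
      apply Rmult_le_compat; try lra; [apply Rmult_le_pos; lra|]. apply Rmult_le_compat; lra.
    - right. field. split; lra. }
  assert (Tr := Cmod_triangle (l - l0) (l0 - X)).
  replace (l - l0 + (l0 - X)) with (l - X) in Tr by ring. lra.
Qed.

(** For Im w in [0, 2 pi) the cut power is e^((s - 1) w); one more e^w is the Jacobian of z =
    e^w. *)
Lemma integrand_exp (w : C) : (0 <= Im w < 2 * PI)%R -> integrand tau s (Cexp w) * Cexp w = log_integrand w.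
Proof.
  intros Hw. unfold integrand, log_integrand. rewrite Cpow_cut_exp.
  - replace (Cexp (s * w)) with (Cexp ((s - 1) * w) * Cexp w) by (rewrite <- Cexp_add; f_equal; ring). ring.
  - generalize PI_RGT_0. lra.
  - lra.
Qed.

Let x0 := ray_start r y.
Let al0 := arc_start r y.

Lemma ray_start_pos : (0 < x0)%R.
Proof. unfold x0, ray_start. apply sqrt_lt_R0. simpl. nra. Qed.

Lemma arc_start_bounds : (0 < al0 < PI / 2)%R.
Proof.
  unfold al0, arc_start. assert (H0 : (0 < y / r)%R) by (apply Rdiv_lt_0_compat; lra).
  assert (H1 : (y / r < 1)%R).
  { apply Rmult_lt_reg_r with r; [lra|]. unfold Rdiv. rewrite Rmult_assoc, Rinv_l by lra. lra. }
  assert (B := asin_bound_lt (y / r) ltac:(lra)). split; [|lra].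
  apply Rnot_le_lt. intros Hn.
  assert (sin (asin (y / r)) <= 0)%R.
  { destruct Hn as [Hn|Hn]; [left; apply sin_lt_0_var; generalize PI_RGT_0; lra|].
    rewrite Hn, sin_0. lra. }
  rewrite sin_asin in H by lra. lra.
Qed.

(** The rays and the arc meet at r e^(i al0) and r e^(-i al0), so that the primitive takes matching
    values on them there. *)
Lemma arc_point (e : R) : (e = 1 \/ e = -1)%R -> Clog (x0, (e * y)%R) = (ln r, (e * al0)%R).
Proof.
  intros He. assert (B := arc_start_bounds).
  rewrite <- (Clog_unique (ln r, (e * al0)%R)).
  - f_equal. unfold Cexp. cbn [Re Im fst snd]. rewrite exp_ln by lra.
    assert (S : sin al0 = (y / r)%R).
    { unfold al0, arc_start. apply sin_asin. split.
      - assert (0 < y / r)%R by (apply Rdiv_lt_0_compat; lra). lra.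
      - apply Rmult_le_reg_r with r; [lra|]. unfold Rdiv. rewrite Rmult_assoc, Rinv_l by lra. lra. }
    assert (Cc : (r * cos al0 = x0)%R).
    { unfold x0, ray_start. symmetry. apply sqrt_lem_1; [nra| |].
      - apply Rmult_le_pos; [lra|]. apply cos_ge_0; lra.
      - assert (Q := sin2_cos2 al0). unfold Rsqr in Q. rewrite S in Q.
        assert (E : (cos al0 * cos al0 = 1 - y / r * (y / r))%R) by lra.
        replace (r * cos al0 * (r * cos al0))%R with (r * r * (cos al0 * cos al0))%R by ring.
        rewrite E. field. lra. }
    destruct He as [-> | ->].
    + rewrite !Rmult_1_l. apply C_eq; simpl; rewrite ?S; [lra|field; lra].
    + replace (-1 * al0)%R with (- al0)%R by ring. rewrite cos_neg, sin_neg, S.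
      apply C_eq; simpl; [lra|field; lra].
  - cbn [Im snd]. destruct He as [-> | ->]; lra.
Qed.

(* [e = 1] is the upper ray, [e = -1] the lower one, where [arg z] lies one full turn above the
   principal argument; [c] is the corresponding shift of [log z]. *)
Lemma ray_int (e : R) (c m l0 : C) : (e = 1%R /\ c = 0 /\ m = 1 \/ e = (-1)%R /\ c = Ci * RtoC (2 * PI) /\ m = mono) ->
  is_prim log_integrand (Clog (x0, (e * y)%R)) l0 ->
  @is_RInt_gen C_R_NormedModule (fun t => integrand tau s (t, (e * y)%R)) (at_point x0)
    (Rbar_locally p_infty) (m * X - m * l0).
Proof.
  intros Hc Hl0. assert (Hx := ray_start_pos).
  assert (Habs : (Rabs (e * y) <= y)%R).
  { destruct Hc as [[-> _]|[-> _]]; [rewrite Rmult_1_l, Rabs_pos_eq|rewrite Rabs_left]; lra. }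
  assert (Pr : forall T, (0 < T)%R -> exists l, is_prim log_integrand (Clog (T, (e * y)%R)) l).
  { intros T HT. apply hprim_exists. rewrite Cexp_Clog by exact HT. apply strip_enclosed; [lra|exact Habs]. }
  (* A choice of primitives along the ray; the default value 0 is taken only for T <= 0, to the left
     of the ray. *)
  set (g T := match Rlt_dec 0 T with
     | left HT => m * proj1_sig (constructive_indefinite_description _ (Pr T HT)) - m * l0
     | right _ => 0 end).
  assert (Hg : forall T, (0 < T)%R -> exists l, is_prim log_integrand (Clog (T, (e * y)%R)) l /\ g T = m * l - m * l0).
  { intros T HT. unfold g. destruct (Rlt_dec 0 T) as [H|H]; [|contradiction].
    exists (proj1_sig (constructive_indefinite_description _ (Pr T H))). split; [|reflexivity].
    exact (proj2_sig (constructive_indefinite_description _ (Pr T H))). }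
  assert (Mc : forall w, log_integrand (w + c) = m * log_integrand w).
  { intros w. destruct Hc as [[_ [-> ->]]|[_ [-> ->]]]; [rewrite Cplus_0_r; ring|apply log_integrand_mono]. }
  assert (Dg : forall t, is_Cderive (fun t => (t, (e * y)%R) : C) t (RtoC 1)).
  { intros t. apply is_Cderive_pair; simpl.
    - apply (is_derive_id (K := R_AbsRing)).
    - apply (@is_derive_const R_AbsRing R_NormedModule). }
  apply (is_RInt_gen_to_infty _ _ g).
  - intros T HT. destruct (Hg T ltac:(lra)) as [l [Hl Eg]]. rewrite Eg.
    apply (is_CInt_eq _ _ _ (m * (l - l0))); [|ring].
    apply (is_CInt_ext (fun t => m * (log_integrand (Clog (t, (e * y)%R)) * (1 / ((t, (e * y)%R) : C))))).
    { rewrite Rmin_left, Rmax_right by exact HT. intros t Ht.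
      assert (Ht0 : (0 < Re (t, (e * y)%R))%R) by (simpl; lra).
      assert (Ez : Cexp (Clog (t, (e * y)%R) + c) = (t, (e * y)%R)).
      { destruct Hc as [[_ [-> _]]|[_ [-> _]]]; [rewrite Cplus_0_r|rewrite Cexp_turn]; apply Cexp_Clog, Ht0. }
      rewrite Cmult_assoc, <- Mc, <- integrand_exp, Ez.
      - field. intros E. rewrite E in Ht0. simpl in Ht0. lra.
      - assert (Bc := Clog_bound (t, (e * y)%R)).
        replace (Im (Clog (t, (e * y)%R) + c)) with (Im (Clog (t, (e * y)%R)) + Im c)%R by reflexivity.
        destruct Hc as [[-> [-> _]]|[-> [-> _]]].
        + simpl Im at 2. simpl Im at 3. assert (0 <= atan (1 * y / t))%R; [|unfold Clog in *; simpl in *; lra].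
          rewrite <- atan_0. left. apply atan_increasing. rewrite Rmult_1_l. apply Rdiv_lt_0_compat; lra.
        + assert (Q : (atan (-1 * y / t) < 0)%R).
          { rewrite <- atan_0. apply atan_increasing. unfold Rdiv.
            assert (0 < / t)%R by (apply Rinv_0_lt_compat; lra). nra. }
          replace (Im (Ci * RtoC (2 * PI))) with (2 * PI)%R by (simpl; ring).
          unfold Clog in *; simpl in *; lra. }
    apply is_CInt_mult.
    apply (hpath (fun t => Clog (t, (e * y)%R)) (fun t => 1 / ((t, (e * y)%R) : C))).
    + exact HT.
    + intros t Ht. exists (mkposreal x0 Hx). intros u Hu.
      apply (is_Cderive_Clog (fun t => (t, (e * y)%R) : C)); [|apply Dg].
      change (Rabs (u - t) < x0)%R in Hu. apply Rabs_def2 in Hu. simpl. lra.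
    + intros t Ht. apply continuous_Cdiv; [|apply continuous_const|eapply is_Cderive_continuous, Dg].
      intros E. apply (f_equal Re) in E. simpl in E. lra.
    + intros t Ht. rewrite Cexp_Clog by (simpl; lra). apply strip_enclosed; [lra|exact Habs].
    + exact Hl0.
    + exact Hl.
  - intros eps He. assert (Pm : (0 < Cmod m + 1)%R) by (generalize (Cmod_ge_0 m); lra).
    destruct (ray_limit (e * y) Habs (eps / (Cmod m + 1))%R) as [T0 HT0]; [apply Rdiv_lt_0_compat; lra|].
    exists (Rmax 1 T0). intros T HT. assert (M1 := Rmax_l 1 T0). assert (M2 := Rmax_r 1 T0).
    destruct (Hg T ltac:(lra)) as [l [Hl Eg]]. rewrite Eg.
    replace (m * l - m * l0 - (m * X - m * l0)) with (m * (l - X)) by ring. rewrite Cmod_mult.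
    specialize (HT0 T l ltac:(lra) Hl). apply (Rmult_lt_compat_l (Cmod m + 1)) in HT0; [|exact Pm].
    replace ((Cmod m + 1) * (eps / (Cmod m + 1)))%R with eps in HT0 by (field; lra).
    generalize (Cmod_ge_0 (l - X)). nra.
Qed.

(** In w the arc is the vertical segment from ln r + i al0 to ln r + i (2 pi - al0); its end is the
    lower junction lifted by a full turn, whence [mono]. *)
Lemma arc_int (l1 l2 : C) : is_prim log_integrand (Clog (x0, (1 * y)%R)) l1 -> is_prim log_integrand (Clog (x0, (-1 * y)%R)) l2 ->
  is_CInt (on_arc (integrand tau s) r) (arc_start r y) (arc_end r y) (mono * l2 - l1).
Proof.
  intros H1 H2. assert (B := arc_start_bounds).
  assert (Hx := ray_start_pos). fold al0.
  assert (Eend : arc_end r y = (2 * PI - al0)%R) by reflexivity. rewrite Eend.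
  apply hprim_mono in H2.
  2:{ rewrite Cexp_Clog by exact Hx. apply strip_enclosed; [lra|]. rewrite Rabs_left; lra. }
  rewrite arc_point in H1, H2 by auto.
  set (w t := RtoC (ln r) + Ci * RtoC t).
  apply (is_CInt_ext (fun t => log_integrand (w t) * Ci)).
  { rewrite Rmin_left, Rmax_right by lra. intros t Ht.
    assert (Ew : Cexp (w t) = RtoC r * Cexp (Ci * RtoC t)).
    { unfold w. rewrite Cexp_add, Cexp_RtoC, exp_ln by lra. reflexivity. }
    rewrite <- integrand_exp.
    - unfold on_arc. rewrite Ew. ring.
    - replace (Im (w t)) with t by (unfold w; simpl; ring). lra. }
  apply (hpath w (fun _ => Ci)).
  - lra.
  - intros t Ht. exists (mkposreal 1 Rlt_0_1). intros u _. unfold w.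
    eapply is_Cderive_eq; [apply is_Cderive_plus; [apply is_Cderive_const|apply is_Cderive_linear]|ring].
  - intros. apply continuous_const.
  - intros t Ht. left. rewrite Cmod_Cexp. replace (Re (w t)) with (ln r) by (unfold w; simpl; ring).
    rewrite exp_ln by lra. lra.
  - replace (w al0) with (ln r, (1 * al0)%R); [exact H1|]. unfold w. apply C_eq; simpl; ring.
  - replace (w (2 * PI - al0)%R) with ((ln r, (-1 * al0)%R) + Ci * RtoC (2 * PI)); [exact H2|].
    unfold w. apply C_eq; simpl; ring.
Qed.

(** Upper ray, arc and lower ray give -(X - l1), mono l2 - l1 and mono X - mono l2; the values at
    the two junctions cancel. *)
Lemma contour_value : ex_contour_integral (integrand tau s) r y /\
  contour_integral (integrand tau s) r y = (mono - 1) * X.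
Proof.
  assert (Hx := ray_start_pos).
  destruct (hprim_exists (Clog (x0, (1 * y)%R))) as [l1 Hl1].
  { rewrite Cexp_Clog by exact Hx. apply strip_enclosed; [lra|]. rewrite Rabs_pos_eq; lra. }
  destruct (hprim_exists (Clog (x0, (-1 * y)%R))) as [l2 Hl2].
  { rewrite Cexp_Clog by exact Hx. apply strip_enclosed; [lra|]. rewrite Rabs_left; lra. }
  assert (I1 := ray_int 1%R 0 1 l1 (or_introl (conj eq_refl (conj eq_refl eq_refl))) Hl1).
  assert (I2 := ray_int (-1)%R _ mono l2 (or_intror (conj eq_refl (conj eq_refl eq_refl))) Hl2).
  assert (I3 := arc_int l1 l2 Hl1 Hl2).
  apply is_RInt_gen_swap in I1.
  replace (1 * y)%R with y in I1 by ring. replace (-1 * y)%R with (- y)%R in I2 by ring.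
  assert (U1 := @is_RInt_gen_unique C_R_CompleteNormedModule _ _ _ _ _ _ I1).
  assert (U2 := @is_RInt_gen_unique C_R_CompleteNormedModule _ _ _ _ _ _ I2).
  assert (U3 := CInt_unique _ _ _ _ I3).
  split.
  - split; [eexists; exact I1|]. split; [eexists; exact I3|eexists; exact I2].
  - unfold contour_integral, on_upper_ray, on_lower_ray. rewrite U3.
    match goal with |- ?A + _ + ?B = _ => replace A with (- (1 * X - 1 * l1)) by (symmetry; exact U1);
      replace B with (mono * X - mono * l2) by (symmetry; exact U2) end.
    ring.
Qed.

End Contour.

(** * The main theorem *)

(** The lattice sum as an explicit function of s, so that its continuity at the integers can be
    stated. *)
Definition Etilde (tau s : C) : C :=
  (1 + Cexp (- (s * (Ci * RtoC PI)))) * cone_lim 1 tau s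
  + (Cexp (- (s * (Ci * RtoC (PI / 2)))) + Cexp (s * (Ci * RtoC (PI / 2)))) * cone_lim (- (Ci * tau)) (- Ci) s.

Section Final.
Variable tau : C.
Hypothesis Hre : (- (1 / 2) < Re tau <= 1 / 2)%R.
Hypothesis Him : (0 < Im tau)%R.

Lemma Etilde_correct (s : C) : (2 < Re s)%R -> is_Etilde tau s (Etilde tau s).
Proof.
  intros Hs. apply Clim_filterlim.
  apply (Clim_ext (fun K => (1 + Cexp (- (s * (Ci * RtoC PI)))) * cone_sum 1 tau s K
    + (Cexp (- (s * (Ci * RtoC (PI / 2)))) + Cexp (s * (Ci * RtoC (PI / 2)))) * cone_sum (- (Ci * tau)) (- Ci) s K)).
  { intros K. symmetry. apply Etilde_cones; [lra|exact Him]. }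
  apply Clim_plus; apply Clim_mult_const; apply cone_lim_correct; try exact Hs.
  - exact (cone1 tau Hre).
  - exact (cone2 tau Him).
Qed.

Lemma Etilde_continuous (s : C) : (2 < Re s)%R -> Ccontinuous (Etilde tau) s.
Proof.
  intros Hs. unfold Etilde.
  assert (Ce : forall c : C, Ccontinuous (fun s => Cexp (s * c)) s).
  { intros c. apply continuous_Cexp, continuous_Cmult; [apply continuous_id|apply continuous_const]. }
  assert (Cn : forall c : C, Ccontinuous (fun s => Cexp (- (s * c))) s).
  { intros c. apply continuous_Cexp, continuous_Copp, continuous_Cmult; [apply continuous_id|apply continuous_const]. }
  apply continuous_Cplus; apply continuous_Cmult.
  - apply continuous_Cplus; [apply continuous_const|apply Cn].
  - apply cone_lim_continuous; [exact (cone1 tau Hre)|exact Hs].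
  - apply continuous_Cplus; [apply Cn|apply Ce].
  - apply cone_lim_continuous; [exact (cone2 tau Him)|exact Hs].
Qed.

Variables r y : R.
Hypothesis Hy : (0 < y)%R.
Hypothesis Hyr : (y < r)%R.
Hypothesis Hencl : forall z : C, sing tau z -> ~ enclosed r y z.

Lemma contour_Mellin (s : C) : (2 < Re s)%R -> exists X1 X2,
  is_CR (fun u => Cexp (s * RtoC u) * kern 1 tau (RtoC (exp u))) X1 /\
  is_CR (fun u => Cexp (s * RtoC u) * kern (- (Ci * tau)) (- Ci) (RtoC (exp u))) X2 /\
  ex_contour_integral (integrand tau s) r y /\
  contour_integral (integrand tau s) r y = (mono s - 1) * (Cexp (- (Ci * s * RtoC PI / 2)) * X1 + X2).
Proof.
  intros Hs.
  destruct (Mellin_exists 1 tau (cone1 tau Hre) s Hs) as [X1 H1].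
  destruct (Mellin_exists _ _ (cone2 tau Him) s Hs) as [X2 H2].
  exists X1, X2. split; [exact H1|]. split; [exact H2|].
  apply contour_value; try assumption.
  assert (C1 := Mellin_cont 1 tau (cone1 tau Hre) s). assert (C2 := Mellin_cont _ _ (cone2 tau Him) s).
  apply (is_CR_ext (fun u => Cexp (- (Ci * s * RtoC PI / 2)) * (Cexp (s * RtoC u) * kern 1 tau (RtoC (exp u)))
     + Cexp (s * RtoC u) * kern (- (Ci * tau)) (- Ci) (RtoC (exp u)))).
  { intros u. unfold log_integrand. rewrite F_kern, Cexp_RtoC. ring. }
  apply is_CR_plus; [|exact C2| |exact H2].
  - intros u. apply continuous_Cmult; [apply continuous_const|apply C1].
  - apply is_CR_mult; assumption.
Qed.

(** With u = e^(i pi s / 2) and v = 1/u, the lattice side is (u + v)(v S1 + S2), since 1 + v^2 = v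
    (u + v). On the contour side v^2 (u^4 - 1) = u^2 - v^2 is 2 i sin (pi s), which the reflection
    formula removes together with the two Gamma factors. *)
Lemma Etilde_contour (s : C) : (2 < Re s)%R -> (forall n : nat, s <> RtoC (INR n)) ->
  Etilde tau s = contour_side tau r y s.
Proof.
  intros Hs Hn. destruct (contour_Mellin s Hs) as [X1 [X2 [H1 [H2 [_ Hc]]]]].
  destruct (Gam_exists s ltac:(lra)) as [g Hg].
  assert (Rf := reflection s g ltac:(lra) Hn Hg).
  (* [g] times a cone sum is twice a Mellin integral: both are limits of [g] times the partial
     sums. *)
  assert (E1 := Clim_unique _ _ _ (Clim_mult_const g _ _ (cone_lim_correct _ _ (cone1 tau Hre) s Hs))
    (cone_sum_Mellin _ _ (cone1 tau Hre) s g X1 Hs Hg H1)).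
  assert (E2 := Clim_unique _ _ _ (Clim_mult_const g _ _ (cone_lim_correct _ _ (cone2 tau Him) s Hs))
    (cone_sum_Mellin _ _ (cone2 tau Him) s g X2 Hs Hg H2)).
  assert (PC : RtoC PI <> 0) by (apply RtoC_neq; generalize PI_RGT_0; lra).
  assert (IC := Ci_nz).
  unfold contour_side. rewrite Hc. unfold Etilde, mono, Ccos.
  set (S1 := cone_lim 1 tau s) in *. set (S2 := cone_lim (- (Ci * tau)) (- Ci) s) in *.
  assert (Eh : RtoC (PI / 2) = RtoC PI / 2) by (rewrite RtoC_div by lra; reflexivity).
  set (u := Cexp (s * (Ci * RtoC (PI / 2)))).
  set (v := Cexp (- (s * (Ci * RtoC (PI / 2))))).
  assert (Uv : v * u = 1) by apply Cexp_opp_l.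
  replace (Cexp (Ci * (RtoC PI / 2 * s))) with u by (unfold u; rewrite Eh; f_equal; field).
  replace (Cexp (- (Ci * (RtoC PI / 2 * s)))) with v by (unfold v; rewrite Eh; f_equal; field).
  replace (Cexp (- (Ci * s * RtoC PI / 2))) with v by (unfold v; rewrite Eh; f_equal; field).
  replace (Cexp (- (s * (Ci * RtoC PI)))) with (v * v) by (unfold v; rewrite <- Cexp_add, Eh; f_equal; field).
  replace (Cexp (- (Ci * s * RtoC PI))) with (v * v) by (unfold v; rewrite <- Cexp_add, Eh; f_equal; field).
  replace (Cexp (s * (Ci * RtoC (2 * PI)))) with (u * u * (u * u))
    by (unfold u; rewrite <- !Cexp_add, Eh, RtoC_mult; f_equal; field).
  unfold Csin in Rf.
  replace (Cexp (Ci * (RtoC PI * s))) with (u * u) in Rf by (unfold u; rewrite <- Cexp_add, Eh; f_equal; field).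
  replace (Cexp (- (Ci * (RtoC PI * s)))) with (v * v) in Rf by (unfold v; rewrite <- Cexp_add, Eh; f_equal; field).
  set (G := CGamma (1 - s)) in *.
  replace X1 with (g * S1 / 2) by (rewrite E1; field).
  replace X2 with (g * S2 / 2) by (rewrite E2; field).
  transitivity ((u + v) * (v * S1 + S2) * (g * G * ((u * u - v * v) / (2 * Ci))) / RtoC PI).
  - rewrite Rf. transitivity ((v * u + v * v) * S1 + (v + u) * S2); [rewrite Uv; ring|field; exact PC].
  - transitivity ((u + v) * (v * S1 + S2) * (g * G * (((v * u) * (v * u) * (u * u) - v * v) / (2 * Ci))) / RtoC PI).
    + rewrite Uv. field. split; assumption.
    + field. split; assumption.
Qed.

End Final.

Theorem theorem6 (tau : C)
  (htau_re : (- (1 / 2) < Re tau <= 1 / 2)%R)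
  (htau_im : (0 < Im tau)%R)
  (htau_mod : (1 <= Cmod tau)%R)
  (htau_arc : Cmod tau = 1%R -> (0 <= Re tau)%R)
  (rho r y : R)
  (hrho : is_min_modulus (sing tau) rho)
  (hy : (0 < y)%R) (hyr : (y < r)%R) (hr : (r < rho)%R)
  (hencl : forall z : C, sing tau z -> ~ enclosed r y z)
  (s : C) (hs : (2 < Re s)%R) :
  ex_contour_integral (integrand tau s) r y /\
  exists E : C,
    is_Etilde tau s E /\
    ((forall n : nat, s <> RtoC (INR n)) -> E = contour_side tau r y s) /\
    (forall n : nat, s = RtoC (INR n) ->
       filterlim (contour_side tau r y) (locally' s) (locally E)).
Proof.
  split.
  - destruct (contour_Mellin tau htau_re htau_im r y hy hyr hencl s hs) as [X1 [X2 [_ [_ [H _]]]]]. exact H.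
  - exists (Etilde tau s). split; [|split].
    + apply Etilde_correct; assumption.
    + intros Hn. apply Etilde_contour; assumption.
    + intros n Hn.
      apply (filterlim_ext_loc (Etilde tau)).
      (* Real parts closer than 1 to that of s leave no integer but s itself, and the distance Re s
         - 2 keeps t in the half plane Re t > 2. *)
      * assert (Hr : (0 < Rmin 1 (Re s - 2))%R) by (apply Rmin_pos; lra).
        exists (mkposreal _ Hr). intros t [B1 B2] Ht.
        change (Rabs (Re t - Re s) < Rmin 1 (Re s - 2))%R in B1.
        assert (M1 := Rmin_l 1 (Re s - 2)). assert (M2 := Rmin_r 1 (Re s - 2)).
        apply Rabs_def2 in B1.
        apply Etilde_contour; try assumption; [lra|].
        assert (B3 : (-1 < Re t - Re s < 1)%R) by lra.
        intros k Hk. apply Ht. rewrite Hk, Hn. f_equal. f_equal.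
        rewrite Hk, Hn in B3. simpl in B3. rewrite !INR_IZR_INZ, <- minus_IZR in B3.
        assert (C1 : (Z.of_nat k - Z.of_nat n < 1)%Z) by (apply lt_IZR; lra).
        assert (C2 : (-1 < Z.of_nat k - Z.of_nat n)%Z) by (apply lt_IZR; lra).
        lia.
      * intros P HP. assert (Hc := Etilde_continuous tau htau_re htau_im s hs P HP).
        unfold filtermap, locally', within in *. revert Hc. apply filter_imp. auto.
Qed.
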